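(* Let $p$ be a prime, $n\ge1$, $0\le k\le n-1$, $\nu\ge1$ and $d_1,\dots,d_\nu\ge1$ integers with $$\sum_{j=1}^{\nu}\binom{k+d_j}{d_j}=(k+1)(n-k).$$ Let $f_1,\dots,f_\nu\in\mathbb{Z}_p[x_0,\dots,x_n]$ be independent random homogeneous polynomials of degrees $d_1,\dots,d_\nu$ sampled from the uniform distribution, let $\psi_f$ be the associated random map, and $J\psi_f(0)$ its Jacobian matrix at $0$. Then the expected number of $k$-flats on $Z(f_1,\dots,f_\nu)\subset\mathbb{Q}_p\mathrm{P}^n$ is $$\mathbb{E}\,\#\{\sigma_f=0\}=\mu(\mathbb{Q}_p\mathbb{G}_{k,n})\cdot\mathbb{E}\left\{|\det(J\psi_f(0))|_p\right\}.$$
   Context: $\lambda$ is the Haar measure on $\mathbb{Q}_p^N$ normalized by $\lambda(\mathbb{Z}_p^N)=1$; its restriction to $\mathbb{Z}_p^N$ is the uniform distribution. $|\cdot|_p$ is the $p$-adic absolute value. The uniform distribution on homogeneous polynomials of degree $d$ in $x_0,\dots,x_n$ over $\mathbb{Z}_p$ is the law of $f=\sum_{|\alpha|=d}\xi_\alpha x_0^{\alpha_0}\cdots x_n^{\alpha_n}$ with $\xi_\alpha$ i.i.d. uniform in $\mathbb{Z}_p$. $\mathbb{Q}_p\mathbb{G}_{k,n}$ is the Grassmannian of $k$-flats of $\mathbb{Q}_p\mathrm{P}^n$, i.e. of projective subspaces $\ell=P(L)$ with $L\subset\mathbb{Q}_p^{n+1}$ linear of dimension $k+1$. It carries the measure $\mu=\frac{1}{\lambda(\mathrm{GL}_{n-k}(\mathbb{Z}_p))\lambda(\mathrm{GL}_{k+1}(\mathbb{Z}_p))}q_*\lambda$,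 where $\mathrm{GL}_N(\mathbb{Z}_p)\subset\mathbb{Z}_p^{N\times N}$ and $q:\mathrm{GL}_{n+1}(\mathbb{Z}_p)\to\mathbb{Q}_p\mathbb{G}_{k,n}$ sends $M$ to the column span of $M\begin{pmatrix}\mathbf{1}_{k+1}\\0\end{pmatrix}$. Hence $\mu(\mathbb{Q}_p\mathbb{G}_{k,n})=\frac{\lambda(\mathrm{GL}_{n+1}(\mathbb{Z}_p))}{\lambda(\mathrm{GL}_{k+1}(\mathbb{Z}_p))\lambda(\mathrm{GL}_{n-k}(\mathbb{Z}_p))}$, where $\lambda(\mathrm{GL}_N(\mathbb{Z}_p))=\prod_{i=1}^N(1-p^{-i})$. $\sigma_f=\sigma_{f_1}\oplus\cdots\oplus\sigma_{f_\nu}$ is the section of $\bigoplus_{j}\mathrm{Sym}^{(d_j)}(\tau_{k,n}^* )$ over $\mathbb{Q}_p\mathbb{G}_{k,n}$ ($\tau_{k,n}$ the tautological bundle) given by $\sigma_{f_j}(P(L))=f_j|_L$. So $\{\sigma_f=0\}$ is the set of $k$-flats $P(L)$ with $f_j|_L=0$ for all $j$, i.e. the $k$-flats on $Z(f_1,\dots,f_\nu)$. The map $\psi_f:\mathbb{Q}_p^{(n-k)\times(k+1)}\to\mathbb{Q}_p^{(n-k)(k+1)}$ sends $A$ to the list of all coefficients (monomial basis in $y=(y_0,\dots,y_k)$), for $j=1,\dots,\nu$, of the polynomials $f_j\left(\begin{pmatrix}\mathbf{1}_{k+1}\\ A\end{pmatrix}y\right)\in\mathbb{Q}_p[y_0,\dots,y_k]_{(d_j)}$.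 By the dimension condition $J\psi_f(0)$ is a square matrix of size $(k+1)(n-k)$. *)

(* Defs.v *)
From HB Require Import structures.
From mathcomp Require Import all_boot all_order all_algebra.
From mathcomp Require Import fraction.
From mathcomp Require Import mpoly.
From mathcomp Require Import all_classical all_reals all_analysis.

Set Implicit Arguments.
Unset Strict Implicit.
Unset Printing Implicit Defensive.

Import Order.TTheory GRing.Theory Num.Theory.

Local Open Scope classical_set_scope.
Local Open Scope ring_scope.

Definition padic_compatible (p : nat) (z : nat -> nat) :=
  forall n, (z n < p ^ n)%N /\ z n = (z n.+1 %% p ^ n)%N.

(* Z_p as the inverse limit of the rings Z/p^n: [z n] is the representative in
   [0, p^n) of the residue of z modulo p^n. *)
Record padic_int (p : nat) (p_pr : prime p) := PadicInt {
  padic_res :> nat -> nat;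
  _ : `[< padic_compatible p padic_res >] }.

Section PadicIntegers.
Variables (p : nat) (p_pr : prime p).

Local Notation padic_int := (padic_int p_pr).
Local Notation PadicInt h := (@PadicInt p p_pr _ (asboolT h)).
Local Notation padic_compatible := (padic_compatible p).

HB.instance Definition _ := [isSub for @padic_res p p_pr].
HB.instance Definition _ := [Choice of padic_int by <:].

Let pn_gt0 n : (0 < p ^ n)%N.
Proof. by rewrite expn_gt0 prime_gt0. Qed.

Lemma padic_res_lt (z : padic_int) n : (z n < p ^ n)%N.
Proof. by case: z => z /= /asboolP /(_ n)[]. Qed.

Lemma padic_res_mod (z : padic_int) m n : (n <= m)%N -> (z m %% p ^ n)%N = z n.
Proof.
elim: m => [|m IH].
  by rewrite leqn0 => /eqP ->; rewrite modn_small ?padic_res_lt.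
rewrite leq_eqVlt => /orP[/eqP ->|]; first by rewrite modn_small ?padic_res_lt.
rewrite ltnS => le_nm; rewrite -(IH le_nm).
have -> : z m = (z m.+1 %% p ^ m)%N by case: z {IH} => z /= /asboolP /(_ m)[].
by rewrite modn_dvdm ?dvdn_exp2l.
Qed.

Lemma padic_int_eqP (x y : padic_int) : (forall n, x n = y n) <-> x = y.
Proof. by split=> [xy|->//]; apply: val_inj; apply: funext. Qed.

Lemma padic_compatible_mod (u : nat -> nat) :
  (forall n, u n.+1 = u n %[mod p ^ n]) ->
  padic_compatible (fun n => (u n %% p ^ n)%N).
Proof.
move=> uS n; split; first by rewrite ltn_pmod.
by rewrite modn_dvdm ?dvdn_exp2l.
Qed.

Lemma padic_resS (z : padic_int) n : z n.+1 = z n %[mod p ^ n].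
Proof. by rewrite padic_res_mod// modn_small// padic_res_lt. Qed.

Let natc_compat k : padic_compatible (fun n => (k %% p ^ n)%N).
Proof. exact: (@padic_compatible_mod (fun=> k)). Qed.

Definition padic_natc k := PadicInt (natc_compat k).

Let add_compat (x y : padic_int) :
  padic_compatible (fun n => ((x n + y n) %% p ^ n)%N).
Proof.
apply: (@padic_compatible_mod (fun n => x n + y n)%N) => n.
by rewrite -modnDm !padic_resS modnDm.
Qed.

Definition padic_add x y := PadicInt (add_compat x y).

Let mul_compat (x y : padic_int) :
  padic_compatible (fun n => ((x n * y n) %% p ^ n)%N).
Proof.
apply: (@padic_compatible_mod (fun n => x n * y n)%N) => n.
by rewrite -modnMm !padic_resS modnMm.
Qed.

Definition padic_mul x y := PadicInt (mul_compat x y).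

Let opp_compat (x : padic_int) :
  padic_compatible (fun n => ((p ^ n - x n) %% p ^ n)%N).
Proof.
apply: (@padic_compatible_mod (fun n => p ^ n - x n)%N) => n.
have lt1 := padic_res_lt x n.+1; have lt0 := padic_res_lt x n.
apply/eqP; rewrite -(eqn_modDr (x n)) subnK ?(ltnW lt0)//.
rewrite -modnDmr -padic_resS modnDmr subnK ?(ltnW lt1)//.
by rewrite modnn expnS modnMl.
Qed.

Definition padic_opp x := PadicInt (opp_compat x).

Let addA : associative padic_add.
Proof.
move=> x y z; apply/padic_int_eqP => n /=.
by rewrite modnDml modnDmr addnA.
Qed.

Let addC : commutative padic_add.
Proof. by move=> x y; apply/padic_int_eqP => n /=; rewrite addnC. Qed.

Let add0 : left_id (padic_natc 0) padic_add.
Proof.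
by move=> x; apply/padic_int_eqP => n /=; rewrite mod0n modn_small// padic_res_lt.
Qed.

Let addN : left_inverse (padic_natc 0) padic_opp padic_add.
Proof.
move=> x; apply/padic_int_eqP => n /=.
by rewrite modnDml subnK ?modnn ?mod0n// ltnW// padic_res_lt.
Qed.

HB.instance Definition _ := GRing.isZmodule.Build padic_int addA addC add0 addN.

Let mulA : associative padic_mul.
Proof.
move=> x y z; apply/padic_int_eqP => n /=.
by rewrite modnMml modnMmr mulnA.
Qed.

Let mulC : commutative padic_mul.
Proof. by move=> x y; apply/padic_int_eqP => n /=; rewrite mulnC. Qed.

Let mul1 : left_id (padic_natc 1) padic_mul.
Proof.
move=> x; apply/padic_int_eqP => n /=.
by rewrite modnMml mul1n modn_small// padic_res_lt.
Qed.

Let mulDl : left_distributive padic_mul padic_add.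
Proof.
move=> x y z; apply/padic_int_eqP => n /=.
by rewrite modnMml modnDm mulnDl.
Qed.

Let one_neq0 : padic_natc 1 != padic_natc 0.
Proof.
apply/eqP => /padic_int_eqP /(_ 1%N) /=.
by rewrite mod0n modn_small ?expn1 ?prime_gt1.
Qed.

HB.instance Definition _ := GRing.Zmodule_isComNzRing.Build padic_int
  mulA mulC mul1 mulDl one_neq0.

Definition padic_unit : pred padic_int := fun x => `[< exists y, y * x = 1 >].
Definition padic_int_inv (x : padic_int) : padic_int :=
  xget x [set y | y * x = 1].

Let mulVx : {in padic_unit, left_inverse 1 padic_int_inv *%R}.
Proof. by move=> x /asboolP xU; have := xgetPex x xU. Qed.

Let unitPl (x y : padic_int) : y * x = 1 -> padic_unit x.
Proof. by move=> yx1; apply/asboolP; exists y. Qed.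

Let invr_out : {in [predC padic_unit], padic_int_inv =1 id}.
Proof.
move=> x; rewrite inE /= => /asboolPn xNU; apply: xgetPN => y yx1.
by apply: xNU; exists y.
Qed.

HB.instance Definition _ := GRing.ComNzRing_hasMulInverse.Build padic_int
  mulVx unitPl invr_out.

Lemma padic_int0 n : (0 : padic_int) n = 0%N.
Proof. exact: mod0n. Qed.

Lemma padic_intD (x y : padic_int) n : (x + y) n = ((x n + y n) %% p ^ n)%N.
Proof. by []. Qed.

Lemma padic_intM (x y : padic_int) n : (x * y) n = ((x n * y n) %% p ^ n)%N.
Proof. by []. Qed.

Lemma padic_res0 (z : padic_int) : z 0%N = 0%N.
Proof. by have := padic_res_lt z 0; rewrite expn0; case: (z 0%N). Qed.

Lemma padic_int_neq0 (z : padic_int) : z != 0 <-> exists n, z n.+1 != 0%N.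
Proof.
split=> [z0|[n zn]]; last by apply: contraNneq zn => ->; rewrite padic_int0.
apply: contrapT => H; move/eqP: z0; apply; apply/padic_int_eqP => n.
rewrite padic_int0; case: n => [|n]; first exact: padic_res0.
by apply/eqP; apply: contrapT => /negP zn; apply: H; exists n.
Qed.

(* The largest v such that p^v divides z, for z <> 0 *)
Definition padic_val (z : padic_int) : nat :=
  if pselect (exists n, z n.+1 != 0%N) is left h then ex_minn h else 0%N.

Lemma padic_valP (z : padic_int) n : z != 0 -> (z n == 0%N) = (n <= padic_val z)%N.
Proof.
move=> /padic_int_neq0 z0; rewrite /padic_val; case: pselect => // h.
case: ex_minnP => m zm mmin; apply/idP/idP => [zn|le_nm].
  rewrite leqNgt; apply: contra zm => lt_mn.
  by rewrite -(padic_res_mod z lt_mn) (eqP zn) mod0n.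
case: n le_nm => [|n lt_nm]; first by rewrite padic_res0.
by apply: contraTT lt_nm => /mmin; rewrite -leqNgt.
Qed.

Lemma padic_res_eq0 (z : padic_int) m n : (n <= m)%N ->
  (z n == 0%N) = (p ^ n %| z m)%N.
Proof. by move=> nm; rewrite -(padic_res_mod z nm). Qed.

Lemma padic_logn (z : padic_int) m : z != 0 -> (padic_val z < m)%N ->
  (0 < z m)%N /\ logn p (z m) = padic_val z.
Proof.
move=> z0 vm; have zm : (0 < z m)%N.
  by rewrite lt0n padic_valP// -ltnNge.
split=> //; apply/eqP; rewrite eqn_leq -pfactor_dvdn// -(padic_res_eq0 _ (ltnW vm)).
rewrite padic_valP// leqnn andbT leqNgt -pfactor_dvdn//.
by rewrite -(padic_res_eq0 _ vm) padic_valP// ltnn.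
Qed.

Lemma padic_int_mul_val (x y : padic_int) : x != 0 -> y != 0 ->
  (forall n, ((x * y) n == 0%N) = (n <= padic_val x + padic_val y)%N).
Proof.
move=> x0 y0 n; set m := (n + padic_val x + padic_val y).+1.
have [xm lx] : (0 < x m)%N /\ logn p (x m) = padic_val x.
  by apply: padic_logn => //; rewrite /m ltnS -addnA addnCA leq_addr.
have [ym ly] : (0 < y m)%N /\ logn p (y m) = padic_val y.
  by apply: padic_logn => //; rewrite /m ltnS leq_addl.
have nm : (n <= m)%N by rewrite /m -addnA -addnS leq_addr.
rewrite (padic_res_eq0 _ nm) padic_intM.
rewrite /dvdn modn_dvdm ?dvdn_exp2l// -/(dvdn _ _).
by rewrite pfactor_dvdn ?muln_gt0 ?xm ?ym// lognM// lx ly.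
Qed.

Let integral0 (x y : padic_int) : x * y = 0 -> (x == 0) || (y == 0).
Proof.
move=> xy0; case: (boolP (x == 0)) => //= x0; apply/negPn/negP => y0.
have := padic_int_mul_val x0 y0 (padic_val x + padic_val y).+1.
by rewrite xy0 padic_int0 ltnn.
Qed.

HB.instance Definition _ := GRing.ComUnitRing_isIntegral.Build padic_int integral0.

Lemma padic_valM (x y : padic_int) : x != 0 -> y != 0 ->
  padic_val (x * y) = (padic_val x + padic_val y)%N.
Proof.
move=> x0 y0; have xy0 : x * y != 0 by rewrite mulf_neq0.
apply/eqP; rewrite eqn_leq -padic_int_mul_val// padic_valP// leqnn /=.
by rewrite -padic_valP// padic_int_mul_val.
Qed.

Definition padic_int_abs (z : padic_int) : rat :=
  if z == 0 then 0 else p%:R ^- padic_val z.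

Let p_gt0 : 0 < p%:R :> rat.
Proof. by rewrite ltr0n prime_gt0. Qed.

Lemma padic_int_natr k n : (k%:R : padic_int) n = (k %% p ^ n)%N.
Proof.
elim: k => [|k IH]; first by rewrite padic_int0 mod0n.
by rewrite -addn1 natrD padic_intD IH modnDm.
Qed.

Lemma padic_int_abs_p : padic_int_abs p%:R = p%:R^-1.
Proof.
have resp n : ((p%:R : padic_int) n == 0%N) = (n <= 1)%N.
  by rewrite padic_int_natr -(@dvdn_Pexp2l p n 1) ?prime_gt1// expn1.
have p0 : (p%:R : padic_int) != 0.
  by apply/padic_int_neq0; exists 1%N; rewrite resp.
rewrite /padic_int_abs (negbTE p0); suff -> : padic_val p%:R = 1%N by rewrite expr1.
by apply/eqP; rewrite eqn_leq -resp padic_valP// leqnn -padic_valP// resp.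
Qed.

Lemma padic_int_abs_ge0 z : 0 <= padic_int_abs z.
Proof.
by rewrite /padic_int_abs; case: eqP => // _; rewrite invr_ge0 exprn_ge0// ltW.
Qed.

Lemma padic_int_abs_eq0 z : (padic_int_abs z == 0) = (z == 0).
Proof.
rewrite /padic_int_abs; case: (z =P 0) => _; first by rewrite eqxx.
by rewrite invr_eq0 expf_eq0 (gt_eqF p_gt0) andbF.
Qed.

Lemma padic_int_absM x y : padic_int_abs (x * y) = padic_int_abs x * padic_int_abs y.
Proof.
rewrite /padic_int_abs mulf_eq0; case: eqP => /= [_|/eqP x0]; first by rewrite mul0r.
case: eqP => [_|/eqP y0]; first by rewrite mulr0.
by rewrite padic_valM// exprD invfM.
Qed.

Lemma padic_int_abs_ultra (x y : padic_int) :
  padic_int_abs (x + y) <= Num.max (padic_int_abs x) (padic_int_abs y).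
Proof.
have [->|x0] := eqVneq x 0; first by rewrite add0r le_max lexx orbT.
have [->|y0] := eqVneq y 0; first by rewrite addr0 le_max lexx.
have [->|xy0] := eqVneq (x + y) 0.
  by rewrite {1}/padic_int_abs eqxx le_max padic_int_abs_ge0.
set m := minn (padic_val x) (padic_val y).
have mv : (m <= padic_val (x + y)%R)%N.
  rewrite -padic_valP// padic_intD; suff [-> ->] : x m = 0%N /\ y m = 0%N.
    by rewrite mod0n.
  by split; apply/eqP; rewrite padic_valP// ?geq_minl ?geq_minr.
have mono a b : (a <= b)%N -> p%:R ^- b <= p%:R ^- a :> rat.
  move=> ab; rewrite lef_pV2 ?posrE ?exprn_gt0//.
  by rewrite ler_weXn2l// ler1n prime_gt0.
rewrite /padic_int_abs (negbTE x0) (negbTE y0) (negbTE xy0) le_max.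
case: (leqP (padic_val x) (padic_val y)) => xy.
  by rewrite mono// (leq_trans _ mv)// leq_min leqnn.
by rewrite [X in _ || X]mono ?orbT// (leq_trans _ mv)// leq_min leqnn ltnW.
Qed.

End PadicIntegers.

Section PadicField.
Variables (p : nat) (p_pr : prime p).

Definition padic := {fraction (padic_int p_pr)}.

HB.instance Definition _ := GRing.Field.on padic.

(* [repr x] is a pair (numerator, denominator) of p-adic integers. *)
Definition padic_abs (x : padic) : rat :=
  padic_int_abs (repr x).1 / padic_int_abs (repr x).2.

Local Notation "x %:F" := (@FracField.tofrac (padic_int p_pr) x : padic).

Lemma padic_numden (x : padic) : x = (repr x).1%:F / (repr x).2%:F.
Proof.
have d0 : ((repr x).2)%:F != 0 by rewrite tofrac_eq0 denom_ratioP.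
apply: (mulIf d0); rewrite divfK//.
rewrite -{1}[x]reprK; unlock FracField.tofrac.
rewrite -[LHS]FracField.pi_mul /FracField.mulf.
rewrite !numden_Ratio ?oner_neq0// mulr1.
apply/eqmodP; rewrite /= FracField.equivfE.
by rewrite !numden_Ratio ?oner_neq0 ?denom_ratioP// mulr1 mulrC.
Qed.

Lemma padic_abs_div (a b : padic_int p_pr) : b != 0 ->
  padic_abs (a%:F / b%:F) = padic_int_abs a / padic_int_abs b.
Proof.
move=> b0; set x := _ / _; rewrite /padic_abs.
have d0 := denom_ratioP (repr x).
have abs0 (z : padic_int p_pr) : z != 0 -> padic_int_abs z != 0.
  by rewrite padic_int_abs_eq0.
apply/eqP; rewrite eqr_div ?abs0// -!padic_int_absM; apply/eqP; congr padic_int_abs.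
apply/eqP; rewrite -tofrac_eq !tofracM; apply/eqP.
have := padic_numden x; rewrite {1}/x => /eqP.
by rewrite eqr_div ?tofrac_eq0// => /eqP ->.
Qed.

Lemma padic_abs0 : padic_abs 0 = 0.
Proof.
have := @padic_abs_div 0 1 (oner_neq0 _); rewrite tofrac0 mul0r => ->.
by rewrite {1}/padic_int_abs eqxx mul0r.
Qed.

Lemma padic_abs_eq0 x : (padic_abs x == 0) = (x == 0).
Proof.
rewrite {2}[x]padic_numden /padic_abs !mulf_eq0 !invr_eq0 !tofrac_eq0.
by rewrite !padic_int_abs_eq0.
Qed.

Lemma padic_absM x y : padic_abs (x * y) = padic_abs x * padic_abs y.
Proof.
rewrite {1}[x]padic_numden {1}[y]padic_numden mulf_div -!tofracM.
rewrite padic_abs_div ?mulf_neq0 ?denom_ratioP// !padic_int_absM.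
by rewrite /padic_abs mulf_div.
Qed.

Lemma padic_abs_ge0 x : 0 <= padic_abs x.
Proof. by rewrite divr_ge0 ?padic_int_abs_ge0. Qed.

Lemma padic_abs1 : padic_abs 1 = 1.
Proof.
have a0 : padic_abs 1 != 0 by rewrite padic_abs_eq0 oner_neq0.
by apply: (mulIf a0); rewrite -padic_absM !mul1r.
Qed.

Lemma padic_abs_p : padic_abs p%:R = p%:R^-1.
Proof.
have := @padic_abs_div p%:R 1 (oner_neq0 _).
rewrite tofrac1 divr1 rmorph_nat => ->.
rewrite padic_int_abs_p; suff -> : padic_int_abs (1 : padic_int p_pr) = 1.
  by rewrite divr1.
have a0 : padic_int_abs (1 : padic_int p_pr) != 0.
  by rewrite padic_int_abs_eq0 oner_neq0.
by apply: (mulIf a0); rewrite -padic_int_absM !mul1r.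
Qed.

Lemma padic_absN x : padic_abs (- x) = padic_abs x.
Proof.
suff -> : padic_abs (- x) = padic_abs (-1) * padic_abs x.
  suff -> : padic_abs (-1) = 1 by rewrite mul1r.
  apply/eqP; rewrite -(@eqrXn2 _ 2)// ?padic_abs_ge0// ?ler01//.
  by rewrite expr1n expr2 -padic_absM mulrNN mulr1 padic_abs1.
by rewrite -padic_absM mulN1r.
Qed.

Lemma padic_abs_ultra x y :
  padic_abs (x + y) <= Num.max (padic_abs x) (padic_abs y).
Proof.
have dx := denom_ratioP (repr x); have dy := denom_ratioP (repr y).
rewrite {1}[x]padic_numden {1}[y]padic_numden.
rewrite addf_div ?tofrac_eq0// -!tofracM -tofracD padic_abs_div ?mulf_neq0//.
have abs0 (z : padic_int p_pr) : z != 0 -> 0 < padic_int_abs z.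
  by move=> z0; rewrite lt_neqAle eq_sym padic_int_abs_eq0 z0 padic_int_abs_ge0.
rewrite ler_pdivrMr ?abs0 ?mulf_neq0//.
apply: le_trans (padic_int_abs_ultra _ _) _.
rewrite maxr_pMl ?padic_int_abs_ge0// !padic_int_absM /padic_abs.
set a := padic_int_abs _; set b := padic_int_abs _.
set c := padic_int_abs _; set d := padic_int_abs _.
have b0 : b != 0 by rewrite gt_eqF// abs0.
have d0 : d != 0 by rewrite gt_eqF// abs0.
by rewrite mulrA divfK// [d * b]mulrC mulrA divfK.
Qed.

Definition padic_dist (x y : padic) : rat := padic_abs (y - x).

Let dist0 x : padic_dist x x = 0.
Proof. by rewrite /padic_dist subrr padic_abs0. Qed.

Let dist_eq0 x y : padic_dist x y = 0 -> x = y.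
Proof.
by move=> /eqP; rewrite padic_abs_eq0 subr_eq0 => /eqP.
Qed.

Let distC x y : padic_dist x y = padic_dist y x.
Proof. by rewrite /padic_dist -padic_absN opprB. Qed.

Let dist_triangle y x z : padic_dist x z <= padic_dist x y + padic_dist y z.
Proof.
rewrite /padic_dist -(subrKA y) addrC.
apply: le_trans (padic_abs_ultra _ _) _.
by rewrite ge_max lerDl lerDr !padic_abs_ge0.
Qed.

HB.instance Definition _ := isPointed.Build padic 0.
HB.instance Definition _ := isMetric.Build rat padic
  dist0 dist_eq0 distC dist_triangle.

End PadicField.

Notation borel T := (g_sigma_algebraType (@open T)).

(* Z_p as a subset of Q_p *)
Definition padic_ring (p : nat) (p_pr : prime p) : set (padic p_pr) :=
  range (@FracField.tofrac (padic_int p_pr)).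
Arguments padic_ring {p p_pr}.

Definition integral_mx (p : nat) (p_pr : prime p) m n :
    set 'M[padic p_pr]_(m, n) :=
  [set A | forall i j, padic_ring (A i j)].
Arguments integral_mx {p p_pr m n}.

Definition GLZp (p : nat) (p_pr : prime p) N : set 'M[padic p_pr]_N :=
  [set M | [/\ M \in unitmx, integral_mx M & integral_mx (invmx M)]].
Arguments GLZp {p p_pr} N.

(* Translation invariance together with the value 1 on the compact open
   subgroup of integral matrices determines the measure on all Borel sets. *)
Definition is_haar (R : realType) (p : nat) (p_pr : prime p) m n
    (lam : {measure set (borel 'M[padic p_pr]_(m, n)) -> \bar R}) : Prop :=
  lam integral_mx = 1%E /\
  forall (x : 'M[padic p_pr]_(m, n)) (A : set (borel 'M[padic p_pr]_(m, n))),
    measurable A -> lam [set x + y | y in A] = lam A.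

Section Flats.
Variables (p : nat) (p_pr : prime p).
Local Notation K := (padic p_pr).

Lemma flat_dim n k : (k < n)%N -> (k.+1 + (n - k))%N = n.+1.
Proof. by move=> kn; rewrite addSn subnKC// ltnW. Qed.

(* The (n+1) x (k+1) matrix with the identity above A *)
Definition stack n k (hk : (k < n)%N) (A : 'M[K]_(n - k, k.+1)) :
    'M[K]_(n.+1, k.+1) :=
  castmx (flat_dim hk, erefl) (col_mx 1%:M A).

Definition column_span a b (M : 'M[K]_(a, b)) : {vspace 'cV[K]_a} :=
  <<[seq col j M | j <- enum 'I_b]>>%VS.

(* A k-flat P(L) of the projective n-space is represented by L itself. *)
Definition flats n k : set {vspace 'cV[K]_n.+1} := [set L | \dim L = k.+1].

Definition flat_of_GL n k (hk : (k < n)%N) (M : 'M[K]_n.+1) :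
    {vspace 'cV[K]_n.+1} :=
  column_span (M *m stack hk 0).

Definition grassmann_measure (R : realType)
    (lambda : forall m n, {measure set (borel 'M[K]_(m, n)) -> \bar R})
    n k (hk : (k < n)%N) (S : set {vspace 'cV[K]_n.+1}) : \bar R :=
  ((fine (lambda _ _ (GLZp (n - k))) * fine (lambda _ _ (GLZp k.+1)))^-1%:E
   * lambda _ _ (GLZp n.+1 `&` flat_of_GL hk @^-1` S))%E.

Definition zero_on n (f : {mpoly K[n]}) (L : {vspace 'cV[K]_n}) :=
  forall x : 'cV[K]_n, x \in L -> f.@[fun i => x i ord0] = 0.

Definition flats_on n k nu (f : 'I_nu -> {mpoly K[n.+1]}) :
    set {vspace 'cV[K]_n.+1} :=
  [set L | flats k L /\ forall j, zero_on (f j) L].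

(* Exponents of the monomials of degree d in N variables *)
Definition hmonom N d := {m : 'X_{1..N < d.+1} | mdeg m == d}.

Lemma card_hmonom k d : #|{: hmonom k.+1 d}| = 'C(k + d, d).
Proof.
rewrite card_sig addnC -size_basis cardE -(size_map (@bmnm k.+1 d.+1)).
apply: perm_size; apply: uniq_perm; last first.
- move=> m; rewrite -basis_cover; apply/mapP/eqP => [[b]|md].
    by rewrite mem_enum inE => /eqP md ->.
  have mlt : (mdeg m < d.+1)%N by rewrite md.
  by exists (BMultinom mlt) => //; rewrite mem_enum inE /= md.
- exact: uniq_basis.
- by rewrite map_inj_uniq ?enum_uniq//; exact: val_inj.
Qed.

Definition hpoly N d (c : hmonom N d -> K) : {mpoly K[N]} :=
  \sum_(m : hmonom N d) c m *: 'X_[bmnm (val m)].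

(* f(B y) as a polynomial in y *)
Definition linear_subst a b (B : 'M[K]_(a, b)) (f : {mpoly K[a]}) :
    {mpoly K[b]} :=
  f \mPo [tuple \sum_(l < b) B i l *: 'X_l | i < a].

Section Psi.
Variables (n k nu : nat) (hk : (k < n)%N) (d : 'I_nu -> nat).
Variable f : 'I_nu -> {mpoly K[n.+1]}.

Definition psi_coeffs (A : 'M[K]_(n - k, k.+1)) : seq K :=
  flatten [seq [seq (linear_subst (stack hk A) (f j))@_(bmnm (val m))
               | m <- enum {: hmonom k.+1 (d j)}] | j <- enum 'I_nu].

Lemma size_psi_coeffs A :
  size (psi_coeffs A) = (\sum_(j < nu) 'C(k + d j, d j))%N.
Proof.
rewrite size_flatten /shape -map_comp sumnE big_map big_enum /=.
by apply: eq_bigr => j _; rewrite size_map -cardE card_hmonom.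
Qed.

(* Under the dimension condition [psi_coeffs A] has exactly
   (k + 1)(n - k) entries, so nothing is dropped or padded here. *)
Definition psi (A : 'M[K]_(n - k, k.+1)) : 'rV[K]_((n - k) * k.+1) :=
  \row_s (psi_coeffs A)`_s.

End Psi.

(* Partial derivatives as limits of difference quotients in Q_p; rows are
   indexed by the components of g. *)
Definition padic_jacobian a b (g : 'rV[K]_a -> 'rV[K]_b) (x : 'rV[K]_a) :
    'M[K]_(b, a) :=
  \matrix_(s, t)
    lim ((fun h : K => h^-1 * (g (x + h *: delta_mx 0 t) 0 s - g x 0 s)) @ 0^').

Definition jacobian_psi n k nu (hk : (k < n)%N) (d : 'I_nu -> nat)
    (f : 'I_nu -> {mpoly K[n.+1]}) : 'M[K]_((n - k) * k.+1) :=
  padic_jacobian (psi hk d f \o vec_mx) 0.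

End Flats.

Section Randomness.
Context {R : realType} {disp : measure_display} {Omega : measurableType disp}.
Variable P : probability Omega R.

Definition mutually_independent (I : finType) (disp' : measure_display)
    (T : measurableType disp') (X : I -> {RV P >-> T}) : Prop :=
  forall (J : {set I}) (A : I -> set T), (forall i, measurable (A i)) ->
    P (\bigcap_(i in [set` J]) (X i @^-1` A i)) =
    (\prod_(i in J) P (X i @^-1` A i))%E.

(* The law of X is the restriction of the Haar measure lam to Z_p;
   Q_p is identified with the 1 x 1 matrices. *)
Definition uniform_Zp (p : nat) (p_pr : prime p)
    (lam : {measure set (borel 'M[padic p_pr]_(1, 1)) -> \bar R})
    (X : {RV P >-> borel (padic p_pr)}) : Prop :=
  forall A : set (borel (padic p_pr)), measurable A ->
    distribution P X A =
    lam (integral_mx `&` [set M : 'M[padic p_pr]_(1, 1) | A (M ord0 ord0)]).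

End Randomness.

(* Main.v *)
Require Import Defs.
From HB Require Import structures.
From mathcomp Require Import all_boot all_order all_algebra.
From mathcomp Require Import perm fraction finmap.
From mathcomp Require Import mpoly.
From mathcomp Require Import all_classical all_reals all_analysis measurable_realfun.
From mathcomp Require Import ring.

(** Every subspace of dimension k + 1 lies in exactly one chart
    [g (1; A)], with A in p Z_p^((n - k) x (k + 1)) and g running through lifts
    of representatives of GL_(n+1)(F_p) modulo the stabilizer of the standard
    flat; the number of these charts, times p^(-D) with D = (k + 1)(n - k), is
    mu of the Grassmannian. In the chart of g the flats on Z(f) are the zeros A
    of psi_(f o g), and the uniform law of f is invariant under f |-> f o g.

    Fix m and cut p Z_p^D into the p^(m D) balls of radius p^-(m+1). By Hensel's
    lemma a ball centred at c contains at most one zero with |det J| > p^-(m+1),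
    and it does exactly when, after moving c to the origin (which again
    preserves the law of f), |det J(0)| > p^-(m+1) and psi(0) belongs to the
    lattice p^(m+1) J(0) Z_p^D. Since psi(0) is uniform and independent of J(0),
    this happens with probability p^(-(m+1) D) times the truncated expectation
    of |det J(0)|. All these events depend on f modulo p^(2 m + 2) only, so
    probabilities are averages over finitely many residues.

    A ball containing a zero with det J = 0 satisfies a congruence of
    probability at most p^(-(m+1) D - (m+1)); hence almost surely there is no
    such zero. The theorem follows by monotone convergence in m. *)

Set Implicit Arguments.
Unset Strict Implicit.
Unset Printing Implicit Defensive.

Import Order.TTheory GRing.Theory Num.Theory.

Local Open Scope classical_set_scope.
Local Open Scope ring_scope.

(** * Divisibility by powers of p *)

Section Divisibility.
Variables (p : nat) (p_pr : prime p).
Local Notation O := (padic_int p_pr).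
Implicit Types (x y z : O) (m n : nat).

(** Invariance of the law of f under GL_(n+1)(Z_p) takes the place of a change of variables on the
    Grassmannian: a chart g and the translation to a centre c both act on f through such matrices,
    so all balls are equivalent. The truncation |det J| > p^-(m+1) means that inverting J costs at
    most m digits, while the second-order remainder of psi(p^(m+1) y) is divisible by p^(2m+2).
    Hence the Hensel iteration gains a digit at each step, and its criterion survives a change of f
    modulo p^(2m+2). Uniformity of psi(0) given J(0) is made concrete by adding to f forms in the
    first k+1 variables: this shifts psi(0) arbitrarily and fixes J(0). For a singular zero the
    extra factor p^-(m+1) comes from a primitive left kernel vector u of the Jacobian there: u J(0)
    is divisible by p^(m+1), which puts one more congruence on psi(0) / p^(m+1). The count of flats
    enters only as a limit, off a null set, of functions of finitely many residues. *)

Definition pdvd m x := x m == 0%N.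

Let pn_gt0 n : (0 < p ^ n)%N.
Proof. by rewrite expn_gt0 prime_gt0. Qed.

Lemma pdvdP m x : reflect (exists t, x = p%:R ^+ m * t) (pdvd m x).
Proof.
apply: (iffP eqP) => [xm0|[t ->]]; last first.
  by rewrite padic_intM -natrX padic_int_natr modnn mul0n mod0n.
have dv n : (p ^ m %| x (n + m)%N)%N.
  by rewrite /dvdn padic_res_mod ?leq_addl// xm0.
pose u n := (x (n + m)%N %/ p ^ m)%N.
have uc : padic_compatible p u.
  move=> n; split; first by rewrite ltn_divLR// -expnD padic_res_lt.
  by rewrite /u modn_divl -expnD addSn padic_res_mod.
exists (@PadicInt p p_pr u (asboolT uc)); apply/padic_int_eqP => n.
rewrite padic_intM -natrX padic_int_natr modnMml /= /u mulnC divnK//.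
by rewrite padic_res_mod// leq_addr.
Qed.

Lemma padic_res_eq m x y : (x m == y m) = pdvd m (x - y).
Proof.
rewrite /pdvd padic_intD -[X in (X == _) = _](modn_small (padic_res_lt x m)).
rewrite -[X in (_ == X) = _](modn_small (padic_res_lt y m)).
rewrite -(eqn_modDr ((- y) m)) -padic_intD.
have -> : (((y m + (- y) m) %% p ^ m) = 0)%N by rewrite -padic_intD subrr padic_int0.
by rewrite padic_intD.
Qed.

Lemma pdvd0 m : pdvd m 0. Proof. by rewrite /pdvd padic_int0. Qed.

Lemma pdvd0n x : pdvd 0 x. Proof. by rewrite /pdvd padic_res0. Qed.

Lemma pdvdD m x y : pdvd m x -> pdvd m y -> pdvd m (x + y).
Proof. by rewrite /pdvd padic_intD => /eqP-> /eqP->; rewrite mod0n. Qed.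

Lemma pdvdMr m x y : pdvd m y -> pdvd m (x * y).
Proof. by rewrite /pdvd padic_intM => /eqP->; rewrite muln0 mod0n. Qed.

Lemma pdvdMl m x y : pdvd m x -> pdvd m (x * y).
Proof. by rewrite mulrC; apply: pdvdMr. Qed.

Lemma pdvdN m x : pdvd m (- x) = pdvd m x.
Proof.
by apply/idP/idP => /(pdvdMr (-1)); rewrite mulN1r ?opprK.
Qed.

Lemma pdvdB m x y : pdvd m x -> pdvd m y -> pdvd m (x - y).
Proof. by move=> hx hy; rewrite pdvdD// pdvdN. Qed.

Lemma pdvdBC m x y : pdvd m (x - y) = pdvd m (y - x).
Proof. by rewrite -pdvdN opprB. Qed.

Lemma pdvd_sum m (J : Type) (s : seq J) (P : pred J) (F : J -> O) :
  (forall j, P j -> pdvd m (F j)) -> pdvd m (\sum_(j <- s | P j) F j).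
Proof.
move=> h; elim/big_ind: _ => //; first exact: pdvd0.
by move=> x y; apply: pdvdD.
Qed.

Lemma pdvd_le m n x : (n <= m)%N -> pdvd m x -> pdvd n x.
Proof. by move=> nm; rewrite /pdvd -(padic_res_mod x nm) => /eqP->; rewrite mod0n. Qed.

Lemma pdvd_all x : (forall m, pdvd m x) -> x = 0.
Proof. by move=> h; apply/padic_int_eqP => n; rewrite padic_int0; apply/eqP/h. Qed.

Lemma pdvd_pX m x : pdvd m (p%:R ^+ m * x).
Proof. by apply/pdvdP; exists x. Qed.

Lemma ppX_neq0 m : (p%:R ^+ m : O) != 0.
Proof.
rewrite expf_neq0//; apply/padic_int_neq0; exists 1%N.
rewrite padic_int_natr modn_small; first by rewrite -lt0n prime_gt0.
by rewrite -{1}[p]expn1 ltn_exp2l ?prime_gt1.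
Qed.

Lemma pdvd_pXM m n x : pdvd (m + n) (p%:R ^+ m * x) = pdvd n x.
Proof.
apply/pdvdP/pdvdP => -[t]; last by move=> ->; exists t; rewrite exprD mulrA.
rewrite exprD -mulrA => /(mulfI (ppX_neq0 m)) ->; by exists t.
Qed.

Lemma pdvdM m n x y : pdvd m x -> pdvd n y -> pdvd (m + n) (x * y).
Proof.
move=> /pdvdP[t ->] /pdvdP[u ->]; apply/pdvdP; exists (t * u).
by rewrite exprD mulrACA.
Qed.

Lemma pdvd_trans m y x z : pdvd m (x - y) -> pdvd m (y - z) -> pdvd m (x - z).
Proof. by move=> h1 h2; rewrite -(subrKA y) pdvdD. Qed.

(** The iterates from 0 agree modulo p^n from step n on, so in each coordinate their residues define
    a p-adic integer. Serves both for inverses in Z_p and for Hensel's lemma. *)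
Lemma contraction_fix (J : Type) (Phi : (J -> O) -> J -> O) :
  (forall s u v, (forall i, pdvd s (u i - v i)) ->
     forall i, pdvd s.+1 (Phi u i - Phi v i)) ->
  exists u, forall i, Phi u i = u i.
Proof.
move=> hPhi; pose U n := iter n Phi (fun=> 0).
have US n i : pdvd n (U n.+1 i - U n i).
  elim: n i => [|n IH] i; first exact: pdvd0n.
  exact: hPhi.
have zc i : padic_compatible p (fun n => U n i n %% p ^ n)%N.
  apply: (@padic_compatible_mod p p_pr) => n.
  rewrite padic_res_mod// [RHS]modn_small ?padic_res_lt//; apply/eqP.
  by rewrite padic_res_eq.
pose z i := @PadicInt p p_pr _ (asboolT (zc i)).
have zE n i : pdvd n (z i - U n i).
  by rewrite -padic_res_eq /= modn_small// padic_res_lt.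
exists z => i; apply/eqP; rewrite -subr_eq0; apply/eqP; apply: pdvd_all => n.
apply: (@pdvd_trans _ (U n.+1 i)); last first.
  by apply: (@pdvd_le n.+1) => //; rewrite pdvdBC.
by apply: (@pdvd_le n.+1) => //; apply: hPhi.
Qed.

Lemma padic_natr_res m x : pdvd m (x - (x m)%:R).
Proof. by rewrite -padic_res_eq padic_int_natr modn_small// padic_res_lt. Qed.

Lemma pdvd_prime x y : pdvd 1 (x * y) = pdvd 1 x || pdvd 1 y.
Proof.
by rewrite /pdvd padic_intM expn1 -/(dvdn _ _) Euclid_dvdM// /dvdn
   ![(_ %% p)%N]modn_small// -[X in (_ < X)%N]expn1 padic_res_lt.
Qed.

Lemma pdvd1F m : (0 < m)%N -> pdvd m 1 = false.
Proof.
move=> m0; apply/negbTE/negP => /(pdvd_le m0).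
rewrite -[1]/(1%:R) /pdvd padic_int_natr.
by rewrite modn_small// expn1 prime_gt1.
Qed.

Lemma padic_unitE x : (x \is a GRing.unit) = ~~ pdvd 1 x.
Proof.
apply/idP/idP => [xU|xN].
  by apply/negP => /(pdvdMr x^-1); rewrite mulVr// pdvd1F.
have [y0 y0E] : exists y0, pdvd 1 (1 - x * y0).
  (* By Fermat, x^(p-2) inverts x modulo p. *)
  exists (x ^+ p.-2); rewrite -exprS prednK; last by rewrite -subn1 subn_gt0 prime_gt1.
  have : pdvd 1 (x * (1 - x ^+ p.-1)).
    have rx n : ((x ^+ n) 1%N = (x 1%N) ^ n %% p)%N.
      elim: n => [|n IH]; first by rewrite expr0 (padic_int_natr p_pr 1 1) expn0 expn1.
      by rewrite exprS padic_intM IH expn1 expnS modnMmr.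
    rewrite mulrBr mulr1 -exprS prednK ?prime_gt0// -padic_res_eq rx.
    rewrite fermat_little// modn_small//.
    by rewrite -[X in (_ < X)%N]expn1 padic_res_lt.
  by rewrite pdvd_prime (negbTE xN).
have y00 : y0 != 0.
  by apply: contraTneq y0E => ->; rewrite mulr0 subr0 pdvd1F.
(* Correction by the approximate inverse [y0]: the contraction factor is 1 - x y0, divisible by p,
   and a fixed point satisfies y0 (1 - x u) = 0. *)
pose Phi (u : unit -> O) := fun i => u i + y0 * (1 - x * u i).
have [|u /(_ tt)] := @contraction_fix unit Phi.
  move=> s u v uv i; rewrite /Phi.
  have -> : u i + y0 * (1 - x * u i) - (v i + y0 * (1 - x * v i)) =
    (1 - x * y0) * (u i - v i). by ring.
  by rewrite -[s.+1]add1n pdvdM.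
rewrite /Phi -[RHS]addr0 => /addrI/eqP; rewrite mulf_eq0 (negbTE y00) /=.
rewrite subr_eq0 => /eqP xu; apply/unitrP; exists (u tt).
by rewrite mulrC -xu.
Qed.

Lemma pdvd_split x : x != 0 -> exists q t, t \is a GRing.unit /\ x = p%:R ^+ q * t.
Proof.
move=> x0; have /pdvdP[t xE] : pdvd (padic_val x) x.
  by rewrite /pdvd padic_valP.
exists (padic_val x), t; split=> //; rewrite padic_unitE; apply/negP => tp.
suff : pdvd (padic_val x).+1 x by rewrite /pdvd padic_valP// ltnn.
by rewrite [X in pdvd _ X]xE -addn1 pdvd_pXM.
Qed.

Lemma pdvd_unit q (t : O) : t \is a GRing.unit ->
  forall m, pdvd m (p%:R ^+ q * t) = (m <= q)%N.
Proof.
move=> tU m; case: (leqP m q) => mq.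
  by apply: pdvd_le mq _; apply: pdvd_pX.
apply/negbTE/negP => /(pdvd_le mq); rewrite -addn1 pdvd_pXM.
by apply/negP; rewrite -padic_unitE.
Qed.

Lemma padic_int_abs_unit q (t : O) : t \is a GRing.unit ->
  padic_int_abs (p%:R ^+ q * t : O) = p%:R ^- q.
Proof.
move=> tU; have t0 : t != 0 by apply: contraTneq tU => ->; rewrite unitr0.
rewrite /padic_int_abs mulf_eq0 (negbTE (ppX_neq0 q)) (negbTE t0) /=.
suff -> : padic_val (p%:R ^+ q * t) = q by [].
have h m : (m <= padic_val (p%:R ^+ q * t)%R)%N = (m <= q)%N.
  by rewrite -padic_valP ?mulf_neq0 ?ppX_neq0// -/(pdvd _ _) pdvd_unit.
by apply/eqP; rewrite eqn_leq -h leqnn h leqnn.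
Qed.

Lemma padic_det_cong m N (A B : 'M[O]_N) :
  (forall i j, pdvd m (A i j - B i j)) -> pdvd m (\det A - \det B).
Proof.
move=> AB; have pm x y x' y' : pdvd m (x - x') -> pdvd m (y - y') ->
    pdvd m (x * y - x' * y').
  move=> h1 h2; have -> : x * y - x' * y' = (x - x') * y + x' * (y - y').
    by rewrite mulrBl mulrBr subrKA.
  by rewrite pdvdD ?(pdvdMl _ h1) ?(pdvdMr _ h2).
rewrite /determinant -sumrB; apply: pdvd_sum => s _.
apply: (pm); first by rewrite subrr pdvd0.
elim/big_ind2: _ => //; first by rewrite subrr pdvd0.
by move=> *; apply: pm.
Qed.

Lemma pdvd_mx m a b (A : 'M[O]_(a, b)) :
  (forall i j, pdvd m (A i j)) <-> exists B, A = p%:R ^+ m *: B.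
Proof.
split=> [h|[B ->] i j]; last by rewrite mxE pdvd_pX.
have /choice[f fE] : forall ij : 'I_a * 'I_b, exists t, A ij.1 ij.2 = p%:R ^+ m * t.
  by move=> ij; apply/pdvdP.
exists (\matrix_(i, j) f (i, j)); apply/matrixP => i j; rewrite !mxE.
exact: (fE (i, j)).
Qed.

End Divisibility.

(** * Reduction modulo p *)

Section ResidueField.
Variables (p : nat) (p_pr : prime p).
Local Notation O := (padic_int p_pr).

Definition padic_Fp (x : O) : 'F_p := (x 1%N)%:R.

Lemma Fp_natr_mod k : ((k %% p)%N%:R : 'F_p) = k%:R.
Proof. by have := @Fp_nat_mod p p_pr k => ->. Qed.

Let padic_Fp_zmod : zmod_morphism padic_Fp.
Proof.
move=> x y; apply/eqP; rewrite eq_sym subr_eq; apply/eqP.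
rewrite -[in LHS](subrK y x) /padic_Fp padic_intD expn1.
by rewrite Fp_natr_mod natrD.
Qed.

Let padic_Fp_monoid : monoid_morphism padic_Fp.
Proof.
split=> [|x y]; rewrite /padic_Fp.
  by rewrite (padic_int_natr p_pr 1 1) expn1 Fp_natr_mod.
by rewrite padic_intM expn1 Fp_natr_mod natrM.
Qed.

HB.instance Definition _ := GRing.isZmodMorphism.Build O 'F_p padic_Fp padic_Fp_zmod.
HB.instance Definition _ := GRing.isMonoidMorphism.Build O 'F_p padic_Fp padic_Fp_monoid.

Lemma padic_Fp_eq0 x : (padic_Fp x == 0) = pdvd 1 x.
Proof.
rewrite /padic_Fp -(dvdn_pcharf (pchar_Fp p_pr)) /pdvd /dvdn modn_small//.
by rewrite -[X in (_ < X)%N]expn1 padic_res_lt.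
Qed.

Definition Fp_lift (c : 'F_p) : O := (c : nat)%:R.

Lemma Fp_liftK c : padic_Fp (Fp_lift c) = c.
Proof. by rewrite rmorph_nat natr_Zp. Qed.

Lemma padic_unitmx N (A : 'M[O]_N) :
  (A \in unitmx) = (map_mx padic_Fp A \in unitmx).
Proof. by rewrite !unitmxE det_map_mx padic_unitE unitfE padic_Fp_eq0. Qed.

(** A kernel vector of J modulo p is lifted to Z_p; its nonzero coordinates modulo p become
    units. *)
Lemma singular_mod_p N (J : 'M[O]_N) : pdvd 1 (\det J) ->
  exists (u w : 'cV[O]_N) i, u i 0 \is a GRing.unit /\ J *m u = p%:R *: w.
Proof.
rewrite -padic_Fp_eq0 -det_map_mx -det_tr => /det0P[v v0 vJ].
pose u : 'cV[O]_N := \col_i Fp_lift (v 0 i).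
have /rV0Pn[i vi] := v0.
have /pdvd_mx[w wE] : forall a b, pdvd 1 ((J *m u) a b).
  move=> a b; rewrite -padic_Fp_eq0; move/matrixP/(_ b a)/eqP: vJ.
  rewrite !mxE (ord1 b) => /eqP <-; rewrite rmorph_sum/=; apply/eqP.
  by apply: eq_bigr => j _; rewrite !mxE rmorphM /= Fp_liftK mulrC.
exists u, w, i; split; last by rewrite wE expr1.
by rewrite mxE padic_unitE -padic_Fp_eq0 Fp_liftK.
Qed.

End ResidueField.

(** * Densities of sets defined by congruences *)

Section Indicator.
Variable R : realType.

Definition ind (A : Type) (S : A -> Prop) (a : A) : R := (`[< S a >] : nat)%:R.

Lemma ind_ge0 A S (a : A) : 0 <= ind S a. Proof. exact: ler0n. Qed.

Lemma ind_le1 A S (a : A) : ind S a <= 1.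
Proof. by rewrite /ind; case: asboolP => _. Qed.

Lemma eq_ind A B (S : A -> Prop) (S' : B -> Prop) a b :
  (S a <-> S' b) -> ind S a = ind S' b.
Proof. by move=> h; rewrite /ind (asbool_equiv_eq h). Qed.

Lemma ind_le A B (S : A -> Prop) (S' : B -> Prop) a b :
  (S a -> S' b) -> ind S a <= ind S' b.
Proof.
rewrite /ind; case: asboolP => [Sa|_ _]; last exact: ler0n.
by case: asboolP => // nS' h; case: nS'; apply: h.
Qed.

End Indicator.

Section Average.
Variables (R : realType) (p : nat) (p_pr : prime p) (I : finType).
Local Notation O := (padic_int p_pr).
Local Notation V := (I -> O).
Implicit Types (a b : V) (M : nat).

Definition vcong M a b := forall i, pdvd M (a i - b i).

Definition res_periodic (T : Type) M (phi : V -> T) :=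
  forall a b, vcong M a b -> phi a = phi b.

Local Notation residues M := {ffun I -> 'I_(p ^ M)}.

Definition lift_res M (r : residues M) : V := fun i => (r i)%:R.
Definition red_res M a : residues M :=
  [ffun i => Ordinal (padic_res_lt (a i) M)].

Lemma red_resP M a b : red_res M a = red_res M b <-> vcong M a b.
Proof.
split=> [ab i|ab].
  by move/ffunP/(_ i): ab; rewrite !ffunE => -[ab]; rewrite -padic_res_eq ab.
by apply/ffunP => i; rewrite !ffunE; apply: val_inj; apply/eqP; rewrite /= padic_res_eq.
Qed.

Lemma lift_resK M (r : residues M) : red_res M (lift_res r) = r.
Proof.
apply/ffunP => i; rewrite ffunE; apply: val_inj.
by rewrite /= /lift_res padic_int_natr modn_small.
Qed.

Lemma lift_red_res M a : vcong M (lift_res (red_res M a)) a.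
Proof. by apply/red_resP; rewrite lift_resK. Qed.

Lemma vcong_refl M a : vcong M a a.
Proof. by move=> i; rewrite subrr pdvd0. Qed.

Lemma vcong_sym M a b : vcong M a b -> vcong M b a.
Proof. by move=> ab i; rewrite pdvdBC. Qed.

Lemma vcong_trans M a b c : vcong M a b -> vcong M b c -> vcong M a c.
Proof. by move=> ab bc i; apply: pdvd_trans (ab i) (bc i). Qed.

Lemma res_periodic_le (T : Type) m M (phi : V -> T) : (m <= M)%N ->
  res_periodic m phi -> res_periodic M phi.
Proof. by move=> mM h a b ab; apply: h => i; apply: pdvd_le mM _. Qed.

(** For [phi] of period p^M this is its integral for the uniform law on Z_p^I; see
    [integral_coef_int]. *)
Definition avg M (phi : V -> R) : R :=
  (\sum_(r : residues M) phi (lift_res r)) / #|{: residues M}|%:R.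

Lemma card_residues M : #|{: residues M}| = ((p ^ M) ^ #|I|)%N.
Proof. by rewrite card_ffun card_ord. Qed.

Lemma card_residues_neq0 M : #|{: residues M}|%:R != 0 :> R.
Proof.
by rewrite pnatr_eq0 card_residues -lt0n !expn_gt0 prime_gt0.
Qed.

Lemma eq_avg M phi psi : phi =1 psi -> avg M phi = avg M psi.
Proof. by move=> h; congr (_ / _); apply: eq_bigr => r _; apply: h. Qed.

Lemma avg_cst M c : avg M (fun=> c) = c.
Proof.
rewrite /avg (_ : \sum_(r : residues M) c = c * #|{: residues M}|%:R).
  by rewrite mulfK// card_residues_neq0.
by rewrite sumr_const mulr_natr.
Qed.

Lemma avg_le M phi psi : (forall a, phi a <= psi a) -> avg M phi <= avg M psi.
Proof.
move=> h; rewrite ler_pM2r; first exact: ler_sum.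
by rewrite invr_gt0 lt_neqAle eq_sym card_residues_neq0 ler0n.
Qed.

Lemma avg_sum M (J : finType) (phi : J -> V -> R) :
  avg M (fun a => \sum_j phi j a) = \sum_j avg M (phi j).
Proof. by rewrite /avg exchange_big /= mulr_suml. Qed.

Lemma avgZ M c phi : avg M (fun a => c * phi a) = c * avg M phi.
Proof. by rewrite /avg -mulr_sumr mulrA. Qed.

(** Being invertible modulo p^M is enough for [s] to permute the residues. *)
Lemma avg_bij M phi (s t : V -> V) :
  (forall a b, vcong M a b -> vcong M (s a) (s b)) ->
  (forall a b, vcong M a b -> vcong M (t a) (t b)) ->
  (forall a, vcong M (t (s a)) a) -> (forall a, vcong M (s (t a)) a) ->
  res_periodic M phi -> avg M (fun a => phi (s a)) = avg M phi.
Proof.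
move=> sM tM ts st phiM; congr (_ / _).
rewrite [RHS](reindex (fun r : residues M => red_res M (s (lift_res r)))) /=; last first.
  exists (fun r : residues M => red_res M (t (lift_res r))) => r _.
    rewrite -[RHS]lift_resK; apply/red_resP.
    by apply: vcong_trans (ts _); apply: tM; apply: lift_red_res.
  rewrite -[RHS]lift_resK; apply/red_resP.
  by apply: vcong_trans (st _); apply: sM; apply: lift_red_res.
by apply: eq_bigr => r _; apply: phiM; apply: vcong_sym; apply: lift_red_res.
Qed.

Lemma avg_translate M phi v : res_periodic M phi ->
  avg M (fun a => phi (fun i => a i - v i)) = avg M phi.
Proof.
move=> phiM.
apply: (avg_bij (s := fun a i => a i - v i) (t := fun a i => a i + v i)) => //.
- by move=> a b ab i; rewrite opprD addrACA subrr addr0.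
- by move=> a b ab i; rewrite opprD addrACA subrr addr0.
- by move=> a i; rewrite subrK subrr pdvd0.
- by move=> a i; rewrite addrK subrr pdvd0.
Qed.

Lemma ind_res_periodic M S : (forall a b, vcong M a b -> S a -> S b) ->
  res_periodic M (ind R S).
Proof. by move=> h a b ab; apply: eq_ind; split; apply: h => //; apply: vcong_sym. Qed.

(** Translates have equal density, and the hypotheses make those of [L] by the [v t] a partition of
    [S]. *)
Lemma avg_tiling M (X : finType) (v : X -> V) (S L : V -> Prop) :
  res_periodic M (ind R L) ->
  (forall t a, L (fun i => a i - v t i) -> S a) ->
  (forall a, S a -> exists t, L (fun i => a i - v t i)) ->
  (forall a t t', L (fun i => a i - v t i) -> L (fun i => a i - v t' i) -> t = t') ->
  avg M (ind R S) = #|X|%:R * avg M (ind R L).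
Proof.
move=> LM LS SL Linj.
transitivity (avg M (fun a => \sum_t ind R L (fun i => a i - v t i))).
  apply: eq_avg => a; rewrite {1}/ind; case: asboolP => [/SL[t Lt]|nS].
    rewrite (bigD1 t)//= big1 ?addr0 => [|t' tt'].
      by rewrite /ind asboolT.
    rewrite /ind asboolF// => Lt'; move/eqP: tt'; apply; exact: Linj Lt' Lt.
  by rewrite big1// => t _; rewrite /ind asboolF// => /LS.
rewrite avg_sum (eq_bigr (fun=> avg M (ind R L))) => [|t _].
  by rewrite sumr_const mulr_natl.
exact: avg_translate.
Qed.

Lemma avg_packing M (X : finType) (v : X -> V) (L : V -> Prop) :
  res_periodic M (ind R L) ->
  (forall a t t', L (fun i => a i - v t i) -> L (fun i => a i - v t' i) -> t = t') ->
  #|X|%:R * avg M (ind R L) <= 1.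
Proof.
move=> LM Linj.
pose S a := exists t, L (fun i => a i - v t i).
rewrite -(@avg_tiling _ _ v S)//; last by move=> t a ?; exists t.
by rewrite -[leRHS](avg_cst M); apply: avg_le => a; apply: ind_le1.
Qed.

End Average.

Section Density.
Variables (R : realType) (p : nat) (p_pr : prime p) (D : nat).
Local Notation O := (padic_int p_pr).
Local Notation V := ('I_D -> O).

Definition lattice (J : 'M[O]_D) (a : V) := exists x, \col_i a i = J *m x.

Lemma lattice_res_periodic M J :
  (forall a : V, (forall i, pdvd M (a i)) -> lattice J a) ->
  forall a b, vcong M a b -> lattice J a -> lattice J b.
Proof.
move=> JM a b ab [x ax]; have [y yE] := JM (fun i => a i - b i) ab.
exists (x - y); rewrite mulmxBr -ax -yE; apply/colP => i; rewrite !mxE.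
by rewrite opprB addrCA subrr addr0.
Qed.

(** Induction on the valuation of det J, in place of a Smith normal form. If p divides det J, then J
    u = p w with [u] primitive; putting [w] into the column where [u] has a unit entry gives J' with
    one factor p less in its determinant, and J O^D has index p in J' O^D. The hypothesis that the
    lattice contains p^M O^D makes membership depend on residues modulo p^M. *)
Lemma density_lattice M q (t : O) (J : 'M[O]_D) :
  \det J = p%:R ^+ q * t -> t \is a GRing.unit ->
  (forall a : V, (forall i, pdvd M (a i)) -> lattice J a) ->
  avg M (ind R (lattice J)) = p%:R ^- q.
Proof.
have ppos : (p%:R : R) != 0 by rewrite pnatr_eq0 -lt0n prime_gt0.
elim: q t J => [|q IH] t J Jt tU JM.
  rewrite expr0 invr1 -[RHS](avg_cst p_pr 'I_D M); apply: eq_avg => a.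
  rewrite /ind asboolT//; exists (invmx J *m \col_i a i).
  by rewrite mulKVmx// unitmxE Jt expr0 mul1r.
have [|u [w [i [ui Ju]]]] := @singular_mod_p _ p_pr _ J.
  by rewrite Jt pdvd_unit.
pose J' : 'M[O]_D := \matrix_(a, b) if b == i then w a 0 else J a b.
(* The identity with column i replaced by [u]: the factorization J U = J' diag(1, ..., p, ..., 1)
   yields det J'. *)
pose U : 'M[O]_D := \matrix_(a, b) if b == i then u a 0 else (a == b)%:R.
pose d : 'rV[O]_D := \row_b if b == i then p%:R else 1.
have detU : \det U = u i 0.
  rewrite (expand_det_row _ i) (bigD1 i)//= big1 ?addr0 => [|b bi].
    rewrite mxE eqxx /cofactor addnn -signr_odd odd_double expr0 mul1r.
    rewrite (_ : row' i (col' i U) = 1%:M) ?det1 ?mulr1//.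
    apply/matrixP => a b; rewrite !mxE eq_sym (negbTE (neq_lift _ _)).
    by rewrite (inj_eq (@lift_inj _ _)).
  by rewrite mxE (negbTE bi) eq_sym (negbTE bi) mul0r.
have JU : J *m U = J' *m diag_mx d.
  apply/matrixP => a b; rewrite mul_mx_diag !mxE; case: eqP => [bi|/eqP bi].
    move/colP/(_ a): Ju; rewrite !mxE mulrC => <-.
    by apply: eq_bigr => c _; rewrite mxE bi eqxx.
  rewrite mulr1 (bigD1 b)//= big1 ?addr0 => [|c cb].
    by rewrite mxE (negbTE bi) eqxx mulr1.
  by rewrite mxE (negbTE bi) (negbTE cb) mulr0.
have detd : \det (diag_mx d) = p%:R.
  rewrite det_diag (bigD1 i)//= mxE eqxx big1 ?mulr1// => b bi.
  by rewrite mxE (negbTE bi).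
have detJ' : \det J' = p%:R ^+ q * (t * u i 0).
  have := congr1 determinant JU; rewrite !det_mulmx detU detd Jt exprS.
  move=> h; apply: (mulIf (ppX_neq0 p_pr 1)); rewrite expr1 -h.
  by rewrite [RHS]mulrC !mulrA.
have J'col x : J' *m x = \sum_(b | b != i) x b 0 *: col b J + x i 0 *: w.
  apply/colP => a; rewrite !mxE (bigD1 i)//= addrC mxE eqxx summxE mulrC.
  congr (_ + _); apply: eq_bigr => b bi.
  by rewrite !mxE (negbTE bi) mulrC.
have Jcol x : J *m x = \sum_(b | b != i) x b 0 *: col b J + x i 0 *: col i J.
  apply/colP => a; rewrite !mxE (bigD1 i)//= addrC summxE mulrC.
  by congr (_ + _); apply: eq_bigr => b bi; rewrite !mxE mulrC.
(* J O^D is the set of J' y with p dividing the i-th coordinate of y *)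
have JJ' (x : 'cV[O]_D) : exists y : 'cV[O]_D, pdvd 1 (y i 0) /\ J *m x = J' *m y.
  pose c := x i 0 * (u i 0)^-1.
  exists (\col_b if b == i then p%:R * c else x b 0 - c * u b 0).
  split; first by rewrite mxE eqxx -[p%:R]expr1 pdvd_pX.
  rewrite J'col mxE eqxx.
  under eq_bigr => b bi do rewrite mxE (negbTE bi) scalerBl.
  rewrite sumrB mulrC -scalerA -Ju Jcol [x i 0](_ : _ = c * u i 0); last first.
    by rewrite /c divrK.
  rewrite Jcol scalerDr scaler_sumr scalerA.
  under [X in _ - X + _]eq_bigr do rewrite -scalerA.
  by rewrite addrA subrK.
have J'J (y : 'cV[O]_D) : pdvd 1 (y i 0) -> exists x : 'cV[O]_D, J' *m y = J *m x.
  move=> /pdvdP[c yi].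
  exists (\col_b (if b == i then c * u i 0 else y b 0 + c * u b 0)).
  rewrite J'col yi expr1 mulrC -scalerA -Ju !Jcol mxE eqxx.
  under [in RHS]eq_bigr => b bi do rewrite mxE (negbTE bi) scalerDl.
  rewrite big_split /= scalerDr scaler_sumr scalerA.
  by under [X in _ + (X + _)]eq_bigr do rewrite scalerA; rewrite addrA.
have J'inj (x y : 'cV[O]_D) : J' *m x = J' *m y -> x = y.
  move=> h; apply/eqP; rewrite -subr_eq0; apply/eqP.
  have /(congr1 (mulmx (\adj J'))) : J' *m (x - y) = 0 by rewrite mulmxBr h subrr.
  rewrite mulmx0 mulmxA mul_adj_mx detJ' mul_scalar_mx => /colP h0.
  apply/colP => a; move: (h0 a); rewrite !mxE => /eqP.
  rewrite mulf_eq0 mulf_eq0 (negbTE (ppX_neq0 _ _)) /= => /orP[/eqP tu0|/eqP//].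
  by move: (unitrM t (u i 0)); rewrite tU ui tu0 unitr0.
have J'w (y : 'cV[O]_D) r b :
    (J' *m (y + r *: delta_mx i 0)) b 0 = (J' *m y) b 0 + r * w b 0.
  rewrite mulmxDr -scalemxAr !mxE; congr (_ + _ * _).
  rewrite (bigD1 i)//= big1 => [|c ci].
    by rewrite addr0 !mxE !eqxx mulr1.
  by rewrite !mxE (negbTE ci) mulr0.
have := IH _ J' detJ'; rewrite unitrM tU ui => /(_ isT).
have J'M a : (forall i, pdvd M (a i)) -> lattice J' a.
  by move=> /JM[x ax]; have [y [_ yE]] := JJ' x; exists y; rewrite ax.
(* The p cosets of J O^D in J' O^D are the shifts by r w with r < p; in the coordinates of J', r is
   the i-th one modulo p. *)
move=> /(_ J'M); rewrite (@avg_tiling R p p_pr _ M 'I_p (fun r b => r%:R * w b 0) _ (lattice J)).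
- by rewrite card_ord exprS invfM => <-; rewrite mulrA mulVf// mul1r.
- exact/ind_res_periodic/lattice_res_periodic.
- move=> r a [x ax]; have [y [_ xy]] := JJ' x.
  exists (y + r%:R *: delta_mx i 0); apply/colP => b.
  by rewrite J'w -xy -ax !mxE subrK.
- move=> a [y ay]; have rlt : ((y i 0)%R 1%N < p)%N.
    by rewrite -[X in (_ < X)%N]expn1 padic_res_lt.
  exists (Ordinal rlt) => /=.
  have [|x xE] := J'J (y + - ((y i 0) 1%N)%:R *: delta_mx i 0).
    by rewrite !mxE !eqxx mulr1; apply: padic_natr_res.
  exists x; rewrite -xE; apply/colP => b.
  by rewrite J'w -ay !mxE mulNr.
- move=> a r r' [x ax] [x' ax']; apply: val_inj => /=.
  have [y [yi xy]] := JJ' x; have [y' [yi' xy']] := JJ' x'.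
  have : J' *m (y + r%:R *: delta_mx i 0) = J' *m (y' + r'%:R *: delta_mx i 0).
    by apply/colP => b; rewrite !J'w -xy -xy' -ax -ax' !mxE !subrK.
  move/J'inj/colP/(_ i); rewrite !mxE !eqxx !mulr1 => /eqP.
  rewrite addrC -subr_eq -addrA eq_sym -subr_eq0 => /eqP h.
  have : pdvd 1 (r'%:R - r%:R : O).
    have -> : (r'%:R - r%:R : O) = y i 0 - y' i 0.
      by apply/eqP; rewrite -subr_eq0 -h; apply/eqP; ring.
    exact: pdvdB.
  rewrite -padic_res_eq !padic_int_natr expn1 !modn_small// => /eqP->//.
Qed.

End Density.

(** * Systems of forms in the charts of the Grassmannian *)

Section LinearSubstitution.
Variable S : comNzRingType.

(** Reduces compatibility of substitutions with sums and products to a check on constants and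
    variables. *)
Lemma mpoly_alg_ind n (Q : {mpoly S[n]} -> Prop) :
  (forall c, Q c%:MP) -> (forall i, Q 'X_i) ->
  (forall f g, Q f -> Q g -> Q (f + g)) ->
  (forall f g, Q f -> Q g -> Q (f * g)) -> forall f, Q f.
Proof.
move=> QC QX QD QM f; rewrite [f]mpolyE.
elim/big_ind: _ => [|//|m _]; first by rewrite -mpolyC0.
rewrite -mul_mpolyC; apply: (QM) => //; rewrite mpolyXE_id.
elim/big_ind: _ => [|//|i _]; first by rewrite -mpolyC1.
by elim: (m i) => [|k IH]; rewrite ?expr0 -?mpolyC1// exprS; apply: QM.
Qed.

Definition lform a b (B : 'M[S]_(a, b)) (i : 'I_a) : {mpoly S[b]} :=
  \sum_(l < b) B i l *: 'X_l.

Definition lsub a b (B : 'M[S]_(a, b)) (f : {mpoly S[a]}) : {mpoly S[b]} :=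
  f \mPo [tuple lform B i | i < a].

HB.instance Definition _ a b (B : 'M[S]_(a, b)) :=
  GRing.LRMorphism.copy (lsub B) (comp_mpoly [tuple lform B i | i < a]).

Lemma lsubE a b (B : 'M[S]_(a, b)) f : lsub B f = f \mPo [tuple lform B i | i < a].
Proof. by []. Qed.

Lemma lsubC a b (B : 'M[S]_(a, b)) c : lsub B c%:MP = c%:MP.
Proof. exact: comp_mpolyC. Qed.

Lemma lsubX a b (B : 'M[S]_(a, b)) i : lsub B 'X_i = lform B i.
Proof. by rewrite /lsub comp_mpolyXU -tnth_nth tnth_mktuple. Qed.

Lemma lsub_mul a b c (B : 'M[S]_(a, b)) (C : 'M[S]_(b, c)) f :
  lsub (B *m C) f = lsub C (lsub B f).
Proof.
elim/mpoly_alg_ind: f => [e|i|f g IHf IHg|f g IHf IHg].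
- by rewrite !lsubC.
- rewrite !lsubX /lform linear_sum /=.
  under [RHS]eq_bigr do rewrite linearZ /= lsubX /lform scaler_sumr.
  rewrite exchange_big /=; apply: eq_bigr => l _.
  by rewrite mxE scaler_suml; apply: eq_bigr => j _; rewrite scalerA.
- by rewrite !rmorphD /= IHf IHg.
- by rewrite !rmorphM /= IHf IHg.
Qed.

Lemma lsub1 a (f : {mpoly S[a]}) : lsub 1%:M f = f.
Proof.
elim/mpoly_alg_ind: f => [e|i|f g IHf IHg|f g IHf IHg].
- by rewrite lsubC.
- rewrite lsubX /lform (bigD1 i)//= mxE eqxx scale1r big1 ?addr0// => j ji.
  by rewrite mxE eq_sym (negbTE ji) scale0r.
- by rewrite rmorphD /= IHf IHg.
- by rewrite rmorphM /= IHf IHg.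
Qed.

Lemma lsub_homog a b (B : 'M[S]_(a, b)) f d :
  f \is d.-homog -> lsub B f \is d.-homog.
Proof.
move=> fd; rewrite /lsub comp_mpolyE big_seq; apply: rpred_sum => m mf.
have md : mdeg m = d := dhomog_mf fd mf.
apply: rpredZ; rewrite -md mdegE.
elim/big_ind2: _ => [|p x q y px qy|i _]; first exact: dhomog1.
- exact: dhomogM.
- rewrite tnth_mktuple; suff h : lform B i \is 1.-homog.
    by have := dhomogMn (m i) h; rewrite mul1n.
  by apply: rpred_sum => l _; apply: rpredZ; rewrite dhomogX; apply/eqP/mdeg1.
Qed.

(** Expanding to second order involves no factorials, so the remainder has coefficients in the same
    ring, in particular in Z_p. *)
Lemma lsub_taylor a b (B C : 'M[S]_(a, b)) h f : exists g,
  lsub (B + h *: C) f = lsub B f +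
    h *: \sum_i lform C i * lsub B f^`M(i) + h ^+ 2 *: g.
Proof.
elim/mpoly_alg_ind: f => [e|i|f f' [g IHf] [g' IHf']|f f' [g IHf] [g' IHf']].
- exists 0; rewrite !lsubC big1 ?scaler0 ?addr0// => i _.
  by rewrite mderivC linear0 mulr0.
- exists 0; rewrite !lsubX (bigD1 i)//= big1 ?addr0 => [|j ji].
    rewrite mderivX mnm1E eqxx scale1r.
    rewrite (_ : (U_(i) - U_(i))%MM = 0%MM); last first.
      by apply/mnmP => l; rewrite mnmBE subnn mnm0E.
    rewrite mpolyX0 rmorph1 mulr1 scaler0 addr0.
    rewrite /lform scaler_sumr -big_split /=; apply: eq_bigr => l _.
    by rewrite !mxE scalerDl scalerA.
  by rewrite mderivX mnm1E eq_sym (negbTE ji) scale0r linear0 mulr0.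
- exists (g + g'); rewrite !rmorphD /= IHf IHf' /=.
  under [in RHS]eq_bigr do rewrite mderivD rmorphD mulrDr.
  rewrite big_split /= -!mul_mpolyC.
  move: (\sum_i _) (\sum_i _) (lsub B f) (lsub B f') (_%:MP) (_%:MP) => *.
  by ring.
- pose T u := \sum_i lform C i * lsub B u^`M(i).
  (* What is left of the product of the two expansions once h^2 is factored out. *)
  exists (lsub B f * g' + g * lsub B f' + T f * T f' + h *: (T f * g' + g * T f')
    + h ^+ 2 *: (g * g')).
  have -> : \sum_i lform C i * lsub B (f * f')^`M(i) =
      T f * lsub B f' + lsub B f * T f'.
    rewrite /T mulr_sumr mulr_suml -big_split /=; apply: eq_bigr => i _.
    by rewrite mderivM rmorphD /= !rmorphM /= mulrDr mulrA mulrCA.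
  rewrite !rmorphM /= IHf IHf' -/(T f) -/(T f') -!mul_mpolyC rmorphXn /=.
  move: (T f) (T f') (h%:MP) (lsub B f) (lsub B f') => *.
  by ring.
Qed.

Lemma lsub_cong a b (B C : 'M[S]_(a, b)) h f :
  exists g, lsub (B + h *: C) f = lsub B f + h *: g.
Proof.
have [g ->] := lsub_taylor B C h f.
by eexists; rewrite -addrA expr2 -scalerA -scalerDr.
Qed.

End LinearSubstitution.

Opaque lsub.

Section MapSubstitution.
Variables (S S' : comNzRingType) (phi : {rmorphism S -> S'}).

Lemma map_lform a b (B : 'M[S]_(a, b)) i :
  map_mpoly phi (lform B i) = lform (map_mx phi B) i.
Proof.
rewrite /lform rmorph_sum /=; apply: eq_bigr => l _.
by rewrite map_mpolyZ map_mpolyX mxE.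
Qed.

Lemma map_lsub a b (B : 'M[S]_(a, b)) f :
  map_mpoly phi (lsub B f) = lsub (map_mx phi B) (map_mpoly phi f).
Proof.
elim/mpoly_alg_ind: f => [e|i|f g IHf IHg|f g IHf IHg].
- by rewrite lsubC !map_mpolyC lsubC.
- by rewrite lsubX map_mpolyX lsubX map_lform.
- by rewrite !rmorphD /= IHf IHg.
- by rewrite !rmorphM /= IHf IHg.
Qed.

End MapSubstitution.

Section HomogeneousForms.
Variable S : comNzRingType.

Definition hform N d (c : hmonom N d -> S) : {mpoly S[N]} :=
  \sum_(m : hmonom N d) c m *: 'X_[bmnm (val m)].

Lemma hform_coef N d (c : hmonom N d -> S) m : (hform c)@_(bmnm (val m)) = c m.
Proof.
rewrite /hform raddf_sum (bigD1 m)//= big1 ?addr0 => [|m' mm'].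
  by rewrite mcoeffZ mcoeffX eqxx mulr1.
rewrite mcoeffZ mcoeffX; case: eqP => [e|]; last by rewrite mulr0.
by case/eqP: mm'; do 2 apply: val_inj.
Qed.

Lemma hform_homog N d (c : hmonom N d -> S) : hform c \is d.-homog.
Proof.
apply: rpred_sum => m _; apply: rpredZ; rewrite dhomogX.
exact: (valP m).
Qed.

Lemma homog_hform N d (f : {mpoly S[N]}) : f \is d.-homog ->
  f = hform (fun m : hmonom N d => f@_(bmnm (val m))).
Proof.
move=> fd; apply/mpolyP => m0; case: (eqVneq (mdeg m0) d) => [md|md]; last first.
  by rewrite (dhomog_nemf_coeff fd md) (dhomog_nemf_coeff (hform_homog _) md).
have mlt : (mdeg m0 < d.+1)%N by rewrite md.
have mE : mdeg (BMultinom mlt) == d by rewrite /= md.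
by rewrite (hform_coef _ (Sub (BMultinom mlt) mE : hmonom N d)).
Qed.

End HomogeneousForms.

(** * Block matrices of an affine chart *)

Section Charts.
Variables (S : comNzRingType) (r s N : nat) (e : (r + s = N)%N).

(** The equation [e] is a parameter with N a variable, so that destructing it turns every cast into
    the identity; in the application (k + 1) + (n - k) and n + 1 are not convertible. *)
Definition stk (A : 'M[S]_(s, r)) : 'M[S]_(N, r) :=
  castmx (e, erefl) (col_mx 1%:M A).
Definition dirm (A : 'M[S]_(s, r)) : 'M[S]_(N, r) :=
  castmx (e, erefl) (col_mx 0 A).
Definition uni (A : 'M[S]_(s, r)) : 'M[S]_N :=
  castmx (e, e) (block_mx 1%:M 0 A 1%:M).
Definition low (A : 'M[S]_(s, r)) : 'M[S]_N :=
  castmx (e, e) (block_mx 0 0 A 0).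
Definition prj : 'M[S]_(r, N) := castmx (erefl, e) (row_mx 1%:M 0).

Lemma stkZ h A : stk (h *: A) = stk 0 + h *: dirm A.
Proof.
rewrite /stk /dirm; case: _ / e; rewrite !castmx_id scale_col_mx add_col_mx.
by rewrite scaler0 addr0 add0r.
Qed.

Lemma uniZ h A : uni (h *: A) = 1%:M + h *: low A.
Proof.
rewrite /uni /low; case: _ / e; rewrite !castmx_id scale_block_mx.
by rewrite [1%:M in RHS]scalar_mx_block add_block_mx !scaler0 !addr0 add0r.
Qed.

(** Translation in a chart is left multiplication by a unipotent matrix, hence a linear change of
    variables in the forms. *)
Lemma uni_stk A B : uni A *m stk B = stk (A + B).
Proof.
rewrite /uni /stk; case: _ / e; rewrite !castmx_id mul_block_col.
by rewrite !mul1mx mul0mx addr0 mulmx1.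
Qed.

Lemma uniD A B : uni (A + B) = uni A *m uni B.
Proof.
rewrite /uni; case: _ / e; rewrite !castmx_id mulmx_block.
by rewrite !mul1mx !mulmx1 !mul0mx !mulmx0 !addr0 add0r.
Qed.

Lemma uni0 : uni 0 = 1%:M.
Proof. by rewrite /uni; case: _ / e; rewrite castmx_id -scalar_mx_block. Qed.

Lemma prj_stk A : prj *m stk A = 1%:M.
Proof.
rewrite /prj /stk; case: _ / e; rewrite !castmx_id mul_row_col.
by rewrite mul1mx mul0mx addr0.
Qed.

End Charts.

(** * Coefficient vectors, the map psi and its Jacobian over Z_p *)

Section Systems.
Variables (p : nat) (p_pr : prime p).
Local Notation O := (padic_int p_pr).
Variables (nu r s N D : nat) (e : (r + s = N)%N) (d : 'I_nu -> nat).
Hypothesis DE : D = (s * r)%N.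

Definition cidx n := {j : 'I_nu & hmonom n (d j)}.

(* [tau] numbers the components of psi; only the order of the rows of its
   Jacobian matrix depends on it. *)
Variable tau : 'I_D -> cidx r.

Local Notation V := (cidx N -> O).

Definition forms n (b : cidx n -> O) (j : 'I_nu) : {mpoly O[n]} :=
  hform (fun m : hmonom n (d j) => b (Tagged (fun j => hmonom n (d j)) m)).

Definition coefs n (F : 'I_nu -> {mpoly O[n]}) : cidx n -> O :=
  fun i => (F (tag i))@_(bmnm (val (tagged i))).

Lemma form_coefs n (F : 'I_nu -> {mpoly O[n]}) j :
  (forall j, F j \is (d j).-homog) -> forms (coefs F) j = F j.
Proof. by move=> Fd; rewrite [RHS](homog_hform (Fd j)). Qed.

Lemma coefs_form n (b : cidx n -> O) : coefs (forms b) = b.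
Proof. by apply: funext => -[j m]; rewrite /coefs /forms hform_coef. Qed.

Lemma form_homog n (b : cidx n -> O) j : forms b j \is (d j).-homog.
Proof. exact: hform_homog. Qed.

Lemma formDZ n (b b' : cidx n -> O) h j :
  forms (fun i => b i + h * b' i) j = forms b j + h *: forms b' j.
Proof.
rewrite /forms /hform scaler_sumr -big_split /=; apply: eq_bigr => m _.
by rewrite scalerDl scalerA.
Qed.

Definition act (g : 'M[O]_N) (b : V) : V := coefs (fun j => lsub g (forms b j)).

Lemma form_act g b j : forms (act g b) j = lsub g (forms b j).
Proof. by apply: form_coefs => i; apply/lsub_homog/form_homog. Qed.

Lemma act_mul g h b : act (g *m h) b = act h (act g b).
Proof.
by apply: (congr1 (@coefs N)); apply: funext => j; rewrite lsub_mul form_act.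
Qed.

Lemma act1 b : act 1%:M b = b.
Proof.
rewrite -[RHS]coefs_form; apply: (congr1 (@coefs N)); apply: funext => j.
exact: lsub1.
Qed.

Lemma coefsDZi n (F G : 'I_nu -> {mpoly O[n]}) h i :
  coefs (fun j => F j + h *: G j) i = coefs F i + h * coefs G i.
Proof. by rewrite /coefs mcoeffD mcoeffZ. Qed.

Lemma coefsDZ n (F G : 'I_nu -> {mpoly O[n]}) h :
  coefs (fun j => F j + h *: G j) = (fun i => coefs F i + h * coefs G i).
Proof. by apply: funext => i; rewrite coefsDZi. Qed.

Lemma actDZ g b b' h :
  act g (fun i => b i + h * b' i) = (fun i => act g b i + h * act g b' i).
Proof.
rewrite -coefsDZ; apply: (congr1 (@coefs N)); apply: funext => j.
by rewrite formDZ linearD linearZ.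
Qed.

Lemma vcongP (J : finType) m (b b' : J -> O) : vcong m b b' ->
  exists c, b = (fun i => b' i + p%:R ^+ m * c i).
Proof.
move=> bb'; have /choice[c cE] i : exists t, b i - b' i = p%:R ^+ m * t.
  exact/pdvdP/bb'.
by exists c; apply: funext => i; rewrite -cE addrC subrK.
Qed.

Lemma act_cong m g b b' : vcong m b b' -> vcong m (act g b) (act g b').
Proof.
by move=> /vcongP[c ->] i; rewrite actDZ addrC addKr pdvd_pX.
Qed.

Definition Amx (x : 'cV[O]_D) : 'M[O]_(s, r) := vec_mx (castmx (erefl, DE) x^T).

Lemma AmxDZ x y h : Amx (x + h *: y) = Amx x + h *: Amx y.
Proof.
apply/matrixP => i j; rewrite !mxE !castmxE !mxE.
by rewrite !cast_ord_id.
Qed.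

Lemma AmxD x y : Amx (x + y) = Amx x + Amx y.
Proof. by have := AmxDZ x y 1; rewrite !scale1r. Qed.

Lemma Amx0 : Amx 0 = 0.
Proof. by apply/matrixP => i j; rewrite !mxE castmxE !mxE. Qed.

Lemma AmxZ h x : Amx (h *: x) = h *: Amx x.
Proof. by have := AmxDZ 0 x h; rewrite !add0r Amx0 add0r. Qed.

Lemma Amx_inj : injective Amx.
Proof.
move=> x y /(can_inj vec_mxK) /(congr1 (castmx (esym (erefl 1%N), esym DE))).
rewrite !castmxK => h.
by rewrite -[x]trmxK h trmxK.
Qed.

Lemma Amx_surj A : exists x, Amx x = A.
Proof.
exists (castmx (esym (erefl 1%N), esym DE) (mxvec A))^T.
by rewrite /Amx trmxK castmxKV mxvecK.
Qed.

Definition psiO (b : V) (x : 'cV[O]_D) : 'cV[O]_D :=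
  \col_i coefs (fun j => lsub (stk e (Amx x)) (forms b j)) (tau i).

(** The differential of [psiO b] at 0, taken from the linear term of [lsub_taylor]; in this
    algebraic form it is linear in [b] and in [x]. *)
Definition dpsi (b : V) (x : 'cV[O]_D) : 'cV[O]_D :=
  \col_i coefs (fun j => \sum_k lform (dirm e (Amx x)) k *
                 lsub (stk e 0) ((forms b j)^`M(k))) (tau i).

Definition jac (b : V) : 'M[O]_D := \matrix_(i, t) dpsi b (delta_mx t 0) i 0.

Lemma dirmDZ A B h : dirm e (A + h *: B) = dirm e A + h *: dirm e B :> 'M[O]_(_, _).
Proof.
rewrite /dirm; case: _ / e; rewrite !castmx_id scale_col_mx add_col_mx.
by rewrite scaler0 addr0.
Qed.

Lemma lformDZ a b (A B : 'M[O]_(a, b)) h i :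
  lform (A + h *: B) i = lform A i + h *: lform B i.
Proof.
rewrite /lform scaler_sumr -big_split /=; apply: eq_bigr => l _.
by rewrite !mxE scalerDl scalerA.
Qed.

Lemma dpsiDZ b x y h : dpsi b (x + h *: y) = dpsi b x + h *: dpsi b y.
Proof.
apply/colP => i; rewrite !mxE -coefsDZi /coefs; congr mcoeff.
rewrite scaler_sumr -big_split /=; apply: eq_bigr => k _.
by rewrite AmxDZ dirmDZ lformDZ mulrDl scalerAl.
Qed.

Lemma dpsi_jac b x : dpsi b x = jac b *m x.
Proof.
have dpsi0 : dpsi b 0 = 0.
  have := dpsiDZ b 0 0 1; rewrite scale1r addr0 scale1r => h.
  by apply: (addrI (dpsi b 0)); rewrite addr0 -h.
have dpsi_sum (J : Type) (l : seq J) (c : J -> O) (v : J -> 'cV[O]_D) :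
    dpsi b (\sum_(j <- l) c j *: v j) = \sum_(j <- l) c j *: dpsi b (v j).
  elim: l => [|j l IH]; first by rewrite !big_nil.
  by rewrite !big_cons addrC dpsiDZ IH addrC.
have xE : x = \sum_(t <- enum 'I_D) x t 0 *: delta_mx t 0.
  rewrite big_enum /=; apply/colP => i; rewrite summxE (bigD1 i)//= big1 ?addr0.
    by rewrite !mxE !eqxx mulr1.
  by move=> j ji; rewrite !mxE eq_sym (negbTE ji) mulr0.
rewrite {1}xE dpsi_sum big_enum /=; apply/colP => i; rewrite summxE mxE.
by apply: eq_bigr => t _; rewrite !mxE mulrC.
Qed.

Lemma psi_taylor b x h : exists R,
  psiO b (h *: x) = psiO b 0 + h *: (jac b *m x) + h ^+ 2 *: R.
Proof.
have /choice[g gE] : forall j, exists g, lsub (stk e (Amx (h *: x))) (forms b j) =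
   lsub (stk e (Amx 0)) (forms b j) + h *: (\sum_k lform (dirm e (Amx x)) k *
     lsub (stk e 0) ((forms b j)^`M(k))) + h ^+ 2 *: g.
  by move=> j; rewrite AmxZ stkZ Amx0; apply: lsub_taylor.
exists (\col_i coefs g (tau i)); rewrite -dpsi_jac; apply/colP => i.
rewrite !mxE /coefs gE mcoeffD mcoeffZ; congr (_ + _).
by rewrite mcoeffD mcoeffZ.
Qed.

(** Moves the point x of the chart to the origin, see [psi_trans]. *)
Definition trans (x : 'cV[O]_D) (b : V) : V := act (uni e (Amx x)) b.

Lemma psi_trans b x y : psiO (trans x b) y = psiO b (x + y).
Proof.
apply/colP => i; rewrite [LHS]mxE [RHS]mxE /coefs /trans form_act -lsub_mul uni_stk.
by rewrite AmxD.
Qed.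

Lemma transD x y b : trans (x + y) b = trans y (trans x b).
Proof. by rewrite /trans AmxD uniD act_mul. Qed.

(** The unipotent matrix of p^m x is the identity modulo p^m. Hence the Jacobian at any point of a
    ball of radius p^-m agrees modulo p^m with the one at the centre. *)
Lemma trans_cong m x b : vcong m (trans (p%:R ^+ m *: x) b) b.
Proof.
move=> i; rewrite /trans AmxZ uniZ /act /coefs.
have [g ->] := lsub_cong 1%:M (low e (Amx x)) (p%:R ^+ m) (forms b (tag i)).
rewrite lsub1 mcoeffD mcoeffZ -/(coefs (forms b) i) coefs_form.
by rewrite addrC addKr pdvd_pX.
Qed.

Lemma psiDZ b b' h x : psiO (fun i => b i + h * b' i) x = psiO b x + h *: psiO b' x.
Proof.
apply/colP => i; rewrite !mxE /coefs formDZ linearD linearZ /=.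
by rewrite mcoeffD mcoeffZ.
Qed.

Lemma jacDZ b b' h : jac (fun i => b i + h * b' i) = jac b + h *: jac b'.
Proof.
apply/matrixP => i t; rewrite !mxE -coefsDZi /coefs; congr mcoeff.
rewrite scaler_sumr -big_split /=; apply: eq_bigr => k _.
by rewrite formDZ mderivD mderivZ linearD linearZ /= mulrDr scalerAr.
Qed.

Lemma jac_cong m b b' : vcong m b b' -> exists E, jac b = jac b' + p%:R ^+ m *: E.
Proof. by move=> /vcongP[c ->]; rewrite jacDZ; exists (jac c). Qed.

Lemma psi_cong m b b' x : vcong m b b' ->
  exists y, psiO b x = psiO b' x + p%:R ^+ m *: y.
Proof. by move=> /vcongP[c ->]; rewrite psiDZ; exists (psiO c x). Qed.

(* The coefficients of the monomials in the first r variables, which are the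
   coordinates of psiO b 0; jac b does not involve them. *)
Variable tau' : cidx r -> 'I_D.
Hypothesis tauK : cancel tau tau'.

Definition ext (y : 'I_D -> O) : V :=
  coefs (fun j => lsub (prj O e) (forms (fun i => y (tau' i)) j)).

Lemma psi_ext y x : psiO (ext y) x = \col_i y i.
Proof.
apply/colP => i; rewrite !mxE /coefs form_coefs => [|j].
  rewrite -lsub_mul prj_stk lsub1 -/(coefs (forms _) _) coefs_form.
  by rewrite tauK.
exact/lsub_homog/form_homog.
Qed.

(** [psiO (ext y)] is constant, so the Taylor formula with h = p^m makes every entry of the Jacobian
    divisible by p^m, for all m. *)
Lemma jac_ext y : jac (ext y) = 0.
Proof.
apply/matrixP => i t; rewrite [RHS]mxE; apply: pdvd_all => m.
have [R] := psi_taylor (ext y) (delta_mx t 0) (p%:R ^+ m).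
rewrite !psi_ext -addrA -[LHS]addr0 => /addrI/esym.
rewrite expr2 -scalerA -scalerDr -colE => /colP/(_ i).
rewrite [LHS]mxE [RHS]mxE => /eqP.
rewrite mulf_eq0 (negbTE (ppX_neq0 _ _)) /=.
rewrite [X in X == _]mxE [X in X + _ == _]mxE addr_eq0 => /eqP ->.
by rewrite pdvdN mxE pdvd_pX.
Qed.

End Systems.

(** * Hensel's lemma *)

Section Hensel.
Variables (p : nat) (p_pr : prime p).
Local Notation O := (padic_int p_pr).
Variables (nu r s N D : nat) (e : (r + s = N)%N) (d : 'I_nu -> nat).
Hypothesis DE : D = (s * r)%N.
Variable tau : 'I_D -> cidx d r.

Local Notation V := (cidx d N -> O).
Local Notation psiO := (@psiO p p_pr nu r s N D e d DE tau).
Local Notation jac := (@jac p p_pr nu r s N D e d DE tau).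
Local Notation trans := (@trans p p_pr nu r s N D e d DE).
Local Notation pX m := (p%:R ^+ m : O).

Lemma pX_scaleI m a b : injective (fun A : 'M[O]_(a, b) => pX m *: A).
Proof.
move=> A B /matrixP AB; apply/matrixP => i j; move: (AB i j); rewrite !mxE.
exact/mulfI/ppX_neq0.
Qed.

(** [Y] is p^q J^-1, which is integral: inverting J costs q < m digits. *)
Lemma adj_bound m (J : 'M[O]_D) : ~~ pdvd m (\det J) ->
  exists q t Y, [/\ (q < m)%N, t \is a GRing.unit, \det J = pX q * t,
    J *m Y = (pX q)%:M & Y *m J = (pX q)%:M].
Proof.
move=> Jm; have J0 : \det J != 0 by apply: contraNneq Jm => ->; apply: pdvd0.
have [q [t [tU detJ]]] := pdvd_split J0.
exists q, t, (t^-1 *: \adj J); split=> //.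
- by rewrite detJ pdvd_unit// -ltnNge in Jm.
- rewrite -scalemxAr mul_mx_adj detJ -!mul_scalar_mx -scalar_mxM.
  by rewrite mulrCA mulVr// mulr1.
- rewrite -scalemxAl mul_adj_mx detJ -!mul_scalar_mx -scalar_mxM.
  by rewrite mulrCA mulVr// mulr1.
Qed.

Lemma jac_trans m x b : exists E, jac (trans (pX m *: x) b) = jac b + pX m *: E.
Proof. exact/jac_cong/trans_cong. Qed.

(** [Q] is chosen point by point, yet it is determined, as p^(2 m) is not a zero divisor. Comparing
    the expansions about 0 and about p^m y, whose Jacobians agree modulo p^m, shows that it
    preserves congruences. *)
Lemma psi_rest m b : exists Q : 'cV[O]_D -> 'cV[O]_D,
  (forall y, psiO b (pX m *: y) =
     psiO b 0 + pX m *: (jac b *m y) + pX m ^+ 2 *: Q y) /\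
  (forall k y z, exists w, Q (y + pX k *: z) = Q y + pX k *: w).
Proof.
have /choice[Q QE] y := psi_taylor e DE tau b y (pX m).
exists Q; split=> // k y z.
have [E JE] := jac_trans m y b.
have [Q' Q'E] := psi_taylor e DE tau (trans (pX m *: y) b) z (pX (m + k)).
exists (E *m z + pX k *: Q').
apply: (@pX_scaleI (m + m)); rewrite /= exprD -expr2.
have := QE (y + pX k *: z).
rewrite scalerDr scalerA -exprD -psi_trans Q'E psi_trans addr0 QE JE.
set c := psiO b 0 => h.
apply: (addrI (c + pX m *: (jac b *m (y + pX k *: z)))); rewrite -h.
rewrite !mulmxDr !mulmxDl -!scalemxAr -!scalemxAl !scalerDr !scalerA.
apply/colP => i; rewrite !mxE !exprD.
move: (c i 0) (Q y i 0) (Q' i 0) ((jac b *m y) i 0) ((jac b *m z) i 0)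
  ((E *m z) i 0) (pX m) (pX k) => *.
by ring.
Qed.

(** In place of a smallness condition on psi(0) stands membership in p^m J Z_p^D, which
    [hensel_conv] shows to be necessary as well; the criterion is therefore exact. *)
Lemma hensel m b x : ~~ pdvd m (\det (jac b)) ->
  psiO b 0 = pX m *: (jac b *m x) ->
  exists2 y, psiO b (pX m *: y) = 0 &
    forall y', psiO b (pX m *: y') = 0 -> y' = y.
Proof.
move=> Jm cx; have [q [t [Y [qm tU detJ JY YJ]]]] := adj_bound Jm.
have [Q [QE Qlip]] := psi_rest m b.
have mq : pX m = pX (m - q) * pX q by rewrite -exprD subnK// ltnW.
(* With psi(0) = p^m J x and J Y = p^q, the value psi(p^m y) equals p^m J (y - phi y), so the zeros
   are the fixed points of [phi]. *)
have [phi phiE] : exists phi : 'cV[O]_D -> 'cV[O]_D, forall y, phi y = - (x + pX (m - q) *: (Y *m Q y)).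
  by eexists=> y.
have zeroP (y : 'cV[O]_D) : psiO b (pX m *: y) = 0 <-> phi y = y.
  have -> : psiO b (pX m *: y) = pX m *: (jac b *m (y - phi y)).
    rewrite QE cx phiE opprK !mulmxDr -scalemxAr mulmxA JY mul_scalar_mx.
    rewrite !scalerDr !scalerA addrA [X in X + _]addrC.
    by rewrite -mq -expr2.
  split=> [h|->]; last by rewrite subrr mulmx0 scaler0.
  have /pX_scaleI h0 : pX m *: (jac b *m (y - phi y)) = pX m *: 0.
    by rewrite h scaler0.
  have /(congr1 (mulmx Y)) := h0; rewrite mulmx0 mulmxA YJ mul_scalar_mx => h1.
  have /pX_scaleI/eqP : pX q *: (y - phi y) = pX q *: 0 by rewrite h1 scaler0.
  by rewrite subr_eq0 => /eqP.
have phi_lip k (y z : 'cV[O]_D) : exists w : 'cV[O]_D, phi (y + pX k *: z) = phi y + pX k.+1 *: w.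
  (* As q < m, one factor p can be taken out of p^(m - q); it is the digit gained. *)
  have [w wE] := Qlip k y z; exists (- (pX (m - q).-1 *: (Y *m w))).
  rewrite !phiE wE mulmxDr -scalemxAr scalerDr scalerA addrA opprD; congr (_ + _).
  rewrite scalerN scalerA -!exprD addSnnS prednK ?subn_gt0//.
  by rewrite addnC.
have lip k (y y' : 'cV[O]_D) : (forall i, pdvd k (y i 0 - y' i 0)) ->
    forall i, pdvd k.+1 (phi y i 0 - phi y' i 0).
  move=> yy'; have /pdvd_mx[z zE] : forall i j, pdvd k ((y - y') i j).
    by move=> i j; rewrite (ord1 j) !mxE.
  have [w wE] := phi_lip k y' z; have yE : y = y' + pX k *: z.
    by rewrite -zE addrC subrK.
  by move=> i; rewrite {1}yE wE [X in X - _]mxE addrAC subrr add0r mxE pdvd_pX.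
have [|u uE] := @contraction_fix _ p_pr 'I_D (fun u i => phi (\col_j u j) i 0).
  by move=> k u v uv i; apply: lip => j; rewrite !mxE.
have yE : phi (\col_j u j) = \col_j u j by apply/colP => i; rewrite uE mxE.
exists (\col_j u j); first exact/zeroP.
move=> y' /zeroP y'E; apply/eqP; rewrite -subr_eq0; apply/eqP/matrixP => i j.
rewrite (ord1 j) [RHS]mxE; apply: pdvd_all => k.
elim: k i => [|k IH] i; first exact: pdvd0n.
rewrite -y'E -yE mxE [X in _ + X]mxE; apply: lip => l.
by have := IH l; rewrite !mxE.
Qed.

Lemma hensel_conv m b y : ~~ pdvd m (\det (jac b)) ->
  psiO b (pX m *: y) = 0 -> exists x, psiO b 0 = pX m *: (jac b *m x).
Proof.
move=> Jm h; have [q [t [Y [qm tU detJ JY YJ]]]] := adj_bound Jm.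
have [Q [QE Qlip]] := psi_rest m b.
have mq : pX m = pX (m - q) * pX q by rewrite -exprD subnK// ltnW.
exists (- (y + pX (m - q) *: (Y *m Q y))).
move: h; rewrite QE mulmxN mulmxDr -scalemxAr mulmxA JY mul_scalar_mx.
rewrite scalerN scalerDr !scalerA -addrA => /eqP; rewrite addr_eq0 => /eqP ->.
by rewrite -mq -expr2.
Qed.

Definition good m b := ~~ pdvd m (\det (jac b)) /\
  exists x, psiO b 0 = pX m *: (jac b *m x).

Lemma pdvd_det_cong m (J J' : 'M[O]_D) E : J = J' + pX m *: E ->
  pdvd m (\det J) = pdvd m (\det J').
Proof.
move=> JE; have h : pdvd m (\det J - \det J').
  apply: padic_det_cong => i j; by rewrite JE !mxE addrAC subrr add0r pdvd_pX.
apply/idP/idP => h'; last by rewrite -(subrK (\det J') (\det J)) pdvdD.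
by rewrite -(subrK (\det J) (\det J')) pdvdD// pdvdBC.
Qed.

(** A change of psi(0) by a multiple of p^(2 m) is p^m times a multiple of p^m, and the latter lies
    in J' Z_p^D because p^m = p^(m - q) J' Y. *)
Lemma good_cong m b b' : vcong (2 * m) b b' -> good m b -> good m b'.
Proof.
move=> bb' [Jm [x cx]].
have [E JE] := jac_cong e DE tau bb'.
have [F cE] := psi_cong e DE tau 0 (vcong_sym bb').
have m2 : pX (2 * m) = pX m * pX m by rewrite mul2n -addnn exprD.
have J'm : ~~ pdvd m (\det (jac b')).
  by rewrite -(@pdvd_det_cong _ (jac b) _ (pX m *: E))// scalerA -m2.
split=> //; have [q [t [Y [qm tU detJ JY YJ]]]] := adj_bound J'm.
have mq : pX m = pX (m - q) * pX q by rewrite -exprD subnK// ltnW.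
exists (x + pX (m - q) *: (Y *m (pX m *: (E *m x) + F))).
have -> : jac b' *m (x + pX (m - q) *: (Y *m (pX m *: (E *m x) + F))) =
    jac b' *m x + pX m *: (pX m *: (E *m x) + F).
  by rewrite mulmxDr -scalemxAr mulmxA JY mul_scalar_mx scalerA -mq.
by rewrite cE cx JE mulmxDl -scalemxAl m2 !scalerDr !scalerA !mulrA addrA.
Qed.

End Hensel.

(** * Counting zeros by residues *)

Section Counting.
Variables (R : realType) (p : nat) (p_pr : prime p).
Local Notation O := (padic_int p_pr).
Variables (nu r s N D : nat) (e : (r + s = N)%N) (d : 'I_nu -> nat).
Hypothesis DE : D = (s * r)%N.
Variable tau : 'I_D -> cidx d r.
Variable tau' : cidx d r -> 'I_D.
Hypothesis tauK : cancel tau tau'.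

Local Notation V := (cidx d N -> O).
Local Notation psiO := (@psiO p p_pr nu r s N D e d DE tau).
Local Notation jac := (@jac p p_pr nu r s N D e d DE tau).
Local Notation trans := (@trans p p_pr nu r s N D e d DE).
Local Notation ext := (@ext p p_pr nu r s N D e d tau').
Local Notation good := (@good p p_pr nu r s N D e d DE tau).
Local Notation pX m := (p%:R ^+ m : O).

Lemma avg_exchange (I J : finType) M (F : (I -> O) -> (J -> O) -> R) :
  avg M (fun a => avg M (fun y => F a y)) = avg M (fun y => avg M (fun a => F a y)).
Proof.
rewrite /avg -!mulr_suml exchange_big /= -!mulrA; congr (_ * _).
exact: mulrC.
Qed.

Lemma p_neq0 : (p%:R : R) != 0.
Proof. by rewrite pnatr_eq0 -lt0n prime_gt0. Qed.

(** Replacing |x|_p by 0 when it is at most p^-m leaves a function of x modulo p^m, see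
    [trunc_abs_cong]. *)
Definition trunc_abs m (x : O) : R :=
  if pdvd m x then 0 else ratr (padic_int_abs x).

Lemma trunc_absE m q t : (q < m)%N -> t \is a GRing.unit ->
  trunc_abs m (pX q * t) = p%:R ^- q.
Proof.
move=> qm tU; rewrite /trunc_abs pdvd_unit// leqNgt qm padic_int_abs_unit//=.
by rewrite fmorphV rmorphXn /= ratr_nat.
Qed.

Lemma trunc_abs_ge0 m x : 0 <= trunc_abs m x.
Proof.
by rewrite /trunc_abs; case: ifP => // _; rewrite ler0q padic_int_abs_ge0.
Qed.

Lemma trunc_abs_nondecreasing x : {homo trunc_abs^~ x : m m' / (m <= m')%N >-> m <= m'}.
Proof.
move=> m m' mm'; rewrite /trunc_abs; case: ifPn => [_|xm].
  by case: ifP => // _; rewrite ler0q padic_int_abs_ge0.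
by rewrite ifN//; apply: contra xm; apply: pdvd_le.
Qed.

(* Averaging over the translations by [ext y], which change psiO b 0 by y and
   fix jac b, turns the density of [good m] into that of a lattice. *)
Lemma avg_ext M (phi : V -> R) : res_periodic M phi ->
  avg M phi = avg M (fun a => avg M (fun y : 'I_D -> O => phi (fun i => a i + ext y i))).
Proof.
move=> phiM; rewrite avg_exchange -[LHS](avg_cst p_pr 'I_D M).
apply: eq_avg => y; rewrite -(avg_translate (fun i => - ext y i) phiM).
by apply: eq_avg => a; congr phi; apply: funext => i; rewrite opprK.
Qed.

Lemma psi_add_ext a y : psiO (fun i => a i + ext y i) 0 = psiO a 0 + \col_i y i.
Proof.
have := psiDZ e DE tau a (ext y) 1 0; rewrite scale1r (psi_ext e DE tauK) => <-.
by apply: (congr1 (psiO ^~ 0)); apply: funext => i; rewrite mul1r.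
Qed.

Lemma jac_add_ext a y : jac (fun i => a i + ext y i) = jac a.
Proof.
have := jacDZ e DE tau a (ext y) 1; rewrite scale1r (jac_ext e DE tauK) addr0 => <-.
by apply: (congr1 jac); apply: funext => i; rewrite mul1r.
Qed.

(** For a fixed Jacobian with det J = p^q t and q < m, psi(0) is uniform on Z_p^D and the lattice
    p^m J Z_p^D has density p^-(m D + q), that is p^-(m D) times |det J|. *)
Lemma avg_good m M : (2 * m <= M)%N ->
  avg M (ind R (good m)) =
  p%:R ^- (m * D) * avg M (fun b => trunc_abs m (\det (jac b))).
Proof.
move=> mM; rewrite avg_ext; last first.
  by apply: (res_periodic_le mM); apply: ind_res_periodic => a b; apply: good_cong.
rewrite -avgZ; apply: eq_avg => a.
case: (boolP (pdvd m (\det (jac a)))) => Jm.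
  rewrite /trunc_abs Jm mulr0 -[RHS](avg_cst p_pr 'I_D M); apply: eq_avg => y.
  by rewrite /ind asboolF// => -[]; rewrite jac_add_ext Jm.
have [q [t [Y [qm tU detJ JY YJ]]]] := adj_bound Jm.
have mq : pX m = pX q * pX (m - q) by rewrite -exprD subnKC// ltnW.
(* p^M z = p^m J (p^(M - m - q) Y z), where m + q <= 2 m <= M. *)
have latM (y : 'I_D -> O) : (forall i, pdvd M (y i)) -> lattice (pX m *: jac a) y.
  move=> yM; have /pdvd_mx[z zE] : forall i j, pdvd M ((\col_i y i) i j).
    by move=> i j; rewrite mxE.
  exists (pX (M - (m + q)) *: (Y *m z)).
  rewrite zE -scalemxAr -scalemxAl mulmxA JY mul_scalar_mx !scalerA -!exprD.
  congr (pX _ *: _); rewrite -addnA subnK//.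
  by rewrite (leq_trans _ mM)// mul2n -addnn leq_add2l ltnW.
have detmJ : \det (pX m *: jac a) = pX (m * D + q) * t.
  by rewrite detZ detJ exprD exprM mulrA.
rewrite detJ trunc_absE// -invfM -exprD.
rewrite -(@density_lattice R p p_pr D M _ t (pX m *: jac a))//.
rewrite -[RHS](@avg_translate R p p_pr _ M _ (fun i => - psiO a 0 i 0)); last first.
  exact/ind_res_periodic/lattice_res_periodic.
apply: eq_avg => y; apply: eq_ind; rewrite /good /lattice jac_add_ext psi_add_ext.
have -> : \col_i (y i - - psiO a 0 i 0) = psiO a 0 + \col_i y i.
  by apply/colP => i; rewrite [LHS]mxE [RHS]mxE [X in _ = _ + X]mxE opprK addrC.
by split=> [[_ [x ->]]|[x ->]]; [|split=> //]; exists x; rewrite scalemxAl.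
Qed.

(* What a zero x in p^m Z_p^D with det J(x) = 0 forces on the residue of b
   modulo p^(2 m): J(0) is singular modulo p^m in a primitive direction, and
   psi(0) lies in p^m J(0) Z_p^D up to second order. *)
Definition bad m (b : V) :=
  (exists (u : 'rV[O]_D) i w, u 0 i \is a GRing.unit /\ u *m jac b = pX m *: w) /\
  exists x z, psiO b 0 = pX m *: (jac b *m x) + pX (2 * m) *: z.

Lemma bad_cong m b b' : vcong (2 * m) b b' -> bad m b -> bad m b'.
Proof.
move=> /vcong_sym bb' [[u [i [w [ui uJ]]]] [x [z cb]]].
have m2 : pX (2 * m) = pX m * pX m by rewrite mul2n -addnn exprD.
have [E JE] := jac_cong e DE tau bb'.
have [F cE] := psi_cong e DE tau 0 bb'.
split.
  exists u, i, (w + pX m *: (u *m E)); split=> //.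
  by rewrite JE mulmxDr uJ -scalemxAr m2 scalerDr scalerA.
exists x, (z + F - pX m *: (E *m x)).
rewrite cE cb JE mulmxDl -scalemxAl.
move: (jac b *m x) (E *m x) (pX m) (pX (2 * m)) => A B P Q.
by apply/colP => k; rewrite !mxE; ring.
Qed.

(** With [u] fixed, a bad psi(0) has the form p^m z with u z divisible by p^m. The residues modulo
    p^m in all D coordinates, together with p^m shifts along p^m e_i where u_i is a unit, give p^(m
    D + m) disjoint translates of this set. *)
Lemma avg_bad m M : (2 * m <= M)%N -> avg M (ind R (bad m)) <= p%:R ^- (m * D + m).
Proof.
move=> mM; rewrite avg_ext; last first.
  by apply: (res_periodic_le mM); apply: ind_res_periodic => a b; apply: bad_cong.
rewrite -[leRHS](avg_cst p_pr (cidx d N) M); apply: avg_le => a.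
have [[u [i [w [ui uJ]]]]|nu0] := pselect (exists (u : 'rV[O]_D) i w,
    u 0 i \is a GRing.unit /\ u *m jac a = pX m *: w); last first.
  rewrite [leLHS](_ : _ = avg M (fun _ : 'I_D -> O => 0)); last first.
    by apply: eq_avg => y; rewrite /ind asboolF// => -[]; rewrite jac_add_ext.
  by rewrite avg_cst invr_ge0 exprn_ge0.
pose L (y : 'I_D -> O) := exists z, \col_i y i = pX m *: z /\ pdvd m ((u *m z) 0 0).
have m2 : pX (2 * m) = pX m * pX m by rewrite mul2n -addnn exprD.
have LM : res_periodic M (ind R L).
  apply: (res_periodic_le mM); apply: ind_res_periodic => y y' yy' [z [yz uz]].
  have /pdvd_mx[z' z'E] : forall i j, pdvd (2 * m) ((\col_i y i - \col_i y' i) i j).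
    by move=> k j; rewrite !mxE.
  exists (z - pX m *: z'); split.
    rewrite scalerBr -yz scalerA -m2 -z'E opprB addrC subrK//.
  by rewrite mulmxBr -scalemxAr mxE pdvdD// mxE pdvdN mxE pdvd_pX.
apply: (@le_trans _ _ (avg M (ind R L))).
  rewrite -[leRHS](@avg_translate R p p_pr _ M _ (fun i => - psiO a 0 i 0) LM).
  apply: avg_le => y; apply: ind_le => -[_ [x [z]]].
  rewrite psi_add_ext jac_add_ext m2 -scalerA -scalerDr => yE.
  exists (jac a *m x + pX m *: z); split; last first.
    rewrite mulmxDr mulmxA uJ -scalemxAl -scalemxAr mxE.
    by rewrite pdvdD// mxE pdvd_pX.
  rewrite -yE; apply/colP => k.
  by rewrite [LHS]mxE [RHS]mxE [X in _ = _ + X]mxE opprK addrC.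
pose X : finType := ({ffun 'I_D -> 'I_(p ^ m)} * 'I_(p ^ m))%type.
pose v (t : X) : 'I_D -> O := fun j => (t.1 j)%:R + pX m * ((t.2)%:R * (j == i)%:R).
have := @avg_packing R p p_pr 'I_D M X v L LM.
have -> : #|{: X}|%:R = p%:R ^+ (m * D + m) :> R.
  by rewrite card_prod card_ffun !card_ord -expnM -expnD natrX.
move=> h; rewrite -[leRHS]mul1r ler_pdivlMr ?exprn_gt0 ?ltr0n ?prime_gt0// mulrC.
apply: h => y [t1 t2] [t1' t2'] [z [zE uz]] [z' [z'E uz']].
have t1E : t1 = t1'.
  apply/ffunP => j; apply/val_inj/eqP.
  have : pdvd m ((t1 j)%:R - (t1' j)%:R : O).
    move/colP/(_ j): zE; move/colP/(_ j): z'E; rewrite !mxE /v /= => z'E zE.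
    have -> : (t1 j)%:R - (t1' j)%:R =
      pX m * (z' j 0 - z j 0 + (t2'%:R * (j == i)%:R - t2%:R * (j == i)%:R)) :> O.
      rewrite mulrDr mulrBr -zE -z'E.
      by move: (y j) (t1 j)%:R (t1' j)%:R (pX m) (t2%:R * _) (t2'%:R * _) => *; ring.
    exact: pdvd_pX.
  by rewrite -padic_res_eq !padic_int_natr !modn_small.
subst t1'; congr (_, _); apply/val_inj/eqP.
(* As the first components agree, z' - z is a multiple of e_i; since u_i is a unit, divisibility of
   u (z' - z) by p^m passes to t2 - t2'. *)
have zz' : z' = z + (t2%:R - t2'%:R) *: delta_mx i 0.
  apply: (@pX_scaleI _ p_pr m); apply/colP => j.
  move/colP/(_ j): zE; move/colP/(_ j): z'E; rewrite !mxE /v /= eqxx andbT.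
  rewrite mulrDr => <- <-.
  by move: (y j) (t1 j)%:R (pX m) (j == i)%:R t2%:R t2'%:R => *; ring.
move: uz'; rewrite zz' mulmxDr mxE => /(fun h => pdvdB h uz).
rewrite addrAC subrr add0r -scalemxAr mxE -colE mxE => h'.
have : pdvd m ((t2%:R - t2'%:R) * u 0 i * (u 0 i)^-1) by exact: pdvdMl.
by rewrite mulrK// -padic_res_eq !padic_int_natr !modn_small.
Qed.

Variables (T : finType) (g : T -> 'M[O]_N).
Hypothesis gU : forall t, g t \in unitmx.

(** Centres lie in p Z_p^D, so residues [q] modulo p^m index balls of radius p^-(m + 1); hence
    [m.+1] accompanies [balls m] throughout. *)
Definition center m (q : {ffun 'I_D -> 'I_(p ^ m)}) : 'cV[O]_D :=
  p%:R *: \col_i lift_res p_pr q i.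

Definition zeros (a : V) : set (T * 'cV[O]_D) :=
  [set tx : T * 'cV[O]_D | (forall i, pdvd 1 (tx.2 i 0)) /\ psiO (act (g tx.1) a) tx.2 = 0].

Definition zero_jac (a : V) (tx : T * 'cV[O]_D) : O :=
  \det (jac (trans tx.2 (act (g tx.1) a))).

Definition regular_zeros m (a : V) : set (T * 'cV[O]_D) :=
  [set tx : T * 'cV[O]_D | zeros a tx /\ ~~ pdvd m (zero_jac a tx)].

Local Notation balls m := (T * {ffun 'I_D -> 'I_(p ^ m)})%type.

Definition at_ball m (tq : balls m) (a : V) : V :=
  trans (center tq.2) (act (g tq.1) a).

Lemma at_ball_act m (tq : balls m) :
  exists2 h, h \in unitmx & forall a, at_ball tq a = act h a.
Proof.
exists (g tq.1 *m uni e (Amx DE (center tq.2))) => [|a]; last first.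
  by rewrite act_mul.
rewrite unitmx_mul gU; apply: (proj1 (mulmx1_unit (B := uni e (Amx DE (- center tq.2))) _)).
by rewrite -uniD -AmxD subrr Amx0 uni0.
Qed.

(** Invariance of the uniform law under GL_N(Z_p), seen modulo p^M: every ball of every chart
    behaves like the one at the origin of the standard chart. *)
Lemma avg_at_ball m (tq : balls m) M phi : res_periodic M phi ->
  avg M (fun a => phi (at_ball tq a)) = avg M phi :> R.
Proof.
move=> phiM; have [h hU hE] := at_ball_act tq.
transitivity (avg M (fun a => phi (act h a))).
  by apply: eq_avg => a; rewrite hE.
apply: (avg_bij (s := act h) (t := act (invmx h))) => // [a b|a b|a|a].
- exact: act_cong.
- exact: act_cong.
- by rewrite -act_mul mulmxV// act1; apply: vcong_refl.
- by rewrite -act_mul mulVmx// act1; apply: vcong_refl.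
Qed.

Definition good_balls m (a : V) : set (balls m) :=
  [set tq | good m.+1 (at_ball tq a)].
Arguments good_balls : clear implicits.

Lemma center_cong m (x : 'cV[O]_D) :
  exists y, p%:R *: x = center (red_res m (fun i => x i 0)) + pX m.+1 *: y.
Proof.
have /pdvd_mx[y yE] : forall i j,
    pdvd m ((x - \col_i lift_res p_pr (red_res m (fun i => x i 0)) i) i j).
  move=> i j; rewrite (ord1 j) !mxE.
  by rewrite pdvdBC; apply: (@lift_red_res _ p_pr _ m (fun i => x i 0) i).
by exists y; rewrite exprS -scalerA -yE scalerBr /center addrC subrK.
Qed.

Lemma center_small m (q : {ffun 'I_D -> 'I_(p ^ m)}) y i :
  pdvd 1 ((center q + pX m.+1 *: y) i 0).
Proof.
have p1 (c : O) : pdvd 1 (p%:R * c) by rewrite -{1}[p%:R]expr1 pdvd_pX.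
by rewrite mxE pdvdD// mxE ?exprS -?mulrA p1.
Qed.

Lemma at_ball_trans m (tq : balls m) a y :
  trans (center tq.2 + pX m.+1 *: y) (act (g tq.1) a) =
  trans (pX m.+1 *: y) (at_ball tq a).
Proof. exact: transD. Qed.

Lemma psi_at_ball m (tq : balls m) a y :
  psiO (act (g tq.1) a) (center tq.2 + pX m.+1 *: y) =
  psiO (at_ball tq a) (pX m.+1 *: y).
Proof. exact: (esym (psi_trans e DE tau (act (g tq.1) a) (center tq.2) _)). Qed.

Lemma pdvd_zero_jac m (tq : balls m) a y :
  pdvd m.+1 (zero_jac a (tq.1, center tq.2 + pX m.+1 *: y)) =
  pdvd m.+1 (\det (jac (at_ball tq a))).
Proof.
rewrite /zero_jac /= at_ball_trans.
have [E JE] := jac_trans e DE tau m.+1 y (at_ball tq a).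
exact: pdvd_det_cong JE.
Qed.

(** Hensel's lemma puts one regular zero into each good ball, and [hensel_conv] makes the ball of
    each regular zero good. Regularity may be tested at the zero or at the centre, the two
    determinants being congruent up to a multiple of p^(m + 1). *)
Lemma card_regular_zeros m a : (regular_zeros m.+1 a #= good_balls m a)%card.
Proof.
have /choice[F FE] (tq : balls m) : exists tx, good m.+1 (at_ball tq a) ->
    regular_zeros m.+1 a tx /\ exists y, tx = (tq.1, center tq.2 + pX m.+1 *: y).
  have [[Jm [x cx]]|ng] := pselect (good m.+1 (at_ball tq a)); last first.
    (* Junk value on balls that are not good. *)
    by exists (tq.1, 0) => /ng.
  have [y y0 _] := hensel Jm cx.
  exists (tq.1, center tq.2 + pX m.+1 *: y) => _; split; last by exists y.
  split; last by rewrite pdvd_zero_jac.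
  split; last exact: (etrans (psi_at_ball tq a y) y0).
  exact: (center_small tq.2 y).
suff -> : regular_zeros m.+1 a = F @` good_balls m a.
  apply: inj_card_eq => tq tq' /set_mem/FE[_ [y ->]] /set_mem/FE[_ [y' ->]] [t12 c12].
  case: tq tq' t12 c12 => t q [t' q'] /= -> c12; congr (_, _).
  rewrite -(lift_resK p_pr q) -(lift_resK p_pr q'); apply/red_resP => i.
  have p0 : (p%:R : O) != 0 by have := ppX_neq0 p_pr 1; rewrite expr1.
  suff -> : lift_res p_pr q i - lift_res p_pr q' i = pX m * (y' i 0 - y i 0).
    exact: pdvd_pX.
  apply: (mulfI p0); move/colP/(_ i): c12; rewrite !mxE exprS => c12.
  rewrite mulrBr -[p%:R * lift_res p_pr q' i](addrK (p%:R * pX m * y' i 0)) -c12.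
  by move: (lift_res _ _ _) (pX m) (y i 0) (y' i 0) => *; ring.
apply/seteqP; split=> [|_ [tq /FE[? _] <-]//].
  move=> [t x] [[/= x1 x0] xJ].
  have /pdvd_mx[x' x'E] : forall i j, pdvd 1 (x i j) by move=> i j; rewrite (ord1 j).
  have [y yE] := center_cong m x'.
  pose tq : balls m := (t, red_res m (fun i => x' i 0)).
  have xE : x = center tq.2 + pX m.+1 *: y by rewrite x'E expr1 yE.
  have Jm : ~~ pdvd m.+1 (\det (jac (at_ball tq a))).
    by rewrite -(pdvd_zero_jac _ _ y) -xE.
  have y0 : psiO (at_ball tq a) (pX m.+1 *: y) = 0 by rewrite -psi_at_ball -xE.
  have [x2 cx2] := hensel_conv Jm y0.
  have tqg : good m.+1 (at_ball tq a) by split=> //; exists x2.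
  exists tq => //; have [[[_ F0] _] [y' y'E]] := FE _ tqg.
  have [y1 _ uniq] := hensel Jm cx2.
  rewrite y'E xE; congr (_, _ + _ *: _).
  rewrite (uniq _ y0); apply: uniq.
  by rewrite -psi_at_ball; move: F0; rewrite y'E.
Qed.

Lemma zero_bad m a tx : zeros a tx -> zero_jac a tx = 0 ->
  exists q, bad m.+1 (at_ball ((tx.1, q) : balls m) a).
Proof.
case: tx => t x [/= x1 x0] J0.
have /pdvd_mx[x' x'E] : forall i j, pdvd 1 (x i j) by move=> i j; rewrite (ord1 j).
have [y yE] := center_cong m x'.
pose tq : balls m := (t, red_res m (fun i => x' i 0)).
have xE : x = center tq.2 + pX m.+1 *: y by rewrite x'E expr1 yE.
exists tq.2; rewrite -/tq.
have m2 : pX (2 * m.+1) = pX m.+1 * pX m.+1 by rewrite mul2n -addnn exprD.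
split; last first.
  have [Q [QE _]] := psi_rest e DE tau m.+1 (at_ball tq a).
  have : psiO (at_ball tq a) (pX m.+1 *: y) = 0 by rewrite -psi_at_ball -xE.
  rewrite QE -addrA => /eqP; rewrite addr_eq0 => /eqP ->.
  exists (- y), (- Q y).
  by rewrite mulmxN !scalerN opprD m2 expr2.
move: J0; rewrite /zero_jac /= xE at_ball_trans => /eqP/det0P[v v0 vJ].
have [E JE] := jac_trans e DE tau m.+1 y (at_ball tq a).
have /rV0Pn[i0 vi0] := v0.
(* The least such k is the minimal valuation of the entries of the kernel vector [v], so v / p^k is
   primitive. *)
pose P k := [exists i, ~~ pdvd k.+1 (v 0 i)].
have exP : exists k, P k.
  have [k [t' [t'U vE]]] := pdvd_split vi0; exists k; apply/existsP; exists i0.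
  by rewrite vE pdvd_unit// ltnn.
have [k /existsP[i vi] kmin] := ex_minnP exP.
have /pdvd_mx[u uE] : forall j j', pdvd k (v j j').
  move=> j j'; rewrite (ord1 j); case: k {vi} kmin => [_|k kmin]; first exact: pdvd0n.
  apply/negPn/negP => vk; have := kmin k; rewrite ltnn => h.
  by have // : false by apply: h; apply/existsP; exists j'.
exists u, i, (- (u *m E)); split.
  by move: vi; rewrite uE mxE padic_unitE -addn1 pdvd_pXM.
apply: (@pX_scaleI _ p_pr k); rewrite scalemxAl -uE.
apply/eqP; rewrite -subr_eq0 !scalerN opprK scalerA mulrC -scalerA.
rewrite [pX k *: (u *m E)]scalemxAl -uE [X in _ + X]scalemxAr.
by rewrite -mulmxDr -JE vJ.
Qed.

Definition bad_ball m (a : V) := exists tq : balls m, bad m.+1 (at_ball tq a).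

Definition ngood m (a : V) : R := \sum_(tq : balls m) ind R (good m.+1) (at_ball tq a).

Lemma card_balls m : #|{: balls m}|%:R = #|T|%:R * p%:R ^+ (m * D) :> R.
Proof. by rewrite card_prod card_ffun !card_ord natrM -expnM natrX. Qed.

Lemma sum_balls m (c : R) : \sum_(tq : balls m) c = #|T|%:R * p%:R ^+ (m * D) * c.
Proof. by rewrite -card_balls mulr_natl sumr_const. Qed.

(** The p^(m D) balls of a chart against the factor p^-((m + 1) D) of [avg_good] leave p^-D, which
    does not depend on m. *)
Lemma avg_ngood m M : (2 * m.+1 <= M)%N -> avg M (ngood m) =
  #|T|%:R * p%:R ^- D * avg M (fun b => trunc_abs m.+1 (\det (jac b))).
Proof.
move=> mM; rewrite /ngood avg_sum.
rewrite (eq_bigr (fun=> avg M (ind R (good m.+1)))) => [|tq _]; last first.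
  apply: avg_at_ball; apply: (res_periodic_le mM); apply: ind_res_periodic => a b.
  exact: good_cong.
rewrite sum_balls avg_good// mulrA; congr (_ * _).
rewrite -mulrA; congr (_ * _); rewrite mulSn exprD invfM mulrCA mulfV ?mulr1//.
by rewrite expf_neq0// p_neq0.
Qed.

Lemma bad_ball_cong m a b : vcong (2 * m.+1) a b -> bad_ball m a -> bad_ball m b.
Proof.
move=> ab [tq bq]; exists tq; apply: bad_cong bq.
have [h hU hE] := at_ball_act tq; rewrite !hE; exact: act_cong.
Qed.

Lemma avg_bad_ball m M : (2 * m.+1 <= M)%N ->
  avg M (ind R (bad_ball m)) <= #|T|%:R * p%:R ^- m.+1.
Proof.
move=> mM.
apply: (@le_trans _ _ (avg M (fun a => \sum_(tq : balls m) ind R (bad m.+1) (at_ball tq a)))).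
  apply: avg_le => a; rewrite {1}/ind; case: asboolP => [[tq bq]|_]; last first.
    by apply: sumr_ge0 => *; apply: ind_ge0.
  rewrite (bigD1 tq)//= {1}/ind asboolT//= lerDl.
  by apply: sumr_ge0 => *; apply: ind_ge0.
rewrite avg_sum (eq_bigr (fun=> avg M (ind R (bad m.+1)))) => [|tq _]; last first.
  apply: avg_at_ball; apply: (res_periodic_le mM); apply: ind_res_periodic => a b.
  exact: bad_cong.
rewrite sum_balls -mulrA ler_wpM2l//.
apply: (@le_trans _ _ (p%:R ^+ (m * D) * p%:R ^- (m.+1 * D + m.+1))).
  by rewrite ler_wpM2l ?exprn_ge0// avg_bad.
rewrite mulSn -addnA addnCA exprD invfM mulrA mulfV ?mul1r; last first.
  by rewrite expf_neq0// p_neq0.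
rewrite lef_pV2 ?posrE ?exprn_gt0 ?ltr0n ?prime_gt0//.
by rewrite ler_weXn2l ?ler1n ?prime_gt0// leq_addl.
Qed.

Lemma ngood_cong m : res_periodic (2 * m.+1) (ngood m).
Proof.
move=> a b ab; apply: eq_bigr => tq _; have [h hU hE] := at_ball_act tq.
rewrite !hE; apply: (@ind_res_periodic R p p_pr _ (2 * m.+1)) => [? ?|]; first exact: good_cong.
exact: act_cong.
Qed.

(** When |y| > p^-m, adding a multiple of p^m changes the unit part of y only by a multiple of p. *)
Lemma trunc_abs_cong m x y : pdvd m (x - y) -> trunc_abs m x = trunc_abs m y.
Proof.
move=> xy; have xyE : pdvd m x = pdvd m y.
  apply/idP/idP => h; last by rewrite -(subrK y x) pdvdD.
  by rewrite -(subrK x y) pdvdD// pdvdBC.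
case: (boolP (pdvd m y)) => ym; first by rewrite /trunc_abs xyE ym.
have y0 : y != 0 by apply: contraNneq ym => ->; apply: pdvd0.
have [q [t [tU yE]]] := pdvd_split y0.
have qm : (q < m)%N by rewrite yE pdvd_unit// -ltnNge in ym.
have /pdvdP[w wE] := xy.
have mq : pX m = pX q * pX (m - q) by rewrite -exprD subnKC// ltnW.
have -> : x = pX q * (t + pX (m - q) * w).
  by rewrite mulrDr mulrA -mq -yE -wE addrC subrK.
rewrite yE !trunc_absE// padic_unitE; move: tU; rewrite padic_unitE.
apply: contra => h; rewrite -(addrK (pX (m - q) * w) t) pdvdB//.
by apply: (@pdvd_le _ _ (m - q)); rewrite ?subn_gt0// pdvd_pX.
Qed.

Lemma trunc_jac_cong m : res_periodic m (fun b => trunc_abs m (\det (jac b))).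
Proof.
move=> a b ab; have [E JE] := jac_cong e DE tau ab.
apply: trunc_abs_cong; apply: padic_det_cong => i j.
by rewrite JE mxE addrAC subrr add0r mxE pdvd_pX.
Qed.

End Counting.

(** * Forms vanishing on a subspace *)

Section Vanishing.
Variables (p : nat) (p_pr : prime p).
Local Notation O := (padic_int p_pr).
Local Notation K := (padic p_pr).

Definition toF (x : O) : K := FracField.tofrac x.

HB.instance Definition _ := GRing.RMorphism.copy toF (@FracField.tofrac O).

Lemma toF_inj : injective toF.
Proof. by move=> x y /eqP; rewrite tofrac_eq => /eqP. Qed.

Lemma toF_mx_inj a b : injective (@map_mx O K toF a b).
Proof.
move=> A B /matrixP AB; apply/matrixP => i j; move: (AB i j); rewrite !mxE.
exact: toF_inj.
Qed.

Lemma meval_lsub (S : comNzRingType) a b (B : 'M[S]_(a, b)) f (y : 'cV[S]_b) :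
  (lsub B f).@[fun l => y l 0] = f.@[fun i => (B *m y) i 0].
Proof.
elim/mpoly_alg_ind: f => [c|i|f g IHf IHg|f g IHf IHg].
- by rewrite lsubC !mevalC.
- rewrite lsubX mevalXU raddf_sum mxE /=; apply: eq_bigr => l _.
  by rewrite mevalZ mevalXU.
- by rewrite rmorphD /= !mevalD IHf IHg.
- by rewrite rmorphM /= !mevalM IHf IHg.
Qed.

Lemma meval_map (S S' : comNzRingType) (phi : {rmorphism S -> S'}) a
  (f : {mpoly S[a]}) (y : 'I_a -> S) :
  (map_mpoly phi f).@[fun i => phi (y i)] = phi f.@[y].
Proof.
elim/mpoly_alg_ind: f => [c|i|f g IHf IHg|f g IHf IHg].
- by rewrite map_mpolyC !mevalC.
- by rewrite map_mpolyX !mevalXU.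
- by rewrite rmorphD /= !mevalD IHf IHg rmorphD.
- by rewrite rmorphM /= !mevalM IHf IHg rmorphM.
Qed.

Lemma padic_natS_neq0 n : (n.+1%:R : O) != 0.
Proof.
apply/padic_int_neq0; exists n; rewrite padic_int_natr modn_small//.
by rewrite ltn_expl// prime_gt1.
Qed.

(* The Taylor formula at h = p^m shows that the derivatives of a vanishing
   polynomial function vanish as well. *)
Lemma vanish_mderiv a (f : {mpoly O[a]}) i :
  (forall x : 'cV[O]_a, f.@[fun i => x i 0] = 0) ->
  forall x : 'cV[O]_a, (f^`M(i)).@[fun i => x i 0] = 0.
Proof.
move=> f0 x; apply: pdvd_all => m.
have [z z1 ev] : exists2 z : 'I_1 -> O, z 0 = 1 &
    forall (B : 'cV[O]_a) g, (lsub B g).@[z] = g.@[fun i => B i 0].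
  exists (fun l => (1%:M : 'cV[O]_1) l 0) => [|B g]; first by rewrite mxE.
  by rewrite meval_lsub mulmx1.
have [g gE] := lsub_taylor x (delta_mx i 0) (p%:R ^+ m) f.
have cancel_h (u v w t h : O) : h != 0 -> u = v + h * w + h ^+ 2 * t ->
    u = 0 -> v = 0 -> w = - (h * t).
  move=> h0 + u0 v0; rewrite u0 v0 add0r expr2 -mulrA -mulrDr => /esym/eqP.
  by rewrite mulf_eq0 (negbTE h0) /= addr_eq0 => /eqP.
have dE : (\sum_k lform (delta_mx i 0 : 'cV[O]_a) k * lsub x f^`M(k)).@[z] =
    (f^`M(i)).@[fun i => x i 0].
  rewrite -ev raddf_sum (bigD1 i)//= big1 => [|j ji].
    by rewrite mevalM /lform big_ord1 mxE !eqxx scale1r mevalXU z1 mul1r addr0.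
  by rewrite mevalM /lform big_ord1 mxE (negbTE ji) scale0r meval0 mul0r.
rewrite -dE; move/(congr1 (meval z)): gE; rewrite !mevalD !mevalZ => gE.
rewrite (cancel_h _ _ _ _ _ (ppX_neq0 p_pr m) gE); first by rewrite pdvdN pdvd_pX.
- exact: (etrans (ev _ f) (f0 _)).
- exact: (etrans (ev _ f) (f0 _)).
Qed.

(** [zero_on] is a pointwise condition, whereas psi records coefficients. The constant coefficient
    is f(0); the coefficient of m, times m_i, is that of m - U_i in the i-th derivative, and Z_p has
    characteristic 0. *)
Lemma vanish_eq0 a (f : {mpoly O[a]}) :
  (forall x : 'cV[O]_a, f.@[fun i => x i 0] = 0) -> f = 0.
Proof.
move=> f0; apply/mpolyP => m; rewrite mcoeff0.
move: {2}(mdeg m) (erefl (mdeg m)) => n; elim: n m f f0 => [|n IH] m f f0 mn.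
  have -> : m = 0%MM by apply/eqP; rewrite -mdeg_eq0 mn.
  have := f0 0; rewrite mevalE => <-.
  case: (boolP (0%MM \in msupp f)) => f0m; last first.
    rewrite (memN_msupp_eq0 f0m) big_seq big1// => m' m'f.
    have [i mi] : exists i, m' i != 0%N.
      apply/existsP; apply: contraNT f0m => /existsPn h.
      rewrite (_ : 0%MM = m')//; apply/mnmP => i; rewrite mnm0E.
      by move: (h i); rewrite negbK => /eqP.
    rewrite (bigD1 i)//= mxE expr0n (negbTE mi) mul0r mulr0//.
  rewrite (bigD1_seq 0%MM) ?msupp_uniq//=.
  rewrite big1 => [|i _]; last by rewrite mnm0E expr0.
  rewrite mulr1 big1 ?addr0// => m' m'0.
  have [i mi] : exists i, m' i != 0%N.
    apply/existsP; apply: contraNT m'0 => /existsPn h.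
    apply/eqP/mnmP => i; rewrite mnm0E.
    by move: (h i); rewrite negbK => /eqP.
  by rewrite (bigD1 i)//= mxE expr0n (negbTE mi) mul0r mulr0.
have [i mi] : exists i, (0 < m i)%N.
  apply/existsP; have : mdeg m != 0%N by rewrite mn.
  rewrite mdeg_eq0; apply: contraNT => /existsPn h.
  by apply/eqP/mnmP => i; rewrite mnm0E; move: (h i); rewrite -leqNgt leqn0 => /eqP.
have mE : m = (m - U_(i) + U_(i))%MM.
  by rewrite submK// lep1mP -lt0n.
have := IH (m - U_(i))%MM _ (vanish_mderiv i f0).
rewrite mcoeff_mderiv -mE => h.
have {h}/eqP : f@_m *+ ((m - U_(i))%MM i).+1 = 0.
  by apply: h; move: mn; rewrite {1}mE mdegD mdeg1 addn1 => -[].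
by rewrite -mulr_natr mulf_eq0 (negbTE (padic_natS_neq0 _)) orbF => /eqP.
Qed.

End Vanishing.

(** * Column spans and their dimension *)

Section ColumnSpan.
Variables (p : nat) (p_pr : prime p).
Local Notation O := (padic_int p_pr).
Local Notation K := (padic p_pr).
Local Notation toF := (@toF p p_pr).

Lemma nth_cols a b (M : 'M[K]_(a, b)) (j : 'I_b) :
  [seq col j M | j <- enum 'I_b]`_j = col j M.
Proof. by rewrite (nth_map j) ?size_enum_ord// nth_ord_enum. Qed.

Lemma mem_column_span a b (M : 'M[K]_(a, b)) v :
  reflect (exists y, v = M *m y) (v \in column_span M).
Proof.
have E (y : 'cV[K]_b) : M *m y = \sum_j y j 0 *: col j M.
  apply/colP => i; rewrite summxE mxE; apply: eq_bigr => j _.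
  by rewrite !mxE mulrC.
apply: (iffP idP) => [vM|[y ->]]; last first.
  rewrite E; apply: memv_suml => j _; apply/memvZ/memv_span.
  by apply/mapP; exists j; rewrite ?mem_enum.
have Xs : size [seq col j M | j <- enum 'I_b] == b by rewrite size_map size_enum_ord.
pose X : b.-tuple _ := Tuple Xs.
exists (\col_j coord X j v); rewrite E {1}(coord_span (X := X) vM).
by apply: eq_bigr => j _; rewrite mxE -nth_cols.
Qed.

Lemma column_span_mulr a b (M : 'M[K]_(a, b)) U : U \in unitmx ->
  column_span (M *m U) = column_span M.
Proof.
move=> UU; apply/vspaceP => v; apply/mem_column_span/mem_column_span => -[y ->].
  by exists (U *m y); rewrite mulmxA.
by exists (invmx U *m y); rewrite mulmxA mulmxK.
Qed.

Lemma dim_column_span a b (M : 'M[K]_(a, b)) W : W *m M = 1%:M ->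
  \dim (column_span M) = b.
Proof.
move=> WM; rewrite /column_span.
have Xs : size [seq col j M | j <- enum 'I_b] == b by rewrite size_map size_enum_ord.
pose X : b.-tuple _ := Tuple Xs.
suff : free X by rewrite /free => /eqP ->; rewrite size_tuple.
apply/freeP => c c0 j.
have M0 : M *m \col_j c j = 0.
  rewrite -c0; apply/colP => i; rewrite summxE mxE; apply: eq_bigr => l _.
  by rewrite nth_cols !mxE mulrC.
have /colP/(_ j) : W *m (M *m \col_j c j) = 0 by rewrite M0 mulmx0.
by rewrite mulmxA WM mul1mx !mxE.
Qed.

Lemma column_span_basis a b (L : {vspace 'cV[K]_a}) : \dim L = b ->
  exists2 M : 'M[K]_(a, b), L = column_span M & forall y : 'cV[K]_b, M *m y = 0 -> y = 0.
Proof.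
move=> <-; pose X := vbasis L; exists (\matrix_(i, j) (tnth X j) i 0).
  rewrite /column_span -{1}(span_basis (vbasisP L)); congr span.
  rewrite -[in LHS](@map_tnth_enum _ _ X); apply: eq_map => j.
  by apply/colP => i; rewrite !mxE.
move=> y My; have /freeP h := basis_free (vbasisP L).
apply/colP => j; rewrite [RHS]mxE; apply: (h (fun j => y j 0)).
apply: etrans My; apply/colP => i; rewrite summxE mxE; apply: eq_bigr => l _.
by rewrite !mxE mulrC (tnth_nth 0).
Qed.

End ColumnSpan.

(** * Charts modulo p *)

Section Blocks.
Variables (S : comNzRingType) (r s N : nat) (e : (r + s = N)%N).

Definition prj2 : 'M[S]_(s, N) := castmx (erefl, e) (row_mx 0 1%:M).

(** The blocks of A in its first r columns; [lower_block e A = 0] says that A maps the standard flat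
    into itself. *)
Definition upper_block (A : 'M[S]_N) : 'M[S]_r := prj S e *m A *m stk e 0.
Definition lower_block (A : 'M[S]_N) : 'M[S]_(s, r) := prj2 *m A *m stk e 0.

Lemma prj2_stk B : prj2 *m stk e B = B.
Proof.
rewrite /prj2 /stk; case: _ / e; rewrite !castmx_id mul_row_col.
by rewrite mul0mx mul1mx add0r.
Qed.

Lemma stk_split (C : 'M[S]_(N, r)) :
  C = stk e 0 *m (prj S e *m C) + dirm e (prj2 *m C).
Proof.
rewrite /prj2 /prj /stk /dirm; case: _ / e C => C; rewrite !castmx_id.
rewrite -[C]vsubmxK !mul_row_col mul_col_mx add_col_mx.
by rewrite !mul1mx !mul0mx !add0r !addr0.
Qed.

Lemma stkE (A : 'M[S]_(s, r)) : stk e A = stk e 0 + dirm e A.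
Proof. by have := stkZ e 1 A; rewrite !scale1r. Qed.

Lemma dirm_mul (A : 'M[S]_(s, r)) (U : 'M[S]_r) : dirm e (A *m U) = dirm e A *m U.
Proof.
by rewrite /dirm; case: _ / e; rewrite !castmx_id mul_col_mx mul0mx.
Qed.

Lemma dirm0 : dirm e 0 = 0 :> 'M[S]_(N, r).
Proof. by rewrite /dirm; case: _ / e; rewrite castmx_id col_mx0. Qed.

Lemma mul_stk0 A : A *m stk e 0 = stk e 0 *m upper_block A + dirm e (lower_block A).
Proof. by rewrite {1}[A *m stk e 0]stk_split !mulmxA. Qed.

Lemma lower_block_mul A B : lower_block A = 0 -> lower_block B = 0 ->
  lower_block (A *m B) = 0.
Proof.
move=> lA lB; rewrite /lower_block -!mulmxA mul_stk0 lB dirm0 addr0.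
by rewrite [A *m _]mulmxA mulmxA -[X in X *m _]/(_ *m _) [prj2 *m _]mulmxA
   -/(lower_block A) lA mul0mx.
Qed.

End Blocks.

Section BlockUnits.
Variables (S : comUnitRingType) (r s N : nat) (e : (r + s = N)%N).
Implicit Types A : 'M[S]_N.

Lemma upper_block_unit A : A \in unitmx -> lower_block e A = 0 ->
  upper_block e A \in unitmx.
Proof.
move=> AU lA; have h : stk e 0 = invmx A *m stk e 0 *m upper_block e A.
  have hA := mul_stk0 e A; rewrite lA dirm0 addr0 in hA.
  by rewrite -mulmxA -hA mulKmx.
have : upper_block e (invmx A) *m upper_block e A = 1%:M.
  by rewrite {1}/upper_block -2!mulmxA [invmx A *m _]mulmxA -h prj_stk.
by case/mulmx1_unit.
Qed.

Lemma lower_block_inv A : A \in unitmx -> lower_block e A = 0 ->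
  lower_block e (invmx A) = 0.
Proof.
move=> AU lA; have UU := upper_block_unit AU lA.
have h : stk e 0 = invmx A *m stk e 0 *m upper_block e A.
  have hA := mul_stk0 e A; rewrite lA dirm0 addr0 in hA.
  by rewrite -mulmxA -hA mulKmx.
have h0 : lower_block e (invmx A) *m upper_block e A = 0.
  by rewrite {1}/lower_block -2!mulmxA [invmx A *m _]mulmxA -h prj2_stk.
by rewrite -(mulmxK UU (lower_block e _)) h0 mul0mx.
Qed.

End BlockUnits.

Section MapBlocks.
Variables (S S' : comNzRingType) (phi : {rmorphism S -> S'}).
Variables (r s N : nat) (e : (r + s = N)%N).

Lemma map_stk (A : 'M[S]_(s, r)) : map_mx phi (stk e A) = stk e (map_mx phi A).
Proof.
rewrite /stk; case: _ / e; rewrite !castmx_id.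
by rewrite map_col_mx map_mx1.
Qed.

Lemma map_lower_block (A : 'M[S]_N) :
  map_mx phi (lower_block e A) = lower_block e (map_mx phi A).
Proof.
rewrite /lower_block !map_mxM map_stk map_mx0; congr (_ *m _ *m _).
rewrite /prj2; case: _ / e; rewrite !castmx_id.
by rewrite map_row_mx map_mx0 map_mx1.
Qed.

Lemma map_upper_block (A : 'M[S]_N) :
  map_mx phi (upper_block e A) = upper_block e (map_mx phi A).
Proof.
rewrite /upper_block !map_mxM map_stk map_mx0; congr (_ *m _ *m _).
rewrite /prj; case: _ / e; rewrite !castmx_id.
by rewrite map_row_mx map_mx0 map_mx1.
Qed.

End MapBlocks.

(** * Cosets of the stabilizer of the standard flat over a finite field *)

Section Transversal.
Variables (F : finFieldType) (r s N : nat) (e : (r + s = N)%N).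

(** For invertible g and h: both carry the standard flat to the same flat. *)
Definition same_coset (g h : 'M[F]_N) := lower_block e (invmx g *m h) == 0.

Lemma same_coset_refl g : g \in unitmx -> same_coset g g.
Proof.
move=> gU; rewrite /same_coset mulVmx// /lower_block mulmx1.
by rewrite prj2_stk.
Qed.

Lemma same_coset_sym g h : g \in unitmx -> h \in unitmx ->
  same_coset g h -> same_coset h g.
Proof.
move=> gU hU /eqP gh; apply/eqP.
have XU : invmx g *m h \in unitmx by rewrite unitmx_mul unitmx_inv gU.
have -> : invmx h *m g = invmx (invmx g *m h).
  by rewrite -[LHS](mulmxK XU) mulmxA (mulmxK gU) mulVmx// mul1mx.
exact: lower_block_inv.
Qed.

Lemma same_coset_trans g h k : g \in unitmx -> h \in unitmx ->
  same_coset g h -> same_coset h k -> same_coset g k.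
Proof.
move=> gU hU /eqP gh /eqP hk; apply/eqP.
have -> : invmx g *m k = (invmx g *m h) *m (invmx h *m k).
  by rewrite -mulmxA mulKVmx.
exact: lower_block_mul.
Qed.

(** [pick] depends only on the extension of its predicate, so equivalent matrices receive the same
    representative; for invertible g the default is never taken. *)
Definition coset_repr (g : 'M[F]_N) : 'M[F]_N :=
  odflt g [pick h | (h \in unitmx) && same_coset g h].

Lemma coset_reprP g : g \in unitmx ->
  coset_repr g \in unitmx /\ same_coset g (coset_repr g).
Proof.
move=> gU; rewrite /coset_repr; case: pickP => [h /andP[]//|/(_ g)].
by rewrite gU same_coset_refl.
Qed.

Lemma eq_coset_repr g h : g \in unitmx -> h \in unitmx -> same_coset g h ->
  coset_repr g = coset_repr h.
Proof.
move=> gU hU gh; rewrite /coset_repr.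
have E : [pred k | (k \in unitmx) && same_coset g k] =1
         [pred k | (k \in unitmx) && same_coset h k].
  move=> k /=; case: (boolP (k \in unitmx)) => //= kU; apply/idP/idP => ?.
    by apply: (same_coset_trans hU gU) => //; apply: same_coset_sym.
  exact: (same_coset_trans gU hU).
rewrite -(eq_pick E); case: pickP => [//|/(_ h)].
by rewrite /= hU gh.
Qed.

Definition is_coset_repr (t : 'M[F]_N) := (t \in unitmx) && (coset_repr t == t).

Definition coset_reps := {t : 'M[F]_N | is_coset_repr t}.

Lemma coset_reps_unit (t : coset_reps) : val t \in unitmx.
Proof. by have /andP[] := valP t. Qed.

Lemma coset_reps_ex g : g \in unitmx -> exists t : coset_reps, same_coset (val t) g.
Proof.
move=> gU; have [rU gr] := coset_reprP gU.
have rP : is_coset_repr (coset_repr g).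
  by rewrite /is_coset_repr rU (eq_coset_repr (h := g)) ?eqxx//; apply: same_coset_sym.
exists (Sub (coset_repr g) rP); rewrite SubK; exact: same_coset_sym.
Qed.

Lemma coset_reps_uniq (t t' : coset_reps) : same_coset (val t) (val t') -> t = t'.
Proof.
move=> tt'; apply: val_inj.
have /andP[tU /eqP <-] := valP t; have /andP[tU' /eqP <-] := valP t'.
exact: eq_coset_repr.
Qed.

Definition card_GLF n := #|[pred g : 'M[F]_n | g \in unitmx]|.

Lemma card_parabolic : #|[pred g : 'M[F]_N | (g \in unitmx) && (lower_block e g == 0)]| =
  (card_GLF r * card_GLF s * #|F| ^ (r * s))%N.
Proof.
pose f (x : 'M[F]_r * 'M[F]_s * 'M[F]_(r, s)) : 'M[F]_N :=
  castmx (e, e) (block_mx x.1.1 x.2 0 x.1.2).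
have f_inj : injective f.
  move=> [[a b] c] [[a' b'] c']; rewrite /f /= => h.
  have /eq_block_mx[-> -> _ ->] : block_mx a c 0 b = block_mx a' c' 0 b'.
    by rewrite -[LHS](castmxK e e) h castmxK.
  by [].
pose A : pred ('M[F]_r * 'M[F]_s * 'M[F]_(r, s)) :=
  [pred x | (x.1.1 \in unitmx) && (x.1.2 \in unitmx)].
have -> : (card_GLF r * card_GLF s * #|F| ^ (r * s))%N = #|A|.
  rewrite -card_mx /card_GLF -!cardX; apply: eq_card => -[[a b] c].
  by rewrite !inE /= andbT.
rewrite -(card_imset _ f_inj); apply: eq_card => g; rewrite inE.
apply/andP/imsetP => [[gU /eqP lg]|[[[a b] c] /andP[/= aU bU] ->]].
  move: gU lg; rewrite /f /lower_block /prj2 /stk /A; case: _ / e g => g gU.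
  rewrite !castmx_id -[g]submxK mul_row_block mul_row_col.
  rewrite !mul0mx !mul1mx !add0r mulmx1 mulmx0 addr0 => lg.
  exists ((ulsubmx g, drsubmx g), ursubmx g).
    move: gU; rewrite -[g]submxK lg inE /= !block_mxKul !block_mxKdr.
    by rewrite !unitmxE det_ublock unitrM.
  by rewrite /= castmx_id -{1}lg.
rewrite /f /lower_block /prj2 /stk /=; case: _ / e.
rewrite !castmx_id mul_row_block mul_row_col.
rewrite !mul0mx !mul1mx !add0r mulmx1 mulmx0 addr0 eqxx; split=> //.
by rewrite unitmxE det_ublock unitrM -!unitmxE aU bU.
Qed.

(** The fibre of [coset_repr] over a representative t is t times the stabilizer. The orders of the
    general linear groups stay unevaluated, as they cancel against those in [haar_GLZp]. *)
Lemma card_coset_reps :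
  card_GLF N = (#|{: coset_reps}| * (card_GLF r * card_GLF s * #|F| ^ (r * s)))%N.
Proof.
rewrite -card_parabolic /card_GLF -sum1_card.
rewrite (partition_big coset_repr is_coset_repr) /=; last first.
  move=> g gU; have [rU gr] := coset_reprP gU.
  by rewrite /is_coset_repr rU (eq_coset_repr (h := g)) ?eqxx//; apply: same_coset_sym.
rewrite (eq_bigr (fun=> #|[pred g : 'M[F]_N | (g \in unitmx) && (lower_block e g == 0)]|)).
  by rewrite sum_nat_const card_sig; congr (_ * _)%N; apply: eq_card.
move=> t /andP[tU /eqP tr]; rewrite sum1_card.
have f_inj : injective (fun b : 'M[F]_N => t *m b) by apply: can_inj (mulKmx tU).
rewrite -[RHS](card_imset _ f_inj); apply: eq_card => g; rewrite [LHS]inE /=.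
apply/idP/imsetP => [/andP[gU /eqP gt]|[b /andP[bU /eqP lb] ->]].
  exists (invmx t *m g); last by rewrite mulKVmx.
  rewrite inE unitmx_mul unitmx_inv tU gU /=.
  have [_ gr] := coset_reprP gU; rewrite gt in gr.
  exact: same_coset_sym.
have tbU : t *m b \in unitmx by rewrite unitmx_mul tU.
rewrite tbU -[X in _ == X]tr; apply/eqP/eq_coset_repr => //.
by apply: same_coset_sym => //; rewrite /same_coset mulKmx// lb.
Qed.

End Transversal.

(** * Lattice bases of flats *)

Section Elimination.
Variables (p : nat) (p_pr : prime p).
Local Notation O := (padic_int p_pr).
Local Notation K := (padic p_pr).
Local Notation toF := (@toF p p_pr).

Lemma primitive_mx a b (A : 'M[O]_(a, b)) : A != 0 ->
  exists k (U : 'M[O]_(a, b)) i j, U i j \is a GRing.unit /\ A = p%:R ^+ k *: U.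
Proof.
move=> /matrix0Pn[i0 [j0 A0]].
pose P k := [exists i, exists j, ~~ pdvd k.+1 (A i j)].
have exP : exists k, P k.
  have [k [t [tU tE]]] := pdvd_split A0.
  exists k; apply/existsP; exists i0; apply/existsP; exists j0.
  by rewrite tE pdvd_unit// ltnn.
have [k /existsP[i /existsP[j Aij]] kmin] := ex_minnP exP.
have /pdvd_mx[U AE] : forall i j, pdvd k (A i j).
  move=> i' j'; case: k {Aij} kmin => [_|k kmin]; first exact: pdvd0n.
  apply/negPn/negP => Ak; have := kmin k; rewrite ltnn => h.
  have // : false by apply: h; apply/existsP; exists i'; apply/existsP; exists j'.
exists k, U, i, j; split=> //.
by move: Aij; rewrite AE mxE padic_unitE -addn1 pdvd_pXM.
Qed.

Lemma padic_clear_denominators a (v : 'cV[K]_a) :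
  exists (z : O) (w : 'cV[O]_a), z != 0 /\ toF z *: v = map_mx toF w.
Proof.
have D0 i : (repr (v i 0)).2 != 0 by exact: denom_ratioP.
exists (\prod_i (repr (v i 0)).2).
exists (\col_i ((repr (v i 0)).1 * \prod_(j | j != i) (repr (v j 0)).2)).
split; first by apply/prodf_neq0 => i _.
apply/colP => i; rewrite !mxE (bigD1 i)//= !rmorphM /= {2}[v i 0]padic_numden.
rewrite mulrC mulrA; congr (_ * _); rewrite divfK//.
by rewrite tofrac_eq0.
Qed.

Lemma primitive_vec a (v : 'cV[K]_a) : v != 0 ->
  exists c (u : 'cV[O]_a) i, u i 0 \is a GRing.unit /\ v = c *: map_mx toF u.
Proof.
move=> v0; have [z [w [z0 zv]]] := padic_clear_denominators v.
have Fz0 : toF z != 0 by rewrite tofrac_eq0.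
have w0 : w != 0.
  apply: contraNneq v0 => w0; move: zv; rewrite w0 map_mx0 => /eqP.
  by rewrite scalemx_eq0 (negbTE Fz0).
have [k [u [i [j [ui wE]]]]] := primitive_mx w0.
exists ((toF z)^-1 * toF (p%:R ^+ k)), u, i; split; first by rewrite (ord1 j) in ui.
rewrite -scalerA -[v in LHS](scalerK Fz0) zv wE; congr (_ *: _).
by apply/matrixP => i' j'; rewrite !mxE rmorphM.
Qed.

(** Swapped to the top, the unit entry divides all others inside Z_p; the row operations clearing
    them form an integral unipotent matrix. *)
Lemma pivot n (u : 'cV[O]_n.+1) i : u i 0 \is a GRing.unit ->
  exists2 h : 'M[O]_n.+1, h \in unitmx & forall j, j != 0 -> (h *m u) j 0 = 0.
Proof.
move=> ui; pose w := row_perm (tperm 0 i) u.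
have w0 : w 0 0 = u i 0 by rewrite mxE tpermL.
pose h : 'M[O]_n.+1 :=
  \matrix_(a, b) ((a == b)%:R - ((a != 0) && (b == 0))%:R * (w a 0 / w 0 0)).
have hU : h \in unitmx.
  rewrite unitmxE det_trig; last first.
    apply/is_trig_mxP => a b ab; rewrite mxE (_ : a == b = false); last first.
      by apply/negbTE; rewrite neq_ltn ab.
    rewrite (_ : b == 0 = false) ?andbF ?mul0r ?subr0//.
    by apply/negbTE; rewrite -lt0n (leq_ltn_trans _ ab).
  rewrite big1 ?unitr1// => a _; rewrite mxE eqxx.
  by case: (a == 0); rewrite mul0r subr0.
exists (h *m perm_mx (tperm 0 i)).
  by rewrite unitmx_mul hU unitmx_perm.
move=> j j0; rewrite -mulmxA -row_permE -/w [LHS]mxE (bigD1 0)//= (bigD1 j)//=.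
have -> : h j 0 = - (w j 0 / w 0 0).
  by rewrite [LHS]mxE (negbTE j0) eqxx mul1r sub0r.
have -> : h j j = 1 by rewrite [LHS]mxE eqxx (negbTE j0) andbF mul0r subr0.
rewrite big1 => [|a /andP[a0 aj]].
  by rewrite mulNr divrK ?w0// mul1r addr0 addNr.
by rewrite [h j a]mxE [j == a]eq_sym (negbTE aj) (negbTE a0) andbF mul0r subr0 mul0r.
Qed.

(** Induction on the number of columns. A nonzero column over Q_p is a scalar multiple of a
    primitive integral vector, so a unit pivot exists and the row operations stay in GL_n(Z_p). *)
Lemma elimination r : forall n (B : 'M[K]_(n, r)), exists2 h : 'M[O]_n, h \in unitmx &
  forall (i : 'I_n) (j : 'I_r), (r <= i)%N -> (map_mx toF h *m B) i j = 0.
Proof.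
elim: r => [|r IH] n B; first by exists 1%:M; [exact: unitmx1|move=> i []].
case: n B => [|n] B; first by exists 1%:M; [exact: unitmx1|case].
have [h1 h1U h1B] : exists2 h1 : 'M[O]_n.+1, h1 \in unitmx &
    forall i, i != 0 -> (map_mx toF h1 *m B) i 0 = 0.
  have E h i : (map_mx toF h *m B) i 0 = (map_mx toF h *m col 0 B) i 0.
    by rewrite !mxE; apply: eq_bigr => k _; rewrite [col _ _ _ _]mxE.
  have [v0|v0] := eqVneq (col 0 B) 0.
    by exists 1%:M; [exact: unitmx1|move=> i _; rewrite E v0 mulmx0 mxE].
  have [c [u [i [ui vE]]]] := primitive_vec v0.
  have [h hU hu] := pivot ui; exists h => // j j0.
  by rewrite E vE -scalemxAr -map_mxM mxE mxE hu// rmorph0 mulr0.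
pose C : 'M[K]_(1 + n, 1 + r) := map_mx toF h1 *m B.
have [h' h'U h'B] := IH n (drsubmx C).
have bU : (block_mx 1%:M 0 0 h' : 'M[O]_(1 + n)) \in unitmx.
  by rewrite unitmxE det_ublock det1 mul1r -unitmxE.
exists ((block_mx 1%:M 0 0 h' : 'M[O]_(1 + n)) *m h1).
  by rewrite unitmx_mul h1U andbT.
have dlC : dlsubmx C = 0.
  apply/matrixP => i j; rewrite (ord1 j) 2![LHS]mxE [RHS]mxE -[RHS](h1B (rshift 1 i))//.
  by congr (_ _ _); apply: val_inj.
have hC : (block_mx 1%:M 0 0 (map_mx toF h') : 'M[K]_(1 + n)) *m C =
    block_mx (ulsubmx C) (ursubmx C) 0 (map_mx toF h' *m drsubmx C).
  rewrite -[C in LHS]submxK mulmx_block.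
  by rewrite !mul1mx !mul0mx !addr0 dlC mulmx0 !add0r.
have -> : map_mx toF ((block_mx 1%:M 0 0 h' : 'M[O]_(1 + n)) *m h1) *m B =
    block_mx (ulsubmx C) (ursubmx C) 0 (map_mx toF h' *m drsubmx C).
  rewrite -hC [map_mx _ _]map_mxM -mulmxA; congr (_ *m _).
  by rewrite map_block_mx map_mx1 !map_mx0.
move=> i j ri; rewrite mxE; case: splitP => i' ii'.
  by move: ri; rewrite ii' (ord1 i').
rewrite mxE; case: splitP => j' jj'; first by rewrite mxE.
by rewrite h'B//; move: ri; rewrite ii' add1n.
Qed.

Lemma prj2_mulE (S : comNzRingType) r s N (e : (r + s = N)%N) b (C : 'M[S]_(N, b)) i j :
  (prj2 S e *m C) i j = C (cast_ord e (rshift r i)) j.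
Proof.
rewrite /prj2; case: _ / e C => C; rewrite castmx_id -[C in LHS]vsubmxK mul_row_col.
by rewrite mul0mx mul1mx add0r mxE cast_ord_id.
Qed.

(** For a basis matrix B of L, elimination makes h B the standard frame times an invertible R, so
    h^-1 carries the standard flat to L. *)
Lemma integral_frame r s N (e : (r + s = N)%N) (L : {vspace 'cV[K]_N}) :
  \dim L = r -> exists2 h : 'M[O]_N, h \in unitmx &
    L = column_span (map_mx toF (h *m stk e 0)).
Proof.
move=> /column_span_basis[B -> Binj]; have [h hU hB] := elimination B.
pose C := map_mx toF h *m B; pose R := prj K e *m C.
have FhU : map_mx toF h \in unitmx.
  by rewrite unitmxE det_map_mx rmorph_unit// -unitmxE.
have CE : C = stk e 0 *m R.
  rewrite {1}[C](stk_split e) (_ : prj2 _ _ *m C = 0) ?dirm0 ?addr0//.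
  by apply/matrixP => i j; rewrite prj2_mulE hB ?mxE//= leq_addr.
have RU : R \in unitmx.
  rewrite unitmxE unitfE -det_tr; apply/det0P => -[v v0 vR].
  have Rv : R *m v^T = 0 by rewrite -[R]trmxK -trmx_mul vR trmx0.
  have CV : C *m v^T = 0 by rewrite CE -mulmxA Rv mulmx0.
  have Bv : B *m v^T = 0 by rewrite -(mulKmx FhU B) -/C -mulmxA CV mulmx0.
  by move: v0; rewrite -[v]trmxK (Binj _ Bv) trmx0 eqxx.
exists (invmx h); first by rewrite unitmx_inv.
rewrite -[RHS](column_span_mulr _ RU); congr column_span.
rewrite map_mxM map_stk map_mx0 -mulmxA -CE /C mulmxA -map_mxM mulVmx//.
by rewrite map_mx1 mul1mx.
Qed.

End Elimination.

(** * Flats as points of the charts *)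

Section Flats.
Variables (p : nat) (p_pr : prime p).
Local Notation O := (padic_int p_pr).
Local Notation K := (padic p_pr).
Local Notation toF := (@toF p p_pr).
Variables (nu r s N D : nat) (e : (r + s = N)%N) (d : 'I_nu -> nat).
Hypothesis DE : D = (s * r)%N.
Variable tau : 'I_D -> cidx d r.
Variable tau' : cidx d r -> 'I_D.
Hypothesis tau'K : cancel tau' tau.

Local Notation T := (coset_reps 'F_p e).
Local Notation Amx := (@Amx p p_pr r s D DE).

Definition frame (t : T) : 'M[O]_N := map_mx (Fp_lift p_pr) (val t).

Lemma map_frame t : map_mx (@padic_Fp p p_pr) (frame t) = val t.
Proof. by apply/matrixP => i j; rewrite !mxE Fp_liftK. Qed.

Lemma frame_unit t : frame t \in unitmx.
Proof. by rewrite padic_unitmx map_frame coset_reps_unit. Qed.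

Lemma map_inv_frame t : map_mx (@padic_Fp p p_pr) (invmx (frame t)) = invmx (val t).
Proof.
have h : map_mx (@padic_Fp p p_pr) (invmx (frame t)) *m
    map_mx (@padic_Fp p p_pr) (frame t) = 1%:M.
  by rewrite -map_mxM (mulVmx (frame_unit t)) map_mx1.
rewrite map_frame in h.
by rewrite -[LHS](mulmxK (coset_reps_unit t)) h mul1mx.
Qed.

Definition flat_at (tx : T * 'cV[O]_D) : {vspace 'cV[K]_N} :=
  column_span (map_mx toF (frame tx.1 *m stk e (Amx tx.2))).

Lemma flat_at_left_inverse tx : exists W : 'M[O]_(r, N),
  W *m (frame tx.1 *m stk e (Amx tx.2)) = 1%:M.
Proof.
exists (prj O e *m invmx (frame tx.1)).
by rewrite -mulmxA (mulKmx (frame_unit _)) prj_stk.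
Qed.

Lemma dim_flat_at tx : \dim (flat_at tx) = r.
Proof.
have [W WE] := flat_at_left_inverse tx.
apply: (@dim_column_span _ _ _ _ _ (map_mx toF W)).
by rewrite -map_mxM WE map_mx1.
Qed.

Definition small (x : 'cV[O]_D) := forall i, pdvd 1 (x i 0).

Lemma small_Amx x : small x -> map_mx (@padic_Fp p p_pr) (Amx x) = 0.
Proof.
move=> sx; apply/matrixP => i j; rewrite !mxE castmxE !mxE.
by apply/eqP; rewrite padic_Fp_eq0 cast_ord_id; apply: sx.
Qed.

(** Write L as h applied to the standard flat and let t represent h modulo p. The lower block of
    t^-1 h is divisible by p, hence its upper block is invertible, and the lower block times the
    inverse of the upper one is the coordinate of L in the chart t. *)
Lemma flat_at_surj (L : {vspace 'cV[K]_N}) : \dim L = r ->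
  exists2 tx, small tx.2 & L = flat_at tx.
Proof.
move=> /(integral_frame e)[h hU ->].
have hpU : map_mx (@padic_Fp p p_pr) h \in unitmx by rewrite -padic_unitmx.
have [t /eqP th] := coset_reps_ex e hpU.
pose M := invmx (frame t) *m h.
have Mp : map_mx (@padic_Fp p p_pr) M = invmx (val t) *m map_mx (@padic_Fp p p_pr) h.
  rewrite map_mxM; congr (_ *m _).
  exact: map_inv_frame.
have MU : M \in unitmx by rewrite unitmx_mul unitmx_inv frame_unit.
have lM : map_mx (@padic_Fp p p_pr) (lower_block e M) = 0.
  by rewrite map_lower_block Mp th.
have uMU : upper_block e M \in unitmx.
  rewrite padic_unitmx map_upper_block; apply: upper_block_unit.
    by rewrite -padic_unitmx.
  by rewrite -map_lower_block.
have [x xE] := @Amx_surj _ p_pr r s D DE (lower_block e M *m invmx (upper_block e M)).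
exists (t, x).
  move=> i /=; rewrite -padic_Fp_eq0.
  have : map_mx (@padic_Fp p p_pr) (Amx x) = 0.
    by rewrite xE map_mxM lM mul0mx.
  move=> /matrixP Ax0; pose k := cast_ord DE i.
  have [i1 [j1 kE]] : exists i1 j1, k = mxvec_index i1 j1.
    by case/mxvec_indexP: k => i1 j1; exists i1, j1.
  move: (Ax0 i1 j1) => /eqP; rewrite !mxE castmxE !mxE cast_ord_id -kE.
  by rewrite /k cast_ordK.
rewrite /flat_at /= xE.
have ME : M *m stk e 0 = stk e (lower_block e M *m invmx (upper_block e M))
    *m upper_block e M.
  by rewrite [stk e (_ *m _)]stkE mulmxDl -dirm_mul mulmxKV// -mul_stk0.
have -> : h *m stk e 0 = frame t *m stk e (lower_block e M *m invmx (upper_block e M))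
    *m upper_block e M.
  transitivity (frame t *m (M *m stk e 0)); last by rewrite ME mulmxA.
  by rewrite /M mulmxA (mulKVmx (frame_unit t)).
rewrite [in LHS]map_mxM column_span_mulr//.
by rewrite unitmxE det_map_mx rmorph_unit// -unitmxE.
Qed.

(** The two frames differ by a matrix over Q_p, which is integral because frames have integral left
    inverses. Modulo p the coordinates vanish, so both charts belong to one coset; then the top
    block shows that the matrix is 1 and the bottom block that the coordinates agree. *)
Lemma flat_at_inj tx tx' : small tx.2 -> small tx'.2 ->
  flat_at tx = flat_at tx' -> tx = tx'.
Proof.
case: tx tx' => t x [t' x'] /= sx sx' ff.
have /choice[y yE] (j : 'I_r) : exists y : 'cV[K]_r,
    col j (map_mx toF (frame t' *m stk e (Amx x'))) =
    map_mx toF (frame t *m stk e (Amx x)) *m y.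
  apply/mem_column_span; rewrite -[column_span _]/(flat_at (t, x)) ff.
  apply/mem_column_span; exists (delta_mx j 0).
  by rewrite -colE.
pose Y : 'M[K]_r := \matrix_(i, j) y j i 0.
have YE : map_mx toF (frame t' *m stk e (Amx x')) =
    map_mx toF (frame t *m stk e (Amx x)) *m Y.
  apply/matrixP => i j; have /colP/(_ i) := yE j.
  rewrite [LHS]mxE => ->; rewrite [LHS]mxE [RHS]mxE.
  by apply: eq_bigr => k _; rewrite [Y k j]mxE.
pose M := invmx (frame t) *m frame t'.
have [Z ZE] : exists Z, Z = prj O e *m M *m stk e (Amx x') by exists (prj O e *m M *m stk e (Amx x')).
have tU := frame_unit t.
have YZ : Y = map_mx toF Z.
  have [W WE] := flat_at_left_inverse (t, x).
  have := congr1 (mulmx (map_mx toF (prj O e *m invmx (frame t)))) YE.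
  rewrite mulmxA -!map_mxM -[X in _ = map_mx _ X *m _ -> _]mulmxA (mulKmx tU) prj_stk.
  by rewrite map_mx1 mul1mx => <-; rewrite ZE /M !mulmxA.
have ME : M *m stk e (Amx x') = stk e (Amx x) *m Z.
  rewrite -[LHS](mulKmx tU) -[RHS](mulKmx tU); congr (_ *m _).
  rewrite /M !mulmxA (mulmxV tU) mul1mx; apply: (@toF_mx_inj _ p_pr).
  by rewrite YE YZ -map_mxM.
have tt' : t = t'.
  apply: coset_reps_uniq; rewrite /same_coset; apply/eqP.
  have : map_mx (@padic_Fp p p_pr) (M *m stk e (Amx x')) =
         map_mx (@padic_Fp p p_pr) (stk e (Amx x) *m Z) by rewrite ME.
  rewrite !map_mxM !map_stk (small_Amx sx) (small_Amx sx') => h.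
  rewrite /lower_block -mulmxA -(map_inv_frame t) -(map_frame t') h.
  by rewrite mulmxA prj2_stk mul0mx.
subst t'; congr (_, _); apply: (@Amx_inj _ p_pr r s D DE).
move: ME; rewrite /M (mulVmx tU) mul1mx => h.
have Z1 : Z = 1%:M by have := congr1 (mulmx (prj O e)) h; rewrite mulmxA !prj_stk mul1mx.
by have := congr1 (mulmx (prj2 O e)) h; rewrite Z1 mulmx1 !prj2_stk.
Qed.

Definition poly_system (a : cidx d N -> O) (j : 'I_nu) : {mpoly K[N]} :=
  hpoly (fun m : hmonom N (d j) => toF (a (Tagged (fun j => hmonom N (d j)) m))).

Lemma poly_systemE a j : poly_system a j = map_mpoly toF (forms a j).
Proof.
rewrite /poly_system /hpoly /forms /hform rmorph_sum /=.
by apply: eq_bigr => m _; rewrite map_mpolyZ map_mpolyX.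
Qed.

(** Integral points of the span already force f(B y) to vanish as a polynomial, by [vanish_eq0]. *)
Lemma zero_on_column_span b (B : 'M[O]_(N, b)) (f : {mpoly O[N]}) :
  zero_on (map_mpoly toF f) (column_span (map_mx toF B)) <-> lsub B f = 0.
Proof.
split=> [f0|f0 x /mem_column_span[y ->]].
  apply: vanish_eq0 => y; rewrite meval_lsub; apply: (@toF_inj _ p_pr).
  rewrite rmorph0 -(meval_map toF).
  rewrite -(f0 (map_mx toF (B *m y))); last first.
    by apply/mem_column_span; exists (map_mx toF y); rewrite map_mxM.
  by apply: meval_eq => i; rewrite [RHS]mxE.
by rewrite -meval_lsub -map_lsub f0 rmorph0 meval0.
Qed.

Lemma zero_on_flat_at a tx :
  (forall j, zero_on (poly_system a j) (flat_at tx)) <->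
  psiO e DE tau (act (frame tx.1) a) tx.2 = 0.
Proof.
have E j : zero_on (poly_system a j) (flat_at tx) <->
    lsub (stk e (Amx tx.2)) (forms (act (frame tx.1) a) j) = 0.
  rewrite poly_systemE; apply: (iff_trans (zero_on_column_span _ _)).
  by rewrite lsub_mul form_act.
split=> [h|h j]; last first.
  apply/E; set F := lsub _ _; have Fd : F \is (d j).-homog by apply/lsub_homog/form_homog.
  rewrite (homog_hform Fd) /hform big1// => m _.
  move/colP/(_ (tau' (Tagged (fun j => hmonom r (d j)) m))): h.
  by rewrite [LHS]mxE [RHS]mxE tau'K /coefs /= => ->; rewrite scale0r.
apply/colP => i; rewrite [LHS]mxE [RHS]mxE /coefs.
by have /E -> := h (tag (tau i)); rewrite mcoeff0.
Qed.

Lemma flats_on_zeros a :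
  [set L : {vspace 'cV[K]_N} | \dim L = r /\ forall j, zero_on (poly_system a j) L] =
  flat_at @` zeros e DE tau frame a.
Proof.
apply/seteqP; split=> [L [/flat_at_surj[tx sx ->] h]|_ [tx [sx h] <-]].
  by exists tx => //; split=> //; apply/zero_on_flat_at.
by split; [exact: dim_flat_at|apply/zero_on_flat_at].
Qed.

Lemma card_flats_zeros a :
  ([set L : {vspace 'cV[K]_N} | \dim L = r /\ forall j, zero_on (poly_system a j) L]
   #= zeros e DE tau frame a)%card.
Proof.
rewrite flats_on_zeros; apply: inj_card_eq => tx tx' /set_mem[sx _] /set_mem[sx' _].
exact: flat_at_inj.
Qed.

End Flats.

(** * Cardinalities as limits *)

Section CountingLimit.
Variable R : realType.

Lemma eq_counting (A B : choiceType) (S : set A) (S' : set B) : (S #= S')%card ->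
  counting S = counting S' :> \bar R.
Proof.
move=> SS'; rewrite /counting.
have fS : finite_set S <-> finite_set S'.
  by split=> /finite_setP[n Sn]; apply/finite_setP; exists n;
    [rewrite -(card_eql SS')|rewrite (card_eql SS')].
case: asboolP => [/[dup] Sf /fS S'f|nS]; last by rewrite asboolF// => /fS.
rewrite asboolT//; have /finite_setP[n Sn] := Sf.
by rewrite (card_fset_set Sn) (card_fset_set (n := n))// -(card_eql SS').
Qed.

(** Every finite subset of [W] lies in a single [Wm m]. For finite [W] the sequence is eventually
    constant; otherwise it exceeds every bound, and [counting W] is infinite. *)
Lemma counting_cvg (A : choiceType) (W : set A) (Wm : nat -> set A) (n : nat -> nat) :
  (forall m, Wm m `<=` W) -> (forall m m', (m <= m')%N -> Wm m `<=` Wm m') ->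
  (forall x, W x -> exists m, Wm m x) -> (forall m, Wm m #= `I_(n m))%card ->
  (fun m => (n m)%:R%:E) @ \oo --> (counting W : \bar R).
Proof.
move=> WmW Wmon WU Wn.
have nle m : n m = #|`fset_set (Wm m)| by rewrite (card_fset_set (Wn m)).
have Wfin m : finite_set (Wm m) by apply/finite_setP; exists (n m).
have cover (B : {fset A}) : [set` B] `<=` W -> exists m, [set` B] `<=` Wm m.
  move=> BW; have /choice[f fE] (x : B) : exists m, Wm m (val x).
    exact/WU/BW/(valP x).
  exists (\max_(x : B) f x) => x xB.
  exact: (Wmon _ _ (leq_bigmax (F := f) [` xB]%fset)) (fE [` xB]%fset).
rewrite /counting; case: asboolP => [Wf|Winf].
  have [m mW] : exists m, W `<=` Wm m.
    have /finite_fsetP[B WB] := Wf; rewrite WB; apply: cover; by rewrite WB.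
  apply: cvg_near_cst; exists m => // m' /= mm'.
  congr ((_)%:R%:E); rewrite nle; congr (#|`fset_set _|).
  by apply/seteqP; split=> //; apply: (subset_trans mW); apply: Wmon.
apply/cvgeyPge => M; have [k Mk] : exists k : nat, M <= k%:R.
  by exists (Num.bound `|M|); apply/(le_trans (ler_norm _))/ltW/archi_boundP.
have [B BW kB] := infinite_set_fset k Winf.
have [m Bm] := cover B BW; exists m => // m' /= mm'.
rewrite lee_fin (le_trans Mk)// ler_nat (leq_trans kB)// nle.
rewrite -[B]set_fsetK; apply: fsubset_leq_card; rewrite -fset_set_sub//.
exact: subset_trans Bm (Wmon _ _ mm').
Qed.

End CountingLimit.

(** * Haar measure *)

Section FiniteAdditivity.
Import HBNNSimple.
Local Open Scope ereal_scope.
Context d (T : measurableType d) (R : realType).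

Lemma measure_finType (mu : {measure set T -> \bar R}) (X : finType) (F : X -> set T) :
  (forall x, measurable (F x)) -> trivIset setT F ->
  mu (\bigcup_x F x) = \sum_(x : X) mu (F x).
Proof.
move=> mF tF; rewrite measure_fin_bigcup//; last exact: finite_finset.
transitivity (\sum_(x <- enum X) mu (F x)); last by rewrite big_enum.
rewrite [RHS]fsbig_seq ?enum_uniq// (_ : [set` enum X] = [set: X])//.
by apply/seteqP; split=> x //= _; rewrite mem_enum.
Qed.

Lemma sume_cst_eq1 (X : finType) (c : \bar R) : 0 <= c ->
  \sum_(x : X) c = 1 -> c = (#|X|%:R^-1)%:E.
Proof.
move=> c0; case: c c0 => [c _|_|//].
  rewrite sumEFin => -[]; rewrite sumr_const => h; congr EFin.
  have X0 : (#|X|%:R : R) != 0%R.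
    by apply/eqP => X0; move: h; rewrite -mulr_natr X0 mulr0 => /esym/eqP; rewrite oner_eq0.
  by apply: (mulIf X0); rewrite mulVf// mulr_natr.
case: (pickP X) => [x _|X0]; last first.
  by rewrite big1 => [/esym/eqP|x]; [rewrite onee_eq0|have := X0 x].
rewrite (bigD1 x)//= addye ?gt_eqF//.
by rewrite (@lt_le_trans _ _ 0)//; apply: sume_ge0.
Qed.

(* The integral of a nonnegative function is defined as a supremum over simple
   functions, so this holds without any measurability of f and g. *)
Lemma ge0_integral_eq_off_null (mu : {measure set T -> \bar R}) (N : set T)
    (f g : T -> \bar R) : measurable N -> mu N = 0 ->
  (forall x, 0 <= f x) -> (forall x, 0 <= g x) ->
  (forall x, ~ N x -> f x = g x) -> \int[mu]_x f x = \int[mu]_x g x.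
Proof.
move=> mN N0.
suff le (u v : T -> \bar R) : (forall x, 0 <= u x) -> (forall x, 0 <= v x) ->
    (forall x, ~ N x -> u x = v x) -> \int[mu]_x u x <= \int[mu]_x v x.
  move=> f0 g0 fg; apply/eqP; rewrite eq_le !le// => x Nx.
  by rewrite fg.
move=> u0 v0 uv; rewrite !ge0_integralTE//; apply: ge_ereal_sup => _ [h /= hu <-].
have mTN : measurable (setT `\` N) by exact: measurableD.
have -> : sintegral mu h = sintegral mu (proj_nnsfun h mTN).
  transitivity (\int[mu]_x (h x)%:E).
    by rewrite integral_nnsfun// patch_setT.
  rewrite (ge0_negligible_integral mN)//.
  - by rewrite integral_nnsfun// (mrestrict _ mTN).
  - exact/measurable_EFinP.
  - by move=> x _; rewrite lee_fin; exact: fun_ge0.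
apply: ereal_sup_ubound; exists (proj_nnsfun h mTN) => //= x.
rewrite mindicE; case: (pselect (N x)) => Nx.
  by rewrite memNset ?mulr0// => -[].
by rewrite mem_set// mulr1 -uv.
Qed.

End FiniteAdditivity.

(** * Balls of Q_p and residue cosets of matrices *)

Section Balls.
Variables (p : nat) (p_pr : prime p).
Local Notation O := (padic_int p_pr).
Local Notation K := (padic p_pr).
Local Notation toF := (@toF p p_pr).
Local Notation pX m := (p%:R ^+ m : O).

Lemma padic_abs_le_pX (x : K) m : padic_abs x <= p%:R ^- m ->
  exists t, x = toF (pX m * t).
Proof.
have [->|x0] := eqVneq x 0; first by exists 0; rewrite mulr0 rmorph0.
have xE := padic_numden x; rewrite /padic_abs.
have d0 : (repr x).2 != 0 by exact: denom_ratioP.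
move: (repr x).1 (repr x).2 d0 xE => n z z0 xE.
have n0 : n != 0 by apply: contraNneq x0 => n0; rewrite xE n0 tofrac0 mul0r.
have [i [t [tU nE]]] := pdvd_split n0; have [j [u [uU zE]]] := pdvd_split z0.
have p1 : 1 < p%:R :> rat by rewrite ltr1n prime_gt1.
have p0 : 0 < p%:R :> rat by rewrite ltr0n prime_gt0.
rewrite nE zE !padic_int_abs_unit// invrK mulrC -ler_pdivlMl ?exprn_gt0//.
rewrite -invfM -exprD lef_pV2 ?posrE ?exprn_gt0// ler_eXn2l// => ji.
exists (pX (i - (j + m)) * (t / u)).
apply: (@mulIf _ (toF z)); first by rewrite tofrac_eq0.
rewrite xE divfK ?tofrac_eq0// -rmorphM; congr tofrac.
rewrite nE zE -[in LHS](subnKC ji) !exprD.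
rewrite -[in LHS](divrK uU t).
by move: (pX j) (pX m) (pX (i - (j + m))) (t / u) => *; ring.
Qed.

Lemma nbhs_pX (x : K) m : nbhs x [set y | exists t, y = x + toF (pX m * t)].
Proof.
have e0 : 0 < (p%:R ^- m : rat) by rewrite invr_gt0 exprn_gt0// ltr0n prime_gt0.
apply: filterS (nbhsx_ballx x _ e0) => y.
rewrite ballEmdist /= => yx; have [|t tE] := @padic_abs_le_pX (y - x) m.
  exact: ltW.
by exists t; rewrite -tE addrC subrK.
Qed.

Definition ball_pX m (x : K) : set K := [set y | exists t, y = x + toF (pX m * t)].

Lemma open_ball_pX m x : open (ball_pX m x).
Proof.
rewrite openE => _ [t ->]; apply: filterS (nbhs_pX _ m) => _ [u ->].
by exists (t + u); rewrite mulrDr rmorphD addrA.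
Qed.

Definition coset_pX a b m (X : 'M[K]_(a, b)) : set 'M[K]_(a, b) :=
  [set X + map_mx toF (pX m *: T) | T in [set: 'M[O]_(a, b)]].

Lemma coset_pXP a b m (X Y : 'M[K]_(a, b)) :
  coset_pX m X Y <-> forall i j, ball_pX m (X i j) (Y i j).
Proof.
split=> [[T _ <-] i j|h]; first by exists (T i j); rewrite !mxE.
have /choice[f fE] (ij : 'I_a * 'I_b) : exists t,
    Y ij.1 ij.2 = X ij.1 ij.2 + toF (pX m * t) by exact: h.
exists (\matrix_(i, j) f (i, j)) => //; apply/matrixP => i j; rewrite !mxE.
by rewrite -(fE (i, j)).
Qed.

Lemma open_coset_pX a b m (X : 'M[K]_(a, b)) : open (coset_pX m X).
Proof.
rewrite openE => _ [T _ <-].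
exists (fun i j => ball_pX m ((X + map_mx toF (pX m *: T)) i j)) => [i j|Y YP].
  exact: nbhs_pX.
have /coset_pXP[U _ <-] : forall i j,
    ball_pX m ((X + map_mx toF (pX m *: T)) i j) (Y i j) by [].
by exists (T + U) => //; rewrite scalerDr map_mxD addrA.
Qed.

Lemma measurable_coset_pX a b m (X : 'M[K]_(a, b)) :
  measurable (coset_pX m X : set (borel 'M[K]_(a, b))).
Proof. by apply: sub_sigma_algebra; apply: open_coset_pX. Qed.

Lemma measurable_ball_pX m x : measurable (ball_pX m x : set (borel K)).
Proof. by apply: sub_sigma_algebra; apply: open_ball_pX. Qed.

Lemma integral_mxE a b : @integral_mx p p_pr a b = coset_pX 0 0.
Proof.
apply/seteqP; split=> [A Ai|A /coset_pXP h i j].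
  apply/coset_pXP => i j; have [t _ <-] := Ai i j; exists t.
  by rewrite mxE add0r mul1r.
by have [t ->] := h i j; exists (pX 0 * t); rewrite // mxE add0r.
Qed.

Lemma padic_ringE : @padic_ring p p_pr = ball_pX 0 0.
Proof.
apply/seteqP; split=> [_ [t _ <-]|_ [t ->]]; first by exists t; rewrite add0r mul1r.
by exists (pX 0 * t); rewrite // add0r.
Qed.

Definition lift_mx a b m (q : {ffun 'I_a * 'I_b -> 'I_(p ^ m)}) : 'M[K]_(a, b) :=
  \matrix_(i, j) toF (lift_res p_pr q (i, j)).

Lemma ball_pX_natr m (z : O) k : ball_pX m (toF k%:R) (toF z) <-> pdvd m (z - k%:R).
Proof.
split=> [[t /eqP]|/pdvdP[t tE]]; last first.
  by exists t; rewrite -tE -rmorphD addrC subrK.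
by rewrite -rmorphD => /eqP/toF_inj ->; rewrite addrC addKr pdvd_pX.
Qed.

Lemma lift_mx_disjoint a b m (q q' : {ffun 'I_a * 'I_b -> 'I_(p ^ m)}) Y :
  coset_pX m (lift_mx q) Y -> coset_pX m (lift_mx q') Y -> q = q'.
Proof.
move=> /coset_pXP h /coset_pXP h'.
rewrite -(lift_resK p_pr q) -(lift_resK p_pr q'); apply/red_resP => -[i j].
have [t Yt] := h i j; have [u Yu] := h' i j; rewrite Yt !mxE -!rmorphD in Yu.
move/toF_inj: Yu => h1.
have -> : lift_res p_pr q (i, j) - lift_res p_pr q' (i, j) = pX m * (u - t).
  by rewrite mulrBr -(addrK (pX m * t) (lift_res _ _ _)) h1; ring.
exact: pdvd_pX.
Qed.

Lemma integral_mx_cover a b m : @integral_mx p p_pr a b =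
  \bigcup_(q : {ffun 'I_a * 'I_b -> 'I_(p ^ m)}) coset_pX m (lift_mx q).
Proof.
rewrite integral_mxE; apply/seteqP; split=> [_ [T _ <-]|Y [q _ [T _ <-]]].
  pose v (ij : 'I_a * 'I_b) := T ij.1 ij.2; exists (red_res m v) => //.
  apply/coset_pXP => i j; rewrite expr0 scale1r add0r !mxE.
  apply/ball_pX_natr; exact: (vcong_sym (lift_red_res m v) (i, j)).
exists (\matrix_(i, j) lift_res p_pr q (i, j) + pX m *: T) => //.
rewrite expr0 scale1r add0r map_mxD; congr (_ + _).
by apply/matrixP => i j; rewrite !mxE.
Qed.

End Balls.

Section Haar.
Variables (R : realType) (p : nat) (p_pr : prime p).
Local Notation O := (padic_int p_pr).
Local Notation K := (padic p_pr).
Local Notation toF := (@toF p p_pr).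
Local Notation pX m := (p%:R ^+ m : O).

(** The p^(m a b) cosets modulo p^m inside the integral matrices are translates of one another and
    partition a set of measure 1. *)
Lemma haar_coset a b (lam : {measure set (borel 'M[K]_(a, b)) -> \bar R}) m X :
  is_haar lam -> lam (coset_pX m X) = (p%:R ^- (m * (a * b)))%:E.
Proof.
move=> [lam1 lamT].
have shift Y : lam (coset_pX m Y) = lam (coset_pX m 0).
  rewrite -(lamT Y (coset_pX m 0)); last exact: measurable_coset_pX.
  congr (lam _); apply/seteqP; split=> [_ [T _ <-]|_ [_ [T _ <-] <-]].
    by exists (map_mx toF (pX m *: T)) => //; exists T => //; rewrite add0r.
  by exists T => //; rewrite add0r.
rewrite shift.
rewrite (@sume_cst_eq1 R {ffun 'I_a * 'I_b -> 'I_(p ^ m)} (lam (coset_pX m 0)))//.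
  by rewrite card_ffun card_ord card_prod !card_ord -expnM natrX.
rewrite -lam1 (integral_mx_cover _ _ _ m) measure_finType.
- by apply: eq_bigr => q _; rewrite shift.
- by move=> q; apply: measurable_coset_pX.
- by move=> q q' _ _ [Y [Yq Yq']]; apply: lift_mx_disjoint Yq Yq'.
Qed.

Lemma GLZpP N (M : 'M[K]_N) :
  GLZp N M <-> exists2 A : 'M[O]_N, A \in unitmx & M = map_mx toF A.
Proof.
have int (B : 'M[K]_N) : integral_mx B -> exists A, B = map_mx toF A.
  rewrite integral_mxE => -[A _ <-]; exists A.
  by rewrite expr0 scale1r add0r.
split=> [[MU /int[A AE] /int[B BE]]|[A AU ->]].
  exists A => //; have : A *m B = 1%:M.
    by apply: (@toF_mx_inj p p_pr); rewrite map_mxM -AE -BE mulmxV// map_mx1.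
  by case/mulmx1_unit.
have FU : map_mx toF A \in unitmx by rewrite unitmxE det_map_mx rmorph_unit// -unitmxE.
split=> // [i j|]; first by exists (A i j); rewrite ?mxE.
have -> : invmx (map_mx toF A) = map_mx toF (invmx A).
  rewrite -[RHS](mulmxK FU) -map_mxM mulVmx// map_mx1.
  by rewrite mul1mx.
by move=> i j; exists (invmx A i j); rewrite ?mxE.
Qed.

(** Invertibility over Z_p is decided modulo p, so GL_N(Z_p) is a union of cosets modulo p, one for
    each element of GL_N(F_p). *)
Lemma haar_GLZp N (lam : {measure set (borel 'M[K]_(N, N)) -> \bar R}) :
  is_haar lam -> lam (GLZp N) = ((card_GLF 'F_p N)%:R * p%:R ^- (N * N))%:E.
Proof.
move=> lamH.
pose X := {g : 'M['F_p]_N | g \in unitmx}.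
pose F (g : X) := coset_pX 1 (map_mx toF (map_mx (Fp_lift p_pr) (val g))).
have FE : GLZp N = \bigcup_g F g.
  apply/seteqP; split=> [M /GLZpP[A AU ->]|M [g _ [T _ <-]]].
    have gU : map_mx (@padic_Fp p p_pr) A \in unitmx by rewrite -padic_unitmx.
    exists (@exist 'M['F_p]_N (fun g => g \in unitmx) _ gU) => //.
    apply/coset_pXP => i j; rewrite /= !mxE; apply/ball_pX_natr.
    by rewrite -padic_Fp_eq0 rmorphB /= -[X in _ - _ X]/(Fp_lift p_pr _) Fp_liftK subrr.
  apply/GLZpP; exists (map_mx (Fp_lift p_pr) (val g) + pX 1 *: T).
    rewrite padic_unitmx map_mxD (_ : map_mx _ (pX 1 *: T) = 0).
      rewrite addr0 -map_mx_comp (_ : map_mx _ _ = val g) ?(valP g)//.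
      by apply/matrixP => i j; rewrite mxE /= Fp_liftK.
    by apply/matrixP => i j; rewrite !mxE; apply/eqP; rewrite padic_Fp_eq0 pdvd_pX.
  by rewrite map_mxD.
rewrite FE measure_finType.
- rewrite (eq_bigr (fun=> (p%:R ^- (N * N))%:E)) => [|g _]; last first.
    by rewrite (haar_coset _ _ lamH) mul1n.
  have cX : #|{: X}| = card_GLF 'F_p N by rewrite card_sig.
  by rewrite sumEFin -cX mulr_natl sumr_const.
- by move=> g; apply: measurable_coset_pX.
- move=> g g' _ _ [Y [[T _ <-] [T' _ YT']]]; apply: val_inj.
  move: YT'; rewrite -!map_mxD => /(@toF_mx_inj p p_pr).
  move=> /(congr1 (map_mx (@padic_Fp p p_pr))); rewrite !map_mxD.
  have T0 (U : 'M[O]_N) : map_mx (@padic_Fp p p_pr) (pX 1 *: U) = 0.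
    by apply/matrixP => i j; rewrite !mxE; apply/eqP; rewrite padic_Fp_eq0 pdvd_pX.
  have L (h : 'M['F_p]_N) : map_mx (@padic_Fp p p_pr) (map_mx (Fp_lift p_pr) h) = h.
    by apply/matrixP => i j; rewrite !mxE Fp_liftK.
  by rewrite !T0 !addr0 !L => ->.
Qed.

End Haar.

(** * The law of the coefficients *)

Section Law.
Variables (R : realType) (p : nat) (p_pr : prime p).
Local Notation O := (padic_int p_pr).
Local Notation K := (padic p_pr).
Local Notation toF := (@toF p p_pr).
Variable lam : {measure set (borel 'M[K]_(1, 1)) -> \bar R}.
Hypothesis lamH : is_haar lam.
Variables (disp : measure_display) (Omega : measurableType disp).
Variable P : probability Omega R.
Variables (I : finType) (xi : I -> {RV P >-> borel K}).
Hypothesis xi_unif : forall i, uniform_Zp lam (xi i).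
Hypothesis xi_indep : mutually_independent xi.

Lemma prob_ball i m k :
  P (xi i @^-1` ball_pX m (toF k%:R)) = (p%:R ^- m)%:E.
Proof.
have := xi_unif i (measurable_ball_pX m (toF k%:R)).
rewrite /distribution /pushforward => ->.
(* The centre k is an integer, so the ball lies in Z_p and the intersection loses nothing. *)
rewrite (_ : _ `&` _ = coset_pX m (const_mx (toF k%:R))).
  by rewrite (haar_coset _ _ lamH) !muln1.
apply/seteqP; split=> [M [_ Mk]|M /coset_pXP Mk].
  by apply/coset_pXP => i0 j0; rewrite (ord1 i0) (ord1 j0) mxE.
split; last by have := Mk ord0 ord0; rewrite mxE.
move=> i0 j0; have [t ->] := Mk i0 j0; rewrite mxE -rmorphD.
by exists (k%:R + p%:R ^+ m * t).
Qed.

(** The uniform law places the coefficients in Z_p only almost surely; on this event they are read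
    as p-adic integers. *)
Definition integral_event : set Omega := [set w | forall i, padic_ring (xi i w)].

Definition residue_event m (q : {ffun I -> 'I_(p ^ m)}) : set Omega :=
  [set w | forall i, ball_pX m (toF (q i)%:R) (xi i w)].

Lemma residue_eventE m (q : {ffun I -> 'I_(p ^ m)}) :
  residue_event q = \bigcap_(i in [set` [set: I]%SET])
    (xi i @^-1` ball_pX m (toF (q i)%:R)).
Proof.
by apply/seteqP; split=> [w h i _|w h i]; apply: h; rewrite /= ?in_setT.
Qed.

Lemma measurable_residue_event m (q : {ffun I -> 'I_(p ^ m)}) :
  measurable (residue_event q).
Proof.
rewrite residue_eventE; apply: fin_bigcap_measurable => [|i _]; first exact: finite_finset.
rewrite -[X in measurable X]setTI; apply: measurable_funP => //.
exact: measurable_ball_pX.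
Qed.

Lemma prob_residue_event m (q : {ffun I -> 'I_(p ^ m)}) :
  P (residue_event q) = (p%:R ^- (m * #|I|))%:E.
Proof.
rewrite residue_eventE (xi_indep [set: I]%SET); last first.
  by move=> i; apply: measurable_ball_pX.
rewrite (eq_bigr (fun=> (p%:R ^- m)%:E)) => [|i _]; last exact: prob_ball.
rewrite prodEFin; congr EFin.
by rewrite big_const cardsT iter_mulr_1 exprVn exprM.
Qed.

(** At level 0 there is one residue, and its ball is Z_p. *)
Lemma integral_eventE : integral_event =
  residue_event ([ffun=> Ordinal (ltn0Sn 0)] : {ffun I -> 'I_(p ^ 0)}).
Proof.
apply/seteqP; split=> w h i; have := h i; rewrite padic_ringE ffunE.
  by rewrite rmorph0.
by rewrite /= rmorph0.
Qed.

Lemma prob_not_integral : P (~` integral_event) = 0%E.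
Proof.
rewrite probability_setC integral_eventE; last exact: measurable_residue_event.
by rewrite prob_residue_event mul0n expr0 invr1 subee.
Qed.

Lemma measurable_integral_event : measurable integral_event.
Proof. rewrite integral_eventE; exact: measurable_residue_event. Qed.

(* Junk value 0 off the almost sure event that all coefficients are integral. *)
Definition coef_int (w : Omega) (i : I) : O :=
  xget 0 [set z | toF z = xi i w /\ integral_event w].

Lemma coef_intP w i : integral_event w -> toF (coef_int w i) = xi i w.
Proof.
move=> wi; have [z _ zE] := wi i.
by have [] := @xgetPex _ 0 [set z | toF z = xi i w /\ integral_event w]
  (ex_intro _ z (conj zE wi)).
Qed.

Lemma coef_int0 w : ~ integral_event w -> coef_int w = fun=> 0.
Proof. by move=> nw; apply: funext => i; apply: xgetPN => z [_ /nw]. Qed.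

Lemma coef_int_residue m (q : {ffun I -> 'I_(p ^ m)}) w : integral_event w ->
  red_res m (coef_int w) = q <-> residue_event q w.
Proof.
move=> wi; rewrite -{1}(lift_resK p_pr q) red_resP.
split=> h i; have := h i; rewrite -coef_intP// ?ball_pX_natr//.
Qed.

Definition residue_set m (q : {ffun I -> 'I_(p ^ m)}) : set Omega :=
  [set w | red_res m (coef_int w) = q].

Lemma residue_setE m (q : {ffun I -> 'I_(p ^ m)}) : residue_set q =
  residue_event q `|` (~` integral_event `&` [set _ | red_res m (fun=> 0 : O) = q]).
Proof.
have sub w : residue_event q w -> integral_event w.
  by move=> h i; have [t ->] := h i; rewrite -rmorphD; eexists.
apply/seteqP; split=> [w|w [qw|[nw /= <-]]].
- have [wi|nw] := pselect (integral_event w).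
    by rewrite /residue_set /= => /(coef_int_residue _ wi); left.
  by rewrite /residue_set /= coef_int0// => h; right.
- exact/(coef_int_residue _ (sub _ qw)).
- by rewrite /residue_set /= coef_int0.
Qed.

Lemma measurable_not_integral_cst (Q : Prop) :
  measurable (~` integral_event `&` [set _ | Q]).
Proof.
have mN : measurable (~` integral_event).
  exact/measurableC/measurable_integral_event.
have [Qt|nQ] := pselect Q.
  by rewrite (_ : [set _ | Q] = setT) ?setIT//; apply/seteqP; split.
by rewrite (_ : [set _ | Q] = set0) ?setI0//; apply/seteqP; split.
Qed.

Lemma measurable_residue_set m (q : {ffun I -> 'I_(p ^ m)}) : measurable (residue_set q).
Proof.
rewrite residue_setE; apply: measurableU; first exact: measurable_residue_event.
exact: measurable_not_integral_cst.
Qed.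

Lemma prob_residue_set m (q : {ffun I -> 'I_(p ^ m)}) :
  P (residue_set q) = ((#|{: {ffun I -> 'I_(p ^ m)}}|%:R)^-1)%:E.
Proof.
pose N := ~` integral_event `&` [set _ | red_res m (fun=> 0 : O) = q].
have mN : measurable N by exact: measurable_not_integral_cst.
have N0 : P N = 0%E.
  apply: subset_measure0 prob_not_integral => //; last by move=> ? [].
  exact/measurableC/measurable_integral_event.
have mq := measurable_residue_event q.
have PU : P (residue_event q `|` N) = P (residue_event q) by exact: measureU0.
by rewrite residue_setE PU prob_residue_event card_residues -expnM natrX.
Qed.

Lemma coef_int_sum m (phi : (I -> O) -> R) w : res_periodic m phi ->
  phi (coef_int w) =
  \sum_(q : {ffun I -> 'I_(p ^ m)}) phi (lift_res p_pr q) * \1_(residue_set q) w.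
Proof.
move=> phim; rewrite (bigD1 (red_res m (coef_int w)))//= indicE mem_set// mulr1.
rewrite big1 ?addr0 => [|q qw]; first by apply: phim; apply/vcong_sym/lift_red_res.
rewrite indicE memNset ?mulr0// => h.
by move/eqP: qw; apply; rewrite -h.
Qed.

Lemma measurable_coef_int m (phi : (I -> O) -> R) : res_periodic m phi ->
  measurable_fun setT (fun w => phi (coef_int w)).
Proof.
move=> phim; rewrite (_ : (fun w => _) = fun w =>
  \sum_(q : {ffun I -> 'I_(p ^ m)}) phi (lift_res p_pr q) * \1_(residue_set q) w).
  apply: measurable_sum => q; apply: measurable_funM => //.
  exact/measurable_indic/measurable_residue_set.
by apply: funext => w; apply: coef_int_sum.
Qed.

(** A periodic [phi] is a finite combination of indicators of residue sets, all of the same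
    probability; this turns integrals over [Omega] into averages. *)
Lemma integral_coef_int m (phi : (I -> O) -> R) : res_periodic m phi ->
  (forall a, 0 <= phi a) -> (\int[P]_w (phi (coef_int w))%:E = (avg m phi)%:E)%E.
Proof.
move=> phim phi0.
under eq_integral do rewrite (coef_int_sum _ phim) -sumEFin.
rewrite ge0_integral_sum//=; last 2 first.
- move=> q; apply/measurable_EFinP; apply: measurable_funM => //.
  exact/measurable_indic/measurable_residue_set.
- by move=> q w _; rewrite lee_fin mulr_ge0.
rewrite /avg mulr_suml -sumEFin; apply: eq_bigr => q _.
under eq_integral do rewrite EFinM.
have mI : measurable_fun setT (fun w => (\1_(residue_set q) w : R)%:E).
  exact/measurable_EFinP/measurable_indic/measurable_residue_set.
rewrite ge0_integralZl//=; last by rewrite lee_fin.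
rewrite integral_indic//; last exact: measurable_residue_set.
by rewrite setIT EFinM; congr (_ * _)%E; exact: prob_residue_set.
Qed.

Lemma measurable_coef_int_set m (S : (I -> O) -> Prop) : res_periodic m (ind R S) ->
  measurable [set w | S (coef_int w)].
Proof.
move=> Sm; have -> : [set w | S (coef_int w)] =
    (fun w => ind R S (coef_int w)) @^-1` [set 1].
  apply/seteqP; split=> w /=; rewrite /ind; first by move=> h; rewrite asboolT.
  by case: asboolP => // _ /esym/eqP; rewrite oner_eq0.
rewrite -[X in measurable X]setTI; apply: (measurable_coef_int Sm) => //.
Qed.

Lemma prob_coef_int m (S : (I -> O) -> Prop) : res_periodic m (ind R S) ->
  P [set w | S (coef_int w)] = (avg m (ind R S))%:E.
Proof.
move=> Sm; rewrite -(integral_coef_int Sm (fun a => ind_ge0 R S a)).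
have mS := measurable_coef_int_set Sm.
have := integral_indic P measurableT mS; rewrite setIT => <-.
apply: eq_integral => w _; rewrite indicE /ind; congr ((_ : nat)%:R%:E).
Qed.

End Law.

Section MonotoneLimit.
Local Open Scope ereal_scope.
Context d (T : measurableType d) (R : realType).

(** Monotone convergence to the pointwise limit of the [g n], which is then exchanged for [f] by
    [ge0_integral_eq_off_null]. *)
Lemma cvg_integral_off_null (mu : {measure set T -> \bar R}) (N : set T)
    (g : nat -> T -> R) (f : T -> \bar R) :
  measurable N -> mu N = 0 -> (forall n, measurable_fun setT (g n)) ->
  (forall n w, (0 <= g n w)%R) ->
  (forall w m n, (m <= n)%N -> (g m w <= g n w)%R) ->
  (forall w, 0 <= f w) ->
  (forall w, ~ N w -> (g n w)%:E @[n --> \oo] --> f w) ->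
  \int[mu]_w (g n w)%:E @[n --> \oo] --> \int[mu]_w f w.
Proof.
move=> mN N0 mg g0 nd f0 gf.
have nd' w : nondecreasing_seq (fun n => (g n w)%:E).
  by move=> m n mn; rewrite lee_fin nd.
have gcvg w : cvgn (fun n => (g n w)%:E) by exact: ereal_nondecreasing_is_cvgn.
rewrite (@ge0_integral_eq_off_null _ _ _ mu N f (fun w => limn (fun n => (g n w)%:E)))//.
- apply: (@cvg_monotone_convergence _ _ _ mu setT measurableT (fun n w => (g n w)%:E)) => //.
    by move=> n; exact/measurable_EFinP.
  by move=> n w _; rewrite lee_fin.
- by move=> w; apply: lime_ge => //; apply: nearW => n; rewrite lee_fin.
- by move=> w /gf/cvg_lim ->.
Qed.

End MonotoneLimit.

(** * The Jacobian matrix *)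

Section PadicLimits.
Variables (p : nat) (p_pr : prime p).
Local Notation O := (padic_int p_pr).
Local Notation K := (padic p_pr).
Local Notation toF := (@toF p p_pr).
Local Notation pX m := (p%:R ^+ m : O).

Lemma padic_abs_toF (x : O) : padic_abs (toF x) = padic_int_abs x.
Proof.
have := @padic_abs_div p p_pr x 1 (oner_neq0 _); rewrite tofrac1 divr1 => ->.
have -> : padic_int_abs (1 : O) = 1.
  have := @padic_int_abs_unit p p_pr 0 1 (unitr1 _).
  by rewrite expr0 mulr1 invr1.
by rewrite divr1.
Qed.

Lemma padic_abs_pX_le m t : padic_abs (toF (pX m * t)) <= p%:R ^- m.
Proof.
have p0 : 0 < p%:R :> rat by rewrite ltr0n prime_gt0.
rewrite padic_abs_toF; have [->|t0] := eqVneq t 0.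
  by rewrite mulr0 /padic_int_abs eqxx invr_ge0 exprn_ge0// ltW.
have [q [u [uU ->]]] := pdvd_split t0.
rewrite mulrA -exprD padic_int_abs_unit// lef_pV2 ?posrE ?exprn_gt0//.
by rewrite ler_weXn2l ?leq_addr// ler1n prime_gt0.
Qed.

Lemma nbhs_padicP (x : K) (A : set K) : nbhs x A <-> exists m, ball_pX m x `<=` A.
Proof.
split=> [|[m mA]]; last exact: filterS mA (nbhs_pX x m).
move=> /nbhs_ballP[eps eps0 xA].
have [m me] : exists m, p%:R ^- m < eps.
  have p1 : (1 < p)%N by exact: prime_gt1.
  exists (Num.bound eps^-1); rewrite invf_plt ?posrE ?exprn_gt0 ?ltr0n ?prime_gt0//.
  apply: (lt_trans (archi_boundP _)); first by rewrite invr_ge0 ltW.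
  by rewrite -natrX ltr_nat ltn_expl.
exists m => y [t ->]; apply: xA; rewrite ballEmdist /=.
apply: le_lt_trans me; rewrite -[X in X <= _]/(padic_abs (x + toF (pX m * t) - x)).
by rewrite addrAC subrr add0r padic_abs_pX_le.
Qed.

Lemma padic_dnbhs_proper : ProperFilter (0^' : set_system K).
Proof.
apply: Build_ProperFilter_ex => A.
rewrite /dnbhs /= => /nbhs_padicP[m mA].
exists (toF (pX m)); apply: mA.
  by exists 1; rewrite add0r mulr1.
by rewrite tofrac_eq0 ppX_neq0.
Qed.

(** The limit sees only small increments, and these are integral; there g differs from l by a
    multiple of the increment. *)
Lemma padic_lim_dnbhs (g : K -> K) (l : K) :
  (forall z, z != 0 -> exists t, g (toF z) = l + toF (z * t)) ->
  lim (g @ 0^') = l.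
Proof.
move=> gl; have FF := padic_dnbhs_proper.
apply: (@cvg_lim _ (@metric_hausdorff _ K)).
move=> A /nbhs_padicP[m mA]; rewrite /nbhs /= /dnbhs /=.
apply/nbhs_padicP; exists m => _ [t ->]; rewrite add0r => z0; apply: mA.
have [u ->] := gl (pX m * t) (contra_neq (@congr1 _ _ toF _ 0) z0).
by exists (t * u); rewrite mulrA.
Qed.

End PadicLimits.

Section Jacobian.
Variables (p : nat) (p_pr : prime p).
Local Notation O := (padic_int p_pr).
Local Notation K := (padic p_pr).
Local Notation toF := (@toF p p_pr).
Variables (n k nu : nat) (hk : (k < n)%N) (d : 'I_nu -> nat).
Hypothesis hdim : (\sum_(j < nu) 'C(k + d j, d j))%N = (k.+1 * (n - k))%N.

Local Notation D := ((n - k) * k.+1)%N.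
Local Notation e := (flat_dim hk).

(** Listed in the order of [psi_coeffs], so that [row_cidx] names the coefficient in each row of
    psi. *)
Definition all_cidx : seq (cidx d k.+1) :=
  flatten [seq [seq Tagged (fun j => hmonom k.+1 (d j)) m | m <- enum {: hmonom k.+1 (d j)}]
          | j <- enum 'I_nu].

Lemma size_all_cidx : size all_cidx = D.
Proof.
rewrite mulnC -hdim size_flatten /shape -map_comp sumnE big_map big_enum /=.
by apply: eq_bigr => j _; rewrite size_map -cardE card_hmonom.
Qed.

Lemma mem_all_cidx c : c \in all_cidx.
Proof.
apply/flatten_mapP; exists (tag c); rewrite ?mem_enum//.
by apply/mapP; exists (tagged c); rewrite ?mem_enum//; case: c.
Qed.

Lemma uniq_all_cidx : uniq all_cidx.
Proof.
rewrite allpairs_uniq_dep ?enum_uniq// => [j _|]; first exact: enum_uniq.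
by move=> [j m] [j' m'] _ _ h; exact: h.
Qed.

Definition row_cidx (i : 'I_D) : cidx d k.+1 := tnth (Tuple (introT eqP size_all_cidx)) i.

Lemma row_cidxE c i : row_cidx i = nth c all_cidx i.
Proof. exact: tnth_nth. Qed.

Definition cidx_row (c : cidx d k.+1) : 'I_D :=
  cast_ord size_all_cidx (Ordinal (etrans (index_mem c all_cidx) (mem_all_cidx c))).

Lemma row_cidxK : cancel row_cidx cidx_row.
Proof.
move=> i; apply: val_inj; rewrite /= (row_cidxE (row_cidx i)).
by rewrite index_uniq ?uniq_all_cidx// size_all_cidx.
Qed.

Lemma cidx_rowK : cancel cidx_row row_cidx.
Proof.
move=> c; rewrite (row_cidxE c) /=.
by rewrite nth_index// mem_all_cidx.
Qed.

Local Notation psiZ := (@psiO p p_pr nu k.+1 (n - k) n.+1 D e d erefl row_cidx).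
Local Notation jacO := (@jac p p_pr nu k.+1 (n - k) n.+1 D e d erefl row_cidx).
Local Notation Amx := (@Amx p p_pr k.+1 (n - k) D erefl).

Lemma psi_toF (a : cidx d n.+1 -> O) x i :
  psi hk d (poly_system a) (map_mx toF (Amx x)) 0 i = toF (psiZ a x i 0).
Proof.
rewrite [LHS]mxE [psiZ a x i 0]mxE.
have -> : psi_coeffs hk d (poly_system a) (map_mx toF (Amx x)) =
    [seq toF (coefs (fun j => lsub (stk e (Amx x)) (forms a j)) c) | c <- all_cidx].
  rewrite /psi_coeffs /all_cidx map_flatten; congr flatten.
  rewrite -[RHS]map_comp; apply: eq_map => j /=.
  rewrite -[RHS]map_comp; apply: eq_map => m /=.
  rewrite /coefs /= -mcoeff_map_mpoly map_lsub map_stk -poly_systemE lsubE.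
  by [].
have isz : (i < size all_cidx)%N by rewrite size_all_cidx ltn_ord.
by rewrite (nth_map (row_cidx i) _ _ isz) -row_cidxE.
Qed.

Lemma Amx_delta (z : O) t :
  map_mx toF (Amx (z *: delta_mx t 0)) = vec_mx (toF z *: delta_mx 0 t).
Proof.
apply/matrixP => i j; rewrite !mxE andbC.
by rewrite rmorphM rmorph_nat.
Qed.

(** By [psi_taylor] the difference quotient at an integral z is exactly the entry of [jacO a] plus z
    times an integer of Q_p. *)
Lemma jacobian_toF (a : cidx d n.+1 -> O) :
  jacobian_psi hk d (poly_system a) = map_mx toF (jacO a).
Proof.
apply/matrixP => i t; rewrite [LHS]mxE [RHS]mxE.
apply: padic_lim_dnbhs => z z0.
have [Q QE] := psi_taylor e erefl row_cidx a (delta_mx t 0) z.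
exists (Q i 0).
have Fz0 : toF z != 0 by rewrite tofrac_eq0.
have E1 : psi hk d (poly_system a) (vec_mx (0 + toF z *: delta_mx 0 t)) 0 i =
    toF (psiZ a (z *: delta_mx t 0) i 0).
  by rewrite add0r -Amx_delta; apply: psi_toF.
have E0 : psi hk d (poly_system a) (vec_mx 0) 0 i = toF (psiZ a 0 i 0).
  have v0 : vec_mx (0 : 'rV[K]_D) = 0 by exact: linear0.
  have := psi_toF a 0 i; rewrite Amx0 map_mx0 => <-.
  by rewrite v0.
rewrite [X in _ * (X - _)]E1 [X in _ * (_ - X)]E0 QE -colE.
have -> : (psiZ a 0 + z *: col t (jacO a) + z ^+ 2 *: Q) i 0 =
    psiZ a 0 i 0 + z * (jacO a i t + z * Q i 0).
  rewrite [LHS]mxE [X in X + _]mxE [X in _ + X + _]mxE [X in _ + X]mxE [col _ _ _ _]mxE.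
  by ring.
rewrite rmorphD addrAC subrr add0r rmorphM mulrA mulVf// mul1r.
by rewrite rmorphD.
Qed.

End Jacobian.

(** * Expectations *)

Lemma card_set_finType (I : finType) (A : set I) : (A #= `I_#|[pred i | `[<A i>]]|)%card.
Proof.
pose Q : pred I := fun i => `[<A i>].
have -> : #|[pred i | `[<A i>]]| = #|` [fset i in Q]%fset| by rewrite card_finset; apply: eq_card.
have {1}-> : A = [set` [fset i in Q]%fset].
  by apply/seteqP; split=> i /=; rewrite in_fset inE.
exact/card_eq_fsetP.
Qed.

Lemma sum_ind (R : realType) (I : finType) (A : set I) :
  \sum_i ind R A i = #|[pred i | `[<A i>]]|%:R.
Proof.
by rewrite -natr_sum -sum1_card [in RHS]big_mkcond /=; congr (_%:R).
Qed.

Section Expectation.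
Variables (R : realType) (p : nat) (p_pr : prime p).
Local Notation O := (padic_int p_pr).
Local Notation K := (padic p_pr).
Local Notation toF := (@toF p p_pr).
Variables (nu r s N D : nat) (e : (r + s = N)%N) (d : 'I_nu -> nat).
Hypothesis DE : D = (s * r)%N.
Variable tau : 'I_D -> cidx d r.
Variable tau' : cidx d r -> 'I_D.
Hypothesis tauK : cancel tau tau'.

Local Notation T := (coset_reps 'F_p e).
Local Notation g := (@frame p p_pr r s N e).
Local Notation jac := (@jac p p_pr nu r s N D e d DE tau).
Local Notation ngood := (@ngood R p p_pr nu r s N D e d DE tau T g).
Local Notation zeros := (@zeros p p_pr nu r s N D e d DE tau T g).
Local Notation zero_jac := (@zero_jac p p_pr nu r s N D e d DE tau T g).
Local Notation regular_zeros := (@regular_zeros p p_pr nu r s N D e d DE tau T g).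
Local Notation bad_ball := (@bad_ball p p_pr nu r s N D e d DE tau T g).

Lemma ngood_card m a : exists2 n : nat,
  (regular_zeros m.+1 a #= `I_n)%card & ngood m a = n%:R.
Proof.
exists #|[pred tq | `[<@good_balls p p_pr nu r s N D e d DE tau T g m a tq>]]|.
  by apply: (card_eq_trans (card_regular_zeros _ _ _ _ _ _)); apply: card_set_finType.
exact: sum_ind.
Qed.

Lemma regular_zeros_le m m' a : (m <= m')%N -> regular_zeros m a `<=` regular_zeros m' a.
Proof. by move=> mm' tx [tz tJ]; split=> //; apply: contra tJ; apply: pdvd_le. Qed.

(** Although the balls change with m, [ngood m] counts the zeros with |det J| > p^-(m + 1), and
    these sets grow. *)
Lemma ngood_nondecreasing a m m' : (m <= m')%N -> ngood m a <= ngood m' a.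
Proof.
move=> mm'; have [i mi ->] := ngood_card m a; have [j mj ->] := ngood_card m' a.
rewrite ler_nat -card_le_II -(card_le_eql mi) -(card_le_eqr mj).
exact/subset_card_le/regular_zeros_le.
Qed.

Lemma ngood_ge0 m a : 0 <= ngood m a.
Proof. by have [i _ ->] := ngood_card m a. Qed.

Lemma cvg_ngood a : (forall tx, zeros a tx -> zero_jac a tx != 0) ->
  (ngood m a)%:E @[m --> \oo] --> (counting (zeros a) : \bar R).
Proof.
move=> reg; have /choice[n nE] m : exists n : nat,
    (regular_zeros m.+1 a #= `I_n)%card /\ ngood m a = n%:R.
  by have [n ? ?] := ngood_card m a; exists n.
have -> : (fun m => (ngood m a)%:E) = (fun m => (n m)%:R%:E).
  by apply: funext => m; case: (nE m) => _ ->.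
apply: (@counting_cvg R _ _ (fun m => regular_zeros m.+1 a)) => [m tx []//|m m' mm'|tx tz|m].
- exact: regular_zeros_le.
- have [q [t [tU J]]] := pdvd_split (reg _ tz).
  by exists q; split=> //; rewrite J pdvd_unit// ltnn.
- by have [] := nE m.
Qed.

Lemma cvg_trunc_abs (x : O) :
  (trunc_abs R m.+1 x)%:E @[m --> \oo] --> (ratr (padic_int_abs x) : R)%:E.
Proof.
have [->|x0] := eqVneq x 0.
  rewrite (_ : (fun m => _) = fun=> 0%E); last first.
    by apply: funext => m; rewrite /trunc_abs pdvd0.
  by rewrite /padic_int_abs eqxx rmorph0; apply: cvg_cst.
have [q [t [tU xE]]] := pdvd_split x0.
apply: cvg_near_cst; exists q => // m /= qm.
by rewrite /trunc_abs {1}xE pdvd_unit// leqNgt ltnS qm.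
Qed.

Variable lam : {measure set (borel 'M[K]_(1, 1)) -> \bar R}.
Hypothesis lamH : is_haar lam.
Variables (disp : measure_display) (Omega : measurableType disp).
Variable P : probability Omega R.
Variable xi : cidx d N -> {RV P >-> borel K}.
Hypothesis xi_unif : forall i, uniform_Zp lam (xi i).
Hypothesis xi_indep : mutually_independent xi.

Local Notation a := (coef_int xi).

(** Outside this set the coefficients are integral and no zero is singular, since by [zero_bad] a
    singular zero produces a bad ball for every m. *)
Definition exceptional : set Omega :=
  ~` integral_event xi `|` \bigcap_m [set w | bad_ball m (a w)].

Let res_periodic_bad m : res_periodic (2 * m.+1) (ind R (bad_ball m)).
Proof. by apply: ind_res_periodic => b b'; apply: bad_ball_cong; exact: frame_unit. Qed.

Lemma measurable_exceptional : measurable exceptional.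
Proof.
apply: measurableU; first exact/measurableC/measurable_integral_event.
apply: bigcap_measurableType => m _.
exact: (measurable_coef_int_set xi (@res_periodic_bad m)).
Qed.

Lemma prob_exceptional : P exceptional = 0%E.
Proof.
have mN : measurable (~` integral_event xi).
  exact/measurableC/measurable_integral_event.
have mB m : measurable [set w | bad_ball m (a w)].
  exact: (measurable_coef_int_set xi (@res_periodic_bad m)).
have mB' : measurable (\bigcap_m [set w | bad_ball m (a w)]).
  exact: bigcap_measurableType.
have B0 : P (\bigcap_m [set w | bad_ball m (a w)]) = 0%E.
  apply/eqP; rewrite eq_le measure_ge0 andbT; apply/lee_addgt0Pr => eps eps0.
  rewrite add0e.
  have [m me] : exists m, #|{: T}|%:R * p%:R ^- m.+1 <= eps.
    (* The archimedean property suffices, as m < p^(m + 1). *)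
    exists (Num.bound (#|{: T}|%:R / eps)).
    rewrite ler_pdivrMr ?exprn_gt0 ?ltr0n ?prime_gt0// -ler_pdivrMl// mulrC.
    apply/ltW/(lt_trans (archi_boundP _)); first by rewrite divr_ge0// ltW.
    by rewrite -natrX ltr_nat (ltn_trans (ltnSn _))// ltn_expl// prime_gt1.
  apply: (@le_trans _ _ (P [set w | bad_ball m (a w)])).
    by apply: le_measure; rewrite ?inE//; apply: bigcap_inf.
  rewrite (prob_coef_int lamH xi_unif xi_indep (@res_periodic_bad m)) lee_fin.
  apply: le_trans me; exact: (avg_bad_ball R e DE tauK (@frame_unit p p_pr r s N e)).
have PU : P exceptional = P (~` integral_event xi) by exact: measureU0.
by rewrite PU; exact: (prob_not_integral lamH xi_unif xi_indep).
Qed.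

(** Both integrals are monotone limits, related for each m by [avg_ngood]. [F] and [G] are
    prescribed on the integral event, where the coefficients can be read in Z_p. *)
Lemma expectation_zeros (F G : Omega -> \bar R) :
  (forall w, 0 <= F w)%E -> (forall w, 0 <= G w)%E ->
  (forall w, integral_event xi w -> F w = counting (zeros (a w))) ->
  (forall w, integral_event xi w -> G w = (ratr (padic_int_abs (\det (jac (a w)))))%:E) ->
  (\int[P]_w F w = (#|{: T}|%:R * p%:R ^- D)%:E * \int[P]_w G w)%E.
Proof.
move=> F0 G0 FE GE.
have mE := measurable_exceptional; have E0 := prob_exceptional.
have per_good m : res_periodic (2 * m.+1) (ngood m).
  exact: (ngood_cong R e DE tau (@frame_unit p p_pr r s N e)).
have per_jac m : res_periodic m.+1 (fun b => trunc_abs R m.+1 (\det (jac b))).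
  exact: trunc_jac_cong.
have limF : (\int[P]_w (ngood m (a w))%:E @[m --> \oo] --> \int[P]_w F w)%E.
  apply: (cvg_integral_off_null mE E0) => //.
  - by move=> m; apply: (measurable_coef_int xi (per_good m)).
  - by move=> m w; apply: ngood_ge0.
  - by move=> w m m' mm'; apply: ngood_nondecreasing.
  move=> w Ew; have wi : integral_event xi w.
    by apply: contrapT => nw; apply: Ew; left.
  rewrite FE//; apply: cvg_ngood => tx tz; apply/negP => /eqP J0.
  apply: Ew; right => m _; have [q bq] := zero_bad m tz J0.
  by exists (tx.1, q).
have limG : (\int[P]_w (trunc_abs R m.+1 (\det (jac (a w))))%:E @[m --> \oo]
    --> \int[P]_w G w)%E.
  apply: (cvg_integral_off_null mE E0) => //.
  - by move=> m; apply: (measurable_coef_int xi (per_jac m)).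
  - by move=> m w; apply: trunc_abs_ge0.
  - by move=> w m m' mm'; apply: trunc_abs_nondecreasing.
  move=> w Ew; have wi : integral_event xi w.
    by apply: contrapT => nw; apply: Ew; left.
  by rewrite GE//; apply: cvg_trunc_abs.
have E m : (\int[P]_w (ngood m (a w))%:E =
    (#|{: T}|%:R * p%:R ^- D)%:E * \int[P]_w (trunc_abs R m.+1 (\det (jac (a w))))%:E)%E.
  rewrite (integral_coef_int lamH xi_unif xi_indep (per_good m)); last first.
    by move=> b; apply: ngood_ge0.
  (* The truncated determinant has period p^(m + 1), but it is averaged modulo p^(2 (m + 1)), the
     modulus used for [ngood m]. *)
  have per_jac2 := res_periodic_le (_ : m.+1 <= 2 * m.+1)%N (per_jac m).
  rewrite (_ : \int[P]_w _ = (avg (2 * m.+1) (fun b => trunc_abs R m.+1 (\det (jac b))))%:E)%E.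
    rewrite -EFinM; congr EFin.
    exact: (avg_ngood R e DE tauK (@frame_unit p p_pr r s N e)).
  apply: (integral_coef_int lamH xi_unif xi_indep (per_jac2 _)) => [|b].
    by rewrite mul2n -addnn leq_addr.
  exact: trunc_abs_ge0.
have limF' := cvgeZl (y := (#|{: T}|%:R * p%:R ^- D)%:E) isT limG.
rewrite (_ : (fun m => _) = (fun m => \int[P]_w (ngood m (a w))%:E)%E) in limF'; last first.
  by apply: funext => m; rewrite E.
by rewrite -(cvg_lim _ limF)// -(cvg_lim _ limF').
Qed.

End Expectation.

(** * The total mass of the Grassmannian *)

Section GrassmannMeasure.
Variables (R : realType) (p : nat) (p_pr : prime p).
Local Notation K := (padic p_pr).
Variable lambda : forall m n, {measure set (borel 'M[K]_(m, n)) -> \bar R}.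
Hypothesis haar : forall a b, is_haar (lambda a b).

Lemma card_GLF_gt0 N : (0 < card_GLF 'F_p N)%N.
Proof. by apply/card_gt0P; exists 1%:M; rewrite inE unitmx1. Qed.

(** With r = k + 1 and s = n - k, the exponent (r + s)^2 = r^2 + s^2 + 2 r s leaves p^(-2 r s) after
    the division, and the r s free entries of the stabilizer give back p^(r s). *)
Lemma grassmann_measure_flats n k (hk : (k < n)%N) :
  grassmann_measure lambda hk (flats k) =
  (#|{: coset_reps 'F_p (flat_dim hk)}|%:R * p%:R ^- ((n - k) * k.+1))%:E.
Proof.
rewrite /grassmann_measure.
have -> : @GLZp p p_pr n.+1 `&` flat_of_GL hk @^-1` flats k = @GLZp p p_pr n.+1.
  apply/setIidl => M [MU _ _] /=; rewrite /flats /=.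
  rewrite /flat_of_GL; apply: (@dim_column_span _ _ _ _ _ (prj K (flat_dim hk) *m invmx M)).
  rewrite -mulmxA mulKmx// -[stack hk 0]/(stk (flat_dim hk) 0).
  exact: prj_stk.
rewrite !haar_GLZp//= -EFinM; congr EFin.
rewrite (card_coset_reps 'F_p (flat_dim hk)) card_Fp//.
set t := #|_|; set s := (n - k)%N; set r := k.+1.
have NE : n.+1 = (r + s)%N by rewrite flat_dim.
have g0 N : ((card_GLF 'F_p N)%:R : R) != 0 by rewrite pnatr_eq0 -lt0n card_GLF_gt0.
have p0 m : (p%:R ^+ m : R) != 0 by rewrite expf_neq0// pnatr_eq0 -lt0n prime_gt0.
clearbody t; clearbody s r; rewrite NE !natrM natrX.
have -> : ((r + s) * (r + s) = s * s + (r * r + (r * s + s * r)))%N.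
  by rewrite mulnDl !mulnDr addnA [LHS]addnC !addnA.
rewrite !exprD !invfM !invrK.
apply: (mulfI (p0 (s * r)%N)).
move: (g0 r) (g0 s) (p0 (s * s)%N) (p0 (r * r)%N) (p0 (r * s)%N) (p0 (s * r)%N).
move: (_ ^+ (s * s)) (_ ^+ (r * r)) (_ ^+ (r * s)) (_ ^+ (s * r)) => A B C E.
move: (card_GLF _ r)%:R (card_GLF _ s)%:R t%:R => gr gs tt hgr hgs hA hB hC hE.
by field; rewrite hgr hgs hA hB hC hE.
Qed.

End GrassmannMeasure.

Theorem theorem11 (R : realType) (p : nat) (p_pr : prime p)
  (lambda : forall a b : nat,
     {measure set (borel 'M[padic p_pr]_(a, b)) -> \bar R})
  (haar : forall a b : nat, is_haar (lambda a b))
  (n k nu : nat) (hn : (1 <= n)%N) (hk : (k < n)%N) (hnu : (1 <= nu)%N)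
  (d : 'I_nu -> nat) (hd : forall j, (1 <= d j)%N)
  (hdim : (\sum_(j < nu) 'C(k + d j, d j))%N = (k.+1 * (n - k))%N)
  (disp : measure_display) (Omega : measurableType disp)
  (P : probability Omega R)
  (xi : forall j : 'I_nu,
     hmonom n.+1 (d j) -> {RV P >-> borel (padic p_pr)})
  (xi_unif : forall j m, uniform_Zp (lambda 1%N 1%N) (xi j m))
  (xi_indep : mutually_independent
     (fun i : {j : 'I_nu & hmonom n.+1 (d j)} => xi (tag i) (tagged i))) :
  let f (w : Omega) (j : 'I_nu) := hpoly (fun m => xi j m w : padic p_pr) in
  (\int[P]_w counting (flats_on k (f w)) =
   grassmann_measure lambda hk (flats k) *
   'E_P[fun w => ratr (padic_abs (\det (jacobian_psi hk d (f w))))])%E.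
Proof.
move=> f; rewrite unlock (grassmann_measure_flats haar).
pose xi' (i : cidx d n.+1) := xi (tag i) (tagged i).
have fE w : integral_event xi' w -> f w = poly_system (coef_int xi' w).
  move=> wi; apply: funext => j; rewrite /f /poly_system; congr hpoly.
  by apply: funext => m; rewrite coef_intP.
(* Here D is (n - k)(k + 1) itself, so [DE] is [erefl] and matrix entries are numbered as by
   [vec_mx] in [jacobian_psi]. *)
apply: (@expectation_zeros R p p_pr nu k.+1 (n - k) n.+1 _ (flat_dim hk) d erefl
  (row_cidx hdim) (cidx_row hdim) (row_cidxK hdim) _ (haar 1%N 1%N) disp Omega P xi').
- by move=> i; apply: xi_unif.
- exact: xi_indep.
- by move=> w; rewrite /counting; case: ifP => _; rewrite ?lee_fin ?leey.
- by move=> w; rewrite lee_fin ler0q padic_abs_ge0.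
- move=> w wi; rewrite (fE w wi); apply: eq_counting.
  exact: (card_flats_zeros _ _ (cidx_rowK hdim)).
- move=> w wi; rewrite (fE w wi) jacobian_toF det_map_mx padic_abs_toF.
  by [].
Qed.
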